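(* Let $\Delta$ be a Moufang spherical building and let $F$ be a (non-empty) simplex of $\Delta$ which is not a chamber. Let $\mathrm{Aut}^\dagger(\Delta)$ be the group of automorphisms of $\Delta$ generated by all root groups, and let $\mathrm{Aut}^\dagger(\Delta)_F$ be the stabiliser of $F$ in it. Then the special projectivity group $\Pi^+(F)$ is permutation equivalent to the faithful permutation group induced by $\mathrm{Aut}^\dagger(\Delta)_F$ on the residue $\mathrm{Res}_\Delta(F)$.
   Context: Buildings are thick numbered simplicial chamber complexes with type set $I$; $\Delta$ spherical means its apartments are finite Coxeter complexes. In an apartment, two distinct vertices are opposite if every wall containing one contains the other; two simplices $A,B$ of an apartment are opposite if the vertex opposite each vertex of $A$ lies in $B$ and vice versa. Simplices of $\Delta$ are opposite if they are opposite in one (equivalently, every) apartment containing both. $\mathrm{Res}_\Delta(F)$ is the building induced on the vertices $v\notin F$ such that $F\cup\{v\}$ is a simplex. Projectivities: let $F,F'$ be opposite non-empty simplices which are not chambers. For a chamber $C\supseteq F$, let $\mathrm{proj}^F_{F'}(C)$ be the unique chamber containing $F'$ at minimal gallery distance from $C$. This induces an isomorphism $\mathrm{proj}^F_{F'}:\mathrm{Res}_\Delta(F)\to\mathrm{Res}_\Delta(F')$ (not necessarily type preserving), called a perspectivity. If $F_0,\dots,F_\ell$ are consecutively opposite simplices, the composition $\mathrm{proj}^{F_{\ell-1}}_{F_\ell}\circ\cdots\circ\mathrm{proj}^{F_0}_{F_1}$ is a projectivity of length $\ell$; it is even if $\ell$ is even and a self-projectivity of $F_0$ if $F_0=F_\ell$.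 $\Pi^+(F)$ is the group of all even self-projectivities of $F$, acting on $\mathrm{Res}_\Delta(F)$. Moufang: let $\Delta$ be irreducible of rank at least $2$. A root $\alpha$ is a half-apartment (image of a folding of an apartment), with boundary wall $\partial\alpha$. The root group $U_\alpha$ is the group of automorphisms of $\Delta$ fixing every chamber that has a panel in $\alpha\setminus\partial\alpha$. $\Delta$ is Moufang if for every root $\alpha$ the group $U_\alpha$ acts transitively on the set of apartments containing $\alpha$. *)

(* Defs.v *)
From HB Require Import structures.
From mathcomp Require Import all_boot.
From mathcomp Require Import boolp classical_sets functions cardinality.

Set Implicit Arguments.
Unset Strict Implicit.
Unset Printing Implicit Defensive.

Local Open Scope classical_set_scope.
Local Open Scope card_scope.

(* A complex with vertices in V is the set K of its simplices, each simplex
   being the set of its vertices; the empty simplex belongs to every complex.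
   Apartments, roots, walls and residues are all of type set (set V).  Maps
   between complexes are given on vertices by functions whose values outside
   the vertex set of the source are irrelevant. *)

Section Complexes.
Variable V : Type.
Implicit Types (K L S a : set (set V)) (A B C D P : set V) (f : V -> V).

Definition is_complex K :=
  K set0 /\ forall A B, K A -> B `<=` A -> K B.

Definition vertices K : set V := [set v | K [set v]].

Definition chamber K C := K C /\ forall D, K D -> C `<=` D -> D = C.

Definition panel_of P C := exists2 v, C v & P = C `\ v.

Definition panel K P := exists2 C, chamber K C & panel_of P C.

Definition adjacent K C D :=
  [/\ chamber K C, chamber K D, C <> D &
      exists P, panel_of P C /\ panel_of P D].

Fixpoint gallery K (n : nat) C D : Prop :=
  if n is m.+1 then exists2 E, adjacent K C E & gallery K m E D
  else chamber K C /\ C = D.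

Definition chamber_complex K :=
  [/\ is_complex K,
      forall A, K A -> exists2 C, chamber K C & A `<=` C &
      forall C D, chamber K C -> chamber K D -> exists n, gallery K n C D].

Definition chambers_on K A : set (set V) := [set C | chamber K C /\ A `<=` C].

Definition thick K := forall P, panel K P -> `I_3 #<= chambers_on K P.

Definition thin K := forall P, panel K P -> chambers_on K P #= `I_2.

Definition isomorphism K L f :=
  set_bij (vertices K) (vertices L) f /\
  forall A, A `<=` vertices K -> (K A <-> L (f @` A)).

Definition endomorphism K f :=
  (forall A, K A -> K (f @` A)) /\
  (forall C, chamber K C -> chamber K (f @` C)).

Definition folding K f :=
  [/\ endomorphism K f,
      forall v, vertices K v -> f (f v) = f v &
      forall C, chamber K C ->
        [set D | chamber K D /\ f @` D = f @` C] #= `I_2].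

(* Tits: a thin chamber complex such that every ordered pair of adjacent
   chambers (C, D) admits a folding mapping D to C. *)
Definition coxeter_complex K :=
  [/\ chamber_complex K, thin K &
      forall C D, adjacent K C D -> exists2 f, folding K f & f @` D = C].

Definition root S a := exists2 f, folding S f & a = [set f @` A | A in S].

(* The root -a of S, consisting of the chambers outside a and their faces. *)
Definition opposite_root S a : set (set V) :=
  [set A | exists C, [/\ chamber S C, ~ a C & A `<=` C]].

Definition boundary S a : set (set V) := a `&` opposite_root S a.

Definition wall S W := exists2 a, root S a & W = boundary S a.

Definition opposite_vertices S (v w : V) :=
  [/\ vertices S v, vertices S w, v <> w &
      forall W, wall S W -> (W [set v] <-> W [set w])].

Definition opposite_in S A B :=
  [/\ S A, S B,
      forall v, A v -> exists2 w, B w & opposite_vertices S v w &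
      forall w, B w -> exists2 v, A v & opposite_vertices S v w].

End Complexes.

(* A building with vertex set V.  The type set I is taken finite, which is
   automatic when the apartments are finite. *)
Record building (V : Type) (I : finType) := Building {
  simplices : set (set V);
  typ : V -> I;
  apartments : set (set (set V));
  vertexP : forall v, simplices [set v];
  chamber_complexP : chamber_complex simplices;
  typP : forall C, chamber simplices C -> set_bij C [set: I] typ;
  thickP : thick simplices;
  apartment_sub : forall S, apartments S -> S `<=` simplices;
  apartment_coxeter : forall S, apartments S -> coxeter_complex S;
  apartment_join : forall A B, simplices A -> simplices B ->
    exists S, [/\ apartments S, S A & S B];
  apartment_iso : forall S S' A B, apartments S -> apartments S' ->
    S A -> S B -> S' A -> S' B ->
    exists2 f, isomorphism S S' f & forall v, (A `|` B) v -> f v = v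
}.

Section PermutationGroups.

Definition perm_group (T : Type) (G : set (T -> T)) :=
  [/\ G id,
      forall f g, G f -> G g -> G (f \o g) &
      forall f, G f -> exists g, [/\ G g, cancel f g & cancel g f]].

Definition generated (T : Type) (X : set (T -> T)) : set (T -> T) :=
  [set f | forall G, perm_group G -> X `<=` G -> G f].

(* The permutations of the subset X that are restrictions of members of G. *)
Definition induced (T : Type) (X : set T) (G : set (T -> T)) : set (X -> X) :=
  [set h | exists2 g, G g & forall x : X, \val (h x) = g (\val x)].

Definition permutation_equivalent (T U : Type)
    (G : set (T -> T)) (H : set (U -> U)) :=
  exists (b : T -> U) (phi : (T -> T) -> (U -> U)),
    [/\ bijective b, set_bij G H phi,
        forall f g, G f -> G g -> phi (f \o g) = phi f \o phi g &
        forall f x, G f -> b (f x) = phi f (b x)].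

End PermutationGroups.

Section Buildings.
Variables (V : Type) (I : finType) (Delta : building V I).
Implicit Types (F A B C D : set V) (S a : set (set V)).

Local Notation simplices := (simplices Delta).
Local Notation apartments := (apartments Delta).

Definition spherical := forall S, apartments S -> finite_set S.

(* The entry m of the Coxeter matrix at (i, j): in an apartment, a simplex of
   cotype {i, j} lies in 2m chambers. *)
Definition coxeter_entry (i j : I) (m : nat) :=
  forall S A, apartments S -> S A -> typ Delta @` A = ~` [set i; j] ->
    chambers_on S A #= `I_(2 * m).

Definition diagram_edge (i j : I) := i <> j /\ ~ coxeter_entry i j 2.

(* Connectedness of the Coxeter diagram. *)
Definition irreducible :=
  forall J : set I, J !=set0 -> ~` J !=set0 ->
    exists i j, [/\ J i, ~ J j & diagram_edge i j].

Definition opposite A B := exists2 S, apartments S & opposite_in S A B.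

Definition res_vertices F : set V :=
  [set v | ~ F v /\ simplices (F `|` [set v])].

Definition residue F : set (set V) :=
  [set A | simplices A /\ A `<=` res_vertices F].

Definition nearest F C D :=
  chambers_on simplices F D /\
  exists2 n, gallery simplices n C D &
    forall E m, chambers_on simplices F E -> gallery simplices m C E -> n <= m.

Definition is_proj F C D := unique (nearest F C) D.

(* A chamber C containing F corresponds to the chamber C `\` F of the residue
   of F; f is the isomorphism of residues induced by proj^F_F'. *)
Definition perspectivity F F' (f : V -> V) :=
  [/\ opposite F F',
      F !=set0 /\ F' !=set0,
      ~ chamber simplices F /\ ~ chamber simplices F',
      isomorphism (residue F) (residue F') f &
      forall C, chambers_on simplices F C ->
        is_proj F' C (F' `|` f @` (C `\` F))].

Inductive projectivity : nat -> set V -> set V -> (V -> V) -> Prop :=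
| Projectivity0 F : projectivity 0 F F id
| ProjectivityS n F F' F'' f g :
    projectivity n F F' f -> perspectivity F' F'' g ->
    projectivity n.+1 F F'' (g \o f).

Definition special_projectivity_group F :
    set (res_vertices F -> res_vertices F) :=
  induced [set f | exists2 n, ~~ odd n & projectivity n F F f].

(* Automorphisms are not assumed to preserve types. *)
Definition automorphism (g : V -> V) := isomorphism simplices simplices g.

Definition root_group S a : set (V -> V) :=
  [set g | automorphism g /\
    forall C P, chamber simplices C -> panel_of P C ->
      a P -> ~ boundary S a P -> g @` C = C].

Definition moufang :=
  forall S a, apartments S -> root S a ->
  forall S1 S2, apartments S1 -> apartments S2 -> a `<=` S1 -> a `<=` S2 ->
    exists2 g, root_group S a g & [set g @` A | A in S1] = S2.

Definition aut_dagger : set (V -> V) :=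
  generated [set g | exists S a,
    [/\ apartments S, root S a & root_group S a g]].

Definition stabiliser (G : set (V -> V)) F : set (V -> V) :=
  [set g | G g /\ g @` F = F].

End Buildings.

Arguments induced {T} X G.
Arguments special_projectivity_group {V I} Delta F.

(* Main.v *)
(* Let F and F'' be opposite F'.  If g fixes all chambers containing F' and maps F
   to F'', then g induces on Res(F) the composition of the projections from F to F'
   and from F' to F''.  Such a g is a product of root elements, which carry a
   gallery from a chamber of F' to its projection on F, one step at a time, to the
   corresponding gallery towards F''; the roots contain F' in their interior, and
   a root group fixes all chambers containing an interior simplex of its root.
   Hence even projectivities are induced by the group generated by the root groups.

   Conversely, say that g acts projectively on F if g : Res(F) -> Res(gF) is an even
   projectivity.  Conjugating by a perspectivity shows that this property passes
   from F to every simplex opposite F.  Since panels are thick, all simplices of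
   the type of F are joined to F by chains of opposite simplices, and since the
   diagram is connected some simplex of that type lies in the interior of a given
   root; there the root group acts trivially, so root elements, and hence their
   products, act projectively on every simplex. *)

Require Import Defs.
From mathcomp Require Import all_boot.
From mathcomp Require Import boolp classical_sets functions cardinality.
From mathcomp Require Import zify.

Set Implicit Arguments.
Unset Strict Implicit.
Unset Printing Implicit Defensive.

Local Open Scope classical_set_scope.
Local Open Scope card_scope.

(** Chambers are encoded as functions from types to vertices, so that adjacency is differing at one
    type, and a wall enters only through the two sets of chambers it separates: it contains a
    simplex when chambers of the star lie on both sides. Most of the apartment geometry then follows
    from one inequality: reflecting a chamber across a wall brings it nearer to every chamber of the
    other side. Projections only use that opposite simplices lie in the same walls. Two obstacles
    shape the rest. Opposition and projection are maps on chambers that may change types, so that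
    they come from vertex maps has to be proved, by following the type of the image of a panel along
    galleries. And a root group is only given to stabilise chambers with an interior panel; passing
    to all chambers on an interior simplex means spreading fixed chambers from one apartment of a
    star to the others. *)

Lemma argmin T (P : set T) (f : T -> nat) : P !=set0 ->
  exists2 x, P x & forall y, P y -> f x <= f y.
Proof.
move=> [x Px]; move: {2}(f x) (leqnn (f x)) => n.
elim: n x Px => [|n IH] x Px le_n.
  by exists x => // y _; move: le_n; rewrite leqn0 => /eqP ->.
have [[y [Py lt]]|no] := pselect (exists y, P y /\ f y < f x).
  by apply: (IH y) => //; lia.
by exists x => // y Py; rewrite leqNgt; apply/negP => lt; apply: no; exists y.
Qed.

(** * Galleries and distance in sets of typed chambers *)

Section ChamberSets.
Variables (V : Type) (I : finType).
Local Notation ch := (I -> V).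
Implicit Types (A B : set ch) (a b c d e x y : ch) (i j k : I) (f g r : V -> V)
  (F : set V).

Definition adj i a b := a <> b /\ forall j, j <> i -> a j = b j.

Fixpoint gal A n a b : Prop :=
  if n is m.+1 then exists e i, [/\ A a, adj i a e & gal A m e b]
  else A a /\ a = b.

Definition conn A := forall a b, A a -> A b -> exists n, gal A n a b.

Definition dist A a b : nat :=
  xget 0 [set n | gal A n a b /\ forall m, gal A m a b -> n <= m].

Lemma adj_sym i a b : adj i a b -> adj i b a.
Proof. by move=> [ne ag]; split=> [/esym //|j ji]; rewrite ag. Qed.

Lemma adj_neq i a b : adj i a b -> a i <> b i.
Proof.
move=> [ne ag] e; apply: ne; apply/funext => j.
by have [->//|/eqP/ag] := eqVneq j i.
Qed.

Lemma adj_type i j a b : adj i a b -> a j <> b j -> j = i.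
Proof. by move=> [_ ag] ne; apply/eqP/negP => /negP/eqP/ag. Qed.

Lemma adj_uniq i j a b : adj i a b -> adj j a b -> i = j.
Proof. by move=> /adj_neq ni aj; apply: adj_type ni. Qed.

Lemma adj_trans i a b c : adj i a b -> adj i a c -> b = c \/ adj i b c.
Proof.
move=> [_ ab] [_ ac]; have [->|ne] := pselect (b = c); first by left.
by right; split=> // j ji; rewrite -ab // ac.
Qed.

Lemma adj_range i a b v : adj i a b -> range a v -> v <> a i -> range b v.
Proof.
move=> [_ ag] [j _ <-] ne; exists j => //; rewrite ag // => ji.
by apply: ne; rewrite ji.
Qed.

Lemma gal_in A n a b : gal A n a b -> A a /\ A b.
Proof.
elim: n a => [|n IH] a /=; first by move=> [? <-].
by move=> [e [i [Aa _ /IH[]]]].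
Qed.

Lemma gal_cat A n m a b c : gal A n a b -> gal A m b c -> gal A (n + m) a c.
Proof.
elim: n a => [|n IH] a /=; first by move=> [_ ->].
by move=> [e [i [Aa ae /IH h]]] /h h'; exists e, i.
Qed.

Lemma gal1 A i a b : A a -> A b -> adj i a b -> gal A 1 a b.
Proof. by move=> Aa Ab ab; exists b, i. Qed.

Lemma gal_sym A n a b : gal A n a b -> gal A n b a.
Proof.
elim: n a => [|n IH] a /=; first by move=> [Aa <-].
move=> [e [i [Aa ae h]]]; have [Ae _] := gal_in h.
by have := gal_cat (IH _ h) (gal1 Ae Aa (adj_sym ae)); rewrite addn1.
Qed.

Lemma gal_sub A B n a b : A `<=` B -> gal A n a b -> gal B n a b.
Proof.
move=> AB; elim: n a => [|n IH] a /=; first by move=> [/AB].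
by move=> [e [i [/AB Ba ae /IH h]]]; exists e, i.
Qed.

Lemma gal_exit A (P : ch -> bool) n a b : gal A n a b -> P a -> ~~ P b ->
  exists n1 n2 x y i, [/\ gal A n1 a x, gal A n2 y b, adj i x y,
    n = (n1 + n2).+1 & P x /\ ~~ P y].
Proof.
elim: n a => [|n IH] a /=; first by move=> [_ ->] ->.
move=> [e [i [Aa ae h]]] Pa nPb; have [Pe|nPe] := boolP (P e).
  have [n1 [n2 [x [y [k [h1 h2 xy -> hP]]]]]] := IH _ h Pe nPb.
  by exists n1.+1, n2, x, y, k; split=> //; exists e, i.
by exists 0, n, a, e, i.
Qed.

Lemma gal_map A B f n a b : (forall x, A x -> B (f \o x)) -> gal A n a b ->
  exists2 m, m <= n & gal B m (f \o a) (f \o b).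
Proof.
move=> fAB; elim: n a => [|n IH] a /=.
  by move=> [Aa <-]; exists 0 => //; split=> //; apply: fAB.
move=> [e [i [Aa ae h]]]; have [m mn h'] := IH _ h.
have [eq|ne] := pselect (f \o a = f \o e); first by exists m; [lia|rewrite eq].
exists m.+1 => //; exists (f \o e), i; split=> //; first exact: fAB.
by split=> // j ji; rewrite /= (proj2 ae).
Qed.

Section Dist.
Variable A : set ch.
Hypothesis cA : conn A.
Local Notation d := (dist A).

Lemma distP a b : A a -> A b -> gal A (d a b) a b.
Proof.
move=> Aa Ab; have [n h] := cA Aa Ab.
have [|m Pm mmin] := @argmin nat [set n | gal A n a b] id; first by exists n.
rewrite /dist; case: xgetP => [k -> [] //|] /(_ m) []; split=> //.
Qed.

Lemma dist_le n a b : gal A n a b -> d a b <= n.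
Proof.
move=> h; have [Aa Ab] := gal_in h.
have [|m Pm mmin] := @argmin nat [set n | gal A n a b] id; first by exists n.
by rewrite /dist; case: xgetP => [k -> [_ kmin]|] //; apply: kmin.
Qed.

Lemma distxx a : A a -> d a a = 0.
Proof. by move=> Aa; have := @dist_le 0 a a (conj Aa erefl); lia. Qed.

Lemma dist0 a b : A a -> A b -> d a b = 0 -> a = b.
Proof. by move=> Aa Ab e; have := distP Aa Ab; rewrite e => -[]. Qed.

Lemma distC a b : A a -> A b -> d a b = d b a.
Proof.
move=> Aa Ab; apply/eqP; rewrite eqn_leq.
by rewrite !dist_le //; apply/gal_sym/distP.
Qed.

Lemma dist_tri b a c : A a -> A b -> A c -> d a c <= d a b + d b c.
Proof. by move=> Aa Ab Ac; apply/dist_le/gal_cat; apply: distP. Qed.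

Lemma dist1 i a b : A a -> A b -> adj i a b -> d a b = 1.
Proof.
move=> Aa Ab ab; have := dist_le (gal1 Aa Ab ab).
have [e|] := eqVneq (d a b) 0; last by lia.
by case: ab => /(_ (dist0 Aa Ab e)).
Qed.

Lemma dist_step a b : A a -> A b -> a <> b ->
  exists e i, [/\ A e, adj i a e & d a b = (d e b).+1].
Proof.
move=> Aa Ab ne; have := distP Aa Ab; case E: (d a b) => [|n] /=.
  by move=> [_ /ne].
move=> [e [i [_ ae h]]]; have [Ae _] := gal_in h; exists e, i; split=> //.
have := dist_le h; have := dist_tri Aa Ae Ab; rewrite (dist1 Aa Ae ae); lia.
Qed.

Lemma dist_exit (P : ch -> bool) a b : A a -> A b -> P a -> ~~ P b ->
  exists x y i, [/\ A x, A y, adj i x y, P x /\ ~~ P y &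
    d a b = (d a x + d y b).+1].
Proof.
move=> Aa Ab Pa Pb.
have [n1 [n2 [x [y [i [h1 h2 xy e hP]]]]]] := gal_exit (distP Aa Ab) Pa Pb.
have [_ Ax] := gal_in h1; have [Ay _] := gal_in h2.
exists x, y, i; split=> //.
have := dist_le h1; have := dist_le h2; have := dist_tri Aa Ax Ab.
have := dist_tri Ax Ay Ab; rewrite (dist1 Ax Ay xy); lia.
Qed.

Definition btw a x b := d a x + d x b = d a b.

Lemma btw_anti a x y : A a -> A x -> A y -> btw a x y -> btw a y x -> x = y.
Proof.
rewrite /btw => Aa Ax Ay h1 h2; apply: dist0 => //.
by have := distC Ax Ay; lia.
Qed.

End Dist.

Lemma dist_map A B f a b : conn A -> conn B ->
  (forall x, A x -> B (f \o x)) -> A a -> A b ->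
  dist B (f \o a) (f \o b) <= dist A a b.
Proof.
move=> cA cB fAB Aa Ab; have [m mn h] := gal_map fAB (distP cA Aa Ab).
by have := dist_le h; lia.
Qed.

End ChamberSets.

(** * Foldings, roots, reflections and gates in a Coxeter complex *)

Section Coxeter.
Variables (V : Type) (I : finType) (typ : V -> I).
Local Notation ch := (I -> V).
Implicit Types (A B : set ch) (a b c e x y : ch) (i j k : I) (f r : V -> V)
  (F : set V) (H : ch -> bool).

(** The third clause is the two-to-one condition: over each image there is at most one moved
    chamber. *)
Definition fold A f := [/\ forall a, A a -> A (f \o a),
  forall a, A a -> f \o (f \o a) = f \o a &
  forall a b, A a -> A b -> f \o a = f \o b ->
    f \o a <> a -> f \o b <> b -> a = b].

Record coxeter A := Coxeter {
  cx_typ : forall a i, A a -> typ (a i) = i;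
  cx_conn : conn A;
  cx_nb : forall a i, A a -> exists2 b, A b & adj i a b;
  cx_thin : forall a b c i, A a -> A b -> A c -> adj i a b -> adj i a c -> b = c;
  cx_fold : forall a b i, A a -> A b -> adj i a b -> exists2 f, fold A f & f \o b = a
}.

Definition star A F : set ch := [set a | A a /\ F `<=` range a].

Definition side A c e : ch -> bool := fun a => dist A a c < dist A a e.

(* Roots are only meaningful up to their values outside A. *)
Definition rt A H := exists c e i, [/\ A c, A e, adj i c e &
  forall a, A a -> H a = side A c e a].

Definition cuts A H F := exists a b, [/\ star A F a, star A F b & H a != H b].

(** The last clause says that [r] fixes the wall of [H] pointwise, its vertices being those shared
    by chambers of both sides. *)
Definition refl A H r := [/\ forall a, A a -> A (r \o a),
  forall a, A a -> r \o (r \o a) = a,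
  forall a, A a -> H (r \o a) = ~~ H a &
  forall a b v, A a -> A b -> H a != H b -> range a v -> range b v -> r v = v].

Section Apartment.
Variable A : set ch.
Hypothesis cxA : coxeter A.
Let cA := cx_conn cxA.
Local Notation d := (dist A).

Section Fold.
Variable f : V -> V.
Hypothesis ff : fold A f.

Lemma fold_cross a b i : A a -> A b -> adj i a b -> f \o a = a ->
  f \o b <> b -> f \o b = a.
Proof.
case: ff => f1 _ _ Aa Ab ab fa fb.
have [//|ne] := pselect (f \o b = a); case: fb.
apply: (cx_thin cxA Aa (f1 _ Ab) Ab _ ab); split; first exact: nesym.
by move=> j ji; rewrite -[in LHS]fa /= (proj2 ab).
Qed.

(** A minimal gallery from [a] to [b] leaves the fixed chambers at some step [x], [y], which [f]
    folds together; the image gallery loses that step. *)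
Lemma fold_lt a b : A a -> A b -> f \o a = a -> f \o b <> b ->
  d a (f \o b) < d a b.
Proof.
move=> Aa Ab fa fb; case: (ff) => f1 _ _.
have [||x [y [i [Ax Ay xy [/asboolP Px /asboolPn Py] ->]]]] :=
  @dist_exit _ _ _ cA (fun x => `[< f \o x = x >]) a b Aa Ab; [exact/asboolP|exact/asboolPn|].
have := dist_map cA cA f1 Ay Ab; rewrite (fold_cross Ax Ay xy) //.
have := dist_tri cA Aa Ax (f1 _ Ab); lia.
Qed.

End Fold.

Lemma fold_side f a c e i : fold A f -> A c -> A e -> adj i c e ->
  f \o c = c -> f \o e <> e -> A a -> f \o a = a -> side A c e a.
Proof.
move=> ff Ac Ae ce fc fe Aa fa.
by rewrite /side -[X in d a X](fold_cross ff Ac Ae ce) // fold_lt.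
Qed.

Section Opposite.
Variables (f g : V -> V) (c e : ch) (i : I).
Hypotheses (ff : fold A f) (fg : fold A g) (Ac : A c) (Ae : A e)
  (ce : adj i c e) (fe : f \o e = c) (gc : g \o c = e).

Let fc : f \o c = c. Proof. by rewrite -fe; case: ff => _ ->. Qed.
Let ge : g \o e = e. Proof. by rewrite -gc; case: fg => _ ->. Qed.
Let fe' : f \o e <> e. Proof. by rewrite fe; case: ce. Qed.
Let gc' : g \o c <> c. Proof. by rewrite gc; case: ce => /nesym. Qed.

Lemma opp_disj a : A a -> f \o a = a -> g \o a <> a.
Proof.
move=> Aa fa ga.
have := fold_side ff Ac Ae ce fc fe' Aa fa.
by have := fold_side fg Ae Ac (adj_sym ce) ge gc' Aa ga; rewrite /side; lia.
Qed.

(** Induction along a minimal gallery from [a] to [c]. If [b] is the next chamber, [f \o (g \o a)]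
    agrees with [b] off one type and differs from [b], since both foldings are injective on the
    chambers they move; thinness leaves only [a]. *)
Lemma opp_fg a : A a -> f \o a = a -> f \o (g \o a) = a.
Proof.
case: (ff) => f1 _ f3; case: (fg) => g1 g2 g3.
move: {2}(d a c) (erefl (d a c)) => n; elim: n a => [|n IH] a dn Aa fa.
  by rewrite (dist0 cA Aa Ac dn) gc fe.
have [|b [k [Ab ab db]]] := dist_step cA Aa Ac.
  by move=> eq; move: dn; rewrite eq distxx.
have fb : f \o b = b.
  have [//|nb] := pselect (f \o b = b).
  have := fold_lt ff Ac Ab fc nb; rewrite (fold_cross ff Aa Ab ab) //.
  by rewrite (distC cA Ac) // (distC cA Ac) //; lia.
have fgb : f \o (g \o b) = b by apply: IH; [lia| |].
have ga := opp_disj Aa fa; have gb := opp_disj Ab fb.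
have Agga : g \o (g \o a) = g \o a by exact: g2.
have Aggb : g \o (g \o b) = g \o b by exact: g2.
have nga : f \o (g \o a) <> g \o a by move=> /(opp_disj (g1 _ Aa)) /(_ Agga).
have ngb : f \o (g \o b) <> g \o b by move=> /(opp_disj (g1 _ Ab)) /(_ Aggb).
have ne : f \o (g \o a) <> b.
  rewrite -fgb => /(f3 _ _ (g1 _ Aa) (g1 _ Ab)) /(_ nga ngb).
  move=> /(g3 _ _ Aa Ab) /(_ ga gb) eq.
  by case: ab => /(_ eq).
apply: (cx_thin cxA Ab (f1 _ (g1 _ Aa)) Aa _ (adj_sym ab)).
split; first exact: nesym.
by move=> j ji; rewrite -[in LHS]fgb /= (proj2 ab).
Qed.

(** Both [a] and [g \o (f \o a)] are moved by [f] and have image [f \o a], so they coincide, and the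
    latter is fixed by [g]. *)
Lemma opp_compl a : A a -> f \o a <> a -> g \o a = a.
Proof.
case: (ff) => f1 f2 f3; case: (fg) => g1 g2 _ Aa na.
have Afa := f1 _ Aa; have ffa := f2 _ Aa.
suff eq : g \o (f \o a) = a by rewrite -[in LHS]eq g2.
apply: f3 => //; [exact: g1|by rewrite opp_fg|].
move=> /(opp_disj (g1 _ Afa)); apply; exact: g2.
Qed.

End Opposite.

Lemma side_refl c e i : A c -> A e -> adj i c e ->
  (forall a, A a -> side A c e a = ~~ side A e c a) /\
  exists2 r, refl A (side A c e) r & r \o c = e.
Proof.
move=> Ac Ae ce.
have [f ff fe] := cx_fold cxA Ac Ae ce.
have [g fg gc] := cx_fold cxA Ae Ac (adj_sym ce).
have fc : f \o c = c by rewrite -fe; case: ff => _ ->.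
have ge : g \o e = e by rewrite -gc; case: fg => _ ->.
have fe' : f \o e <> e by rewrite fe; case: ce.
have gc' : g \o c <> c by rewrite gc; case: ce => /nesym.
have disj := opp_disj ff fg Ac Ae ce fe gc.
have compl := opp_compl ff fg Ac Ae ce fe gc.
have fgK := opp_fg ff fg Ac Ae ce fe gc.
have gfK := opp_fg fg ff Ae Ac (adj_sym ce) gc fe.
have hP a : A a -> side A c e a = `[< f \o a = a >].
  move=> Aa; case: asboolP => fa; first by rewrite (fold_side ff Ac Ae ce).
  apply/negbTE; have := fold_side fg Ae Ac (adj_sym ce) ge gc' Aa (compl _ Aa fa).
  by rewrite /side; lia.
have hP' a : A a -> side A e c a = ~~ `[< f \o a = a >].
  move=> Aa; case: asboolP => fa.
    by apply/negbTE; have := hP _ Aa; rewrite asboolT // /side; lia.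
  by rewrite (fold_side fg Ae Ac (adj_sym ce)) //; apply: compl.
split; first by move=> a Aa; rewrite hP // hP' // negbK.
(* The reflection is [g] on the half fixed by [f], and [f] on the other half; a vertex common to
   both halves is fixed by both foldings, so the choices are consistent. *)
pose r v := if pselect (exists a, [/\ A a, f \o a = a & range a v]) then g v else f v.
have r1 a : A a -> f \o a = a -> r \o a = g \o a.
  move=> Aa fa; apply/funext => j; rewrite /r /=; case: pselect => // -[].
  by exists a; split=> //; exists j.
have r2 a : A a -> f \o a <> a -> r \o a = f \o a.
  move=> Aa fa; apply/funext => j; rewrite /r /=; case: pselect => //= -[b [Ab fb [k _ eq]]].
  have -> : g (a j) = a j by rewrite -[in RHS](compl _ Aa fa).
  by rewrite -eq -[in LHS]fb.
case: (ff) => f1 f2 f3; case: (fg) => g1 g2 g3.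
have nf a : A a -> f \o a = a -> f \o (g \o a) <> g \o a.
  by move=> Aa fa /(disj _ (g1 _ Aa)); apply; apply: g2.
exists r; last by rewrite r1.
split.
- move=> a Aa; have [fa|fa] := pselect (f \o a = a); first by rewrite r1 //; apply: g1.
  by rewrite r2 //; apply: f1.
- move=> a Aa; have [fa|fa] := pselect (f \o a = a).
    by rewrite (r1 a) // r2; [exact: fgK|exact: g1|exact: nf].
  rewrite (r2 a) // r1; [|exact: f1|exact: f2].
  by apply: gfK => //; apply: compl.
- move=> a Aa; have [fa|fa] := pselect (f \o a = a).
    rewrite (r1 a) // hP ?hP //; last exact: g1.
    by rewrite (asboolT fa) asboolF //; apply: nf.
  rewrite (r2 a) // hP ?hP //; last exact: f1.
  by rewrite (asboolF fa) asboolT //; apply: f2.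
- move=> a b v Aa Ab; rewrite !hP // => ne va vb.
  wlog [fa fb] : a b Aa Ab va vb {ne} / f \o a = a /\ f \o b <> b.
    move: ne; case: asboolP => fa; case: asboolP => fb //= _ h; first exact: (h a b).
    exact: (h b a).
  move: va vb => [j _ <-] [k _ eq].
  have -> : r (a j) = g (a j) by rewrite -/((r \o a) j) r1.
  by rewrite -eq -[in RHS](compl _ Ab fb).
Qed.

Lemma rt_side c e i : A c -> A e -> adj i c e -> rt A (side A c e).
Proof. by move=> Ac Ae ce; exists c, e, i. Qed.

Lemma side_sep c e i : A c -> A e -> adj i c e -> side A c e c != side A c e e.
Proof.
move=> Ac Ae ce; rewrite /side !distxx // (distC cA Ae) // (dist1 cA Ac Ae ce) //.
Qed.

Lemma rt_compl H : rt A H -> rt A (fun a => ~~ H a).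
Proof.
move=> [c [e [i [Ac Ae ce HP]]]]; exists e, c, i; split=> //; first exact: adj_sym.
by move=> a Aa; rewrite HP // (proj1 (side_refl Ac Ae ce)) // negbK.
Qed.

Lemma rt_refl H : rt A H -> exists r, refl A H r.
Proof.
move=> [c [e [i [Ac Ae ce HP]]]]; have [_ [r [r1 r2 r3 r4] _]] := side_refl Ac Ae ce.
exists r; split=> //; first by move=> a Aa; rewrite !HP ?r3 //; apply: r1.
by move=> a b v Aa Ab; rewrite !HP //; apply: r4.
Qed.

Section Reflection.
Variables (H : ch -> bool) (r : V -> V).
Hypothesis rH : refl A H r.

Lemma refl_in a : A a -> A (r \o a). Proof. by case: rH => h _ _ _ /h. Qed.
Lemma reflK a : A a -> r \o (r \o a) = a. Proof. by case: rH => _ h _ _ /h. Qed.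
Lemma reflN a : A a -> H (r \o a) = ~~ H a. Proof. by case: rH => _ _ h _ /h. Qed.

Lemma refl_adj a b i : A a -> A b -> adj i a b -> H a != H b -> r \o a = b.
Proof.
move=> Aa Ab ab ne; case: (rH) => r1 r2 r3 r4.
apply: (cx_thin cxA Aa (r1 _ Aa) Ab _ ab); split.
  by move=> eq; have := r3 _ Aa; rewrite -eq; case: (H a).
move=> j ji; rewrite /= (r4 a b) //.
by exists j => //; rewrite (proj2 ab).
Qed.

Lemma refl_dist a b : A a -> A b -> d (r \o a) (r \o b) = d a b.
Proof.
move=> Aa Ab; have := dist_map cA cA refl_in Aa Ab.
have := dist_map cA cA refl_in (refl_in Aa) (refl_in Ab).
by rewrite !reflK //; lia.
Qed.

Lemma refl_lt a b : A a -> A b -> H a != H b -> d a (r \o b) < d a b.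
Proof.
move=> Aa Ab ne.
have [||x [y [i [Ax Ay xy [Px Py] ->]]]] :=
  @dist_exit _ _ _ cA (fun x => H x == H a) a b Aa Ab; rewrite ?eqxx //.
  by rewrite eq_sym.
have eq : r \o y = x.
  by apply: (@refl_adj y x i) => //; [exact: adj_sym|rewrite (eqP Px)].
have := refl_dist Ay Ab; rewrite eq.
have := dist_tri cA Aa Ax (refl_in Ab); lia.
Qed.

Lemma cuts_fix F v : cuts A H F -> F v -> r v = v.
Proof.
move=> [a [b [[Aa Fa] [Ab Fb] ne]]] Fv; case: rH => _ _ _ h.
by apply: (h a b) => //; [apply: Fa|apply: Fb].
Qed.

Lemma refl_star F a : (forall v, F v -> r v = v) -> star A F a -> star A F (r \o a).
Proof.
move=> fx [Aa Fa]; split; first exact: refl_in.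
by move=> v Fv; have [j _ eq] := Fa _ Fv; exists j => //=; rewrite eq fx.
Qed.

End Reflection.

(** The reflection of [H] exchanges [a] and [b], so [refl_lt] tells which of them is nearer to
    [x]. *)
Lemma rt_uniq H a b i : rt A H -> A a -> A b -> adj i a b -> H a -> ~~ H b ->
  forall x, A x -> H x = side A a b x.
Proof.
move=> rH Aa Ab ab Ha Hb x Ax; have [r rr] := rt_refl rH.
have ne : H a != H b by rewrite Ha; case: (H b) Hb.
have ra := refl_adj rr Aa Ab ab ne.
have rb : r \o b = a by rewrite -ra (reflK rr).
have [Hx|Hx] := boolP (H x); rewrite /side; symmetry.
  by have := @refl_lt _ _ rr x b Ax Ab; rewrite rb Hx; apply; case: (H b) Hb.
have := @refl_lt _ _ rr x a Ax Aa; rewrite ra Ha (negbTE Hx) => /(_ isT); lia.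
Qed.

Lemma rt_sep H a b i : rt A H -> A a -> A b -> adj i a b -> H a != H b ->
  forall x y, A x -> A y -> (H x != H y) = (side A a b x != side A a b y).
Proof.
move=> rH Aa Ab ab; case Ha: (H a); case Hb: (H b) => // _ x y Ax Ay.
  have HP := rt_uniq rH Aa Ab ab Ha (negbT Hb).
  by rewrite (HP x) // (HP y).
have HP := rt_uniq (rt_compl rH) Aa Ab ab (negbT Ha).
by rewrite -(HP _ x) ?Hb // -(HP _ y) ?Hb // (inj_eq negb_inj).
Qed.

(** Roots are convex: the mirror image of [x] would be nearer to both [a] and [b]. *)
Lemma btw_rt a x b H : A a -> A x -> A b -> btw A a x b -> rt A H -> H a = H b ->
  H x = H a.
Proof.
move=> Aa Ax Ab bt rH ab; have [//|ne] := eqVneq (H x) (H a).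
have [r rr] := rt_refl rH; have Ar := refl_in rr Ax.
have h1 : d a (r \o x) < d a x by rewrite (refl_lt rr) // eq_sym.
have h2 : d b (r \o x) < d b x by rewrite (refl_lt rr) // -ab eq_sym.
have := dist_tri cA Aa Ar Ab; move: bt; rewrite /btw.
have := distC cA Ab Ar; have := distC cA Ab Ax; lia.
Qed.

Lemma step_sep a b : A a -> A b -> a <> b -> exists e i, [/\ A e, adj i a e,
  d a b = (d e b).+1 & side A a e b = false].
Proof.
move=> Aa Ab ne; have [e [i [Ae ae dab]]] := dist_step cA Aa Ab ne.
exists e, i; split=> //; rewrite /side (distC cA Ab Aa) (distC cA Ab Ae); lia.
Qed.

Lemma sep_ex a b : A a -> A b -> a <> b -> exists2 H, rt A H & H a != H b.
Proof.
move=> Aa Ab ne; have [e [i [Ae ae _ h]]] := step_sep Aa Ab ne.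
exists (side A a e); first exact: rt_side ae.
by rewrite h /side distxx // (dist1 cA Aa Ae ae).
Qed.

(** Converse of convexity: the first wall crossed on the way from [a] to [x] also separates [a] from
    [b], so that step is progress towards both. *)
Lemma rt_btw a x b : A a -> A x -> A b ->
  (forall H, rt A H -> H a = H b -> H x = H a) -> btw A a x b.
Proof.
move=> Aa Ax Ab; move: {2}(d a x) (erefl (d a x)) => n.
elim: n a Aa => [|n IH] a Aa dn hx.
  by rewrite /btw dn (dist0 cA Aa Ax dn).
have [|e [i [Ae ae dax hE]]] := step_sep Aa Ax.
  by move=> eq; move: dn; rewrite eq distxx.
have rh := rt_side Aa Ae ae.
have ha : side A a e a by rewrite /side distxx // (dist1 cA Aa Ae ae).
have he : side A a e e = false by have := side_sep Aa Ae ae; rewrite ha; case: side.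
have hb : side A a e b = false.
  by case hb : side => //; have := hx _ rh; rewrite ha hb hE => /(_ erefl).
have : btw A e x b.
  apply: IH => //; first by lia.
  move=> H rH eb; have [eqa|nea] := eqVneq (H a) (H e); first by rewrite hx // eqa.
  have HP := rt_sep rH Aa Ae ae nea; apply/eqP/negPn.
  by rewrite HP // he hE.
have : d b a = (d b e).+1.
  have := dist_tri cA Ab Ae Aa; have := dist_tri cA Aa Ae Ab.
  have := distC cA Ab Aa; have := distC cA Ab Ae; have := dist1 cA Aa Ae ae.
  have := dist1 cA Ae Aa (adj_sym ae); have := proj1 (side_refl Aa Ae ae) _ Ab.
  by rewrite hb /side; lia.
by rewrite /btw; have := distC cA Ab Aa; have := distC cA Ab Ae; lia.
Qed.

(** * Gates *)

Definition gate c F (g : ch) := star A F g /\ forall x, star A F x -> btw A c g x.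

(** Otherwise the mirror image of [g] still contains [F] and is nearer to [c]. *)
Lemma gate_rt c F g H : A c -> gate c F g -> rt A H -> cuts A H F -> H g = H c.
Proof.
move=> Ac [[Ag Fg] gm] rH cu; have [//|ne] := eqVneq (H g) (H c).
have [r rr] := rt_refl rH.
have sr := refl_star rr (fun v => cuts_fix rr cu) (conj Ag Fg).
have := gm _ sr; rewrite /btw; have := @refl_lt _ _ rr c g Ac Ag.
by rewrite eq_sym => /(_ ne); lia.
Qed.

Lemma gate_ex c F : A c -> star A F !=set0 -> exists g, gate c F g.
Proof.
move=> Ac ne; have [g [Ag Fg] gm] := argmin (d c) ne; exists g; split=> //.
move=> x [Ax Fx]; apply: rt_btw => // H rH cx.
have [//|ne'] := eqVneq (H g) (H c).
have [r rr] := rt_refl rH.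
have cu : cuts A H F by exists g, x; split=> //; rewrite -cx.
have := gm _ (refl_star rr (fun v => cuts_fix rr cu) (conj Ag Fg)).
by have := @refl_lt _ _ rr c g Ac Ag; rewrite eq_sym => /(_ ne'); lia.
Qed.

(** [F] and [G] lie in the same walls; projections between stars rest on this consequence of
    opposition. *)
Definition par F G := forall H, rt A H -> (cuts A H F <-> cuts A H G).

Lemma par_sym F G : par F G -> par G F.
Proof. by move=> h H /h [h1 h2]. Qed.

(** The gate [b] is on the side of [a] of all walls through [G], which are the walls through [F];
    hence projecting back to [F] returns [a]. *)
Lemma gate_inv F G a b : par F G -> star A F a -> gate a G b -> gate b F a.
Proof.
move=> FG [Aa Fa] gb; have [[Ab Gb] gm] := gb; split=> // x [Ax Fx].
apply: rt_btw => // H rH bx; have [//|ne] := eqVneq (H a) (H b).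
have cu : cuts A H F by exists a, x; split=> //; rewrite -bx.
by move: ne; rewrite (gate_rt Aa gb rH) ?eqxx //; apply/FG.
Qed.

Lemma gate_refl F c b H r : refl A H r -> (forall v, F v -> r v = v) ->
  A c -> gate c F b -> gate (r \o c) F (r \o b).
Proof.
move=> rr fx Ac [[Ab Fb] gm]; split; first exact: (refl_star rr).
move=> x xs; have [Ax _] := xs.
have sx := refl_star rr fx xs; have [Arx _] := sx; have := gm _ sx.
rewrite /btw; have := refl_dist rr Ac Ab; have := refl_dist rr Ab Arx.
have := refl_dist rr Ac Arx; rewrite (reflK rr) //.
lia.
Qed.

(** The wall between [a] and [a'] contains [F], hence [G], so its reflection carries the gate of [a]
    to that of [a']. The first wall met between the two gates also contains both simplices and
    separates [a] from [a']; so it is the same wall, and the gates are adjacent. *)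
Lemma gate_adj F G a a' b i : par F G -> star A F a -> star A F a' -> adj i a a' ->
  gate a G b -> exists r k, [/\ refl A (side A a a') r, r \o a = a',
    forall v, F v \/ G v -> r v = v, gate a' G (r \o b) & adj k b (r \o b)].
Proof.
move=> FG [Aa Fa] [Aa' Fa'] aa' gb; have [[Ab Gb] gm] := gb.
have rH := rt_side Aa Aa' aa'; have [_ [r rr ra]] := side_refl Aa Aa' aa'.
have cF : cuts A (side A a a') F by exists a, a'; split=> //; apply: side_sep aa'.
have cG : cuts A (side A a a') G by apply/FG.
have rG v : G v -> r v = v by exact: (cuts_fix rr cG).
have ga' : gate a' G (r \o b) by rewrite -ra; exact: (gate_refl rr rG).
have Ar := refl_in rr Ab.
have hb := gate_rt Aa gb rH cG; have hrb := reflN rr Ab.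
have ne : b <> r \o b by move=> eq; move: hrb; rewrite -eq; case: side.
have [e [k [Ae be _ he]]] := step_sep Ab Ar ne.
have rH' := rt_side Ab Ae be.
have s1 := side_sep Ab Ae be.
have hbb : side A b e b by rewrite /side distxx // (dist1 cA Ab Ae be).
have cG' : cuts A (side A b e) G.
  by exists b, (r \o b); split; [by []|by case: ga'|rewrite hbb he].
have cF' : cuts A (side A b e) F by apply/FG.
have e1 := gate_rt Aa gb rH' cG'; have e2 := gate_rt Aa' ga' rH' cG'.
have s2 : side A b e a != side A b e a' by rewrite -e1 -e2 hbb he.
have := rt_sep rH' Aa Aa' aa' s2 Ab Ae; rewrite s1 => /esym s3.
exists r, k; split=> //; last by rewrite (refl_adj rr Ab Ae be s3).
by move=> v [|/rG //]; exact: (cuts_fix rr cF).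
Qed.

End Apartment.
End Coxeter.

(** * Isomorphisms of apartments *)

Section Isomorphisms.
Variables (V : Type) (I : finType) (typ : V -> I).
Local Notation ch := (I -> V).
Local Notation coxeter := (coxeter typ).
Implicit Types (A B : set ch) (a b c e x y : ch) (i j k : I) (f r : V -> V)
  (F G : set V) (H : ch -> bool).

Definition iso A B f := (forall a, A a -> B (f \o a)) /\
  (forall a b i j, A a -> A b -> f (a i) = f (b j) -> a i = b j).

Lemma iso_inj A B f a b : iso A B f -> A a -> A b -> f \o a = f \o b -> a = b.
Proof.
by move=> [_ h] Aa Ab e; apply/funext => i; apply: h => //; apply: (congr1 (@^~ i) e).
Qed.

Lemma iso_adj A B f i a b : iso A B f -> A a -> A b -> adj i a b ->
  adj i (f \o a) (f \o b).
Proof.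
move=> fi Aa Ab [ne ag]; split; first by move/(iso_inj fi Aa Ab).
by move=> j ji; rewrite /= ag.
Qed.

Lemma refl_iso A H r : refl A H r -> iso A A r.
Proof.
move=> [r1 r2 _ _]; split=> // a b i j Aa Ab e.
rewrite -(congr1 (@^~ i) (r2 _ Aa)) -(congr1 (@^~ j) (r2 _ Ab)) /=.
by rewrite e.
Qed.

Lemma iso_comp A B C f g : iso A B f -> iso B C g -> iso A C (g \o f).
Proof.
move=> [f1 f2] [g1 g2]; split; first by move=> a /f1/g1.
by move=> a b i j Aa Ab /(g2 _ _ _ _ (f1 _ Aa) (f1 _ Ab)); apply: f2.
Qed.

Section TwoApartments.
Variables A B : set ch.
Hypotheses (cxA : coxeter A) (cxB : coxeter B).
Variable f : V -> V.
Hypothesis fi : iso A B f.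
Let cA := cx_conn cxA.
Let cB := cx_conn cxB.

Let fin a : A a -> B (f \o a). Proof. by case: fi => h _ /h. Qed.

Lemma iso_nb i a y : A a -> B y -> adj i (f \o a) y ->
  exists b, [/\ A b, adj i a b & f \o b = y].
Proof.
move=> Aa By ay; have [b Ab ab] := cx_nb cxA i Aa; exists b; split=> //.
exact: (cx_thin cxB (fin Aa) (fin Ab) By (iso_adj fi Aa Ab ab) ay).
Qed.

Lemma iso_gal n a y : A a -> gal B n (f \o a) y ->
  exists b, [/\ A b, f \o b = y & gal A n a b].
Proof.
elim: n a => [|n IH] a Aa /=; first by move=> [_ <-]; exists a.
move=> [e [i [_ ae h]]]; have [Be _] := gal_in h.
have [b [Ab ab eq]] := iso_nb Aa Be ae.
rewrite -eq in h; have [b' [Ab' eq' h']] := IH _ Ab h.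
by exists b'; split=> //; exists b, i.
Qed.

Lemma iso_dist a b : A a -> A b -> dist B (f \o a) (f \o b) = dist A a b.
Proof.
move=> Aa Ab; apply/eqP; rewrite eqn_leq dist_map //.
have [b' [Ab' e h]] := iso_gal Aa (distP cB (fin Aa) (fin Ab)).
by move/(iso_inj fi Ab' Ab): e h => <- h; apply: dist_le h.
Qed.

Lemma iso_surj y : A !=set0 -> B y -> exists2 b, A b & f \o b = y.
Proof.
move=> [a Aa] By; have [b [Ab e _]] := iso_gal Aa (distP cB (fin Aa) By).
by exists b.
Qed.

Lemma iso_side c e a : A c -> A e -> A a ->
  side B (f \o c) (f \o e) (f \o a) = side A c e a.
Proof. by move=> Ac Ae Aa; rewrite /side !iso_dist. Qed.

Lemma iso_rt H : A !=set0 -> rt B H -> rt A (fun a => H (f \o a)).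
Proof.
move=> ne [c [e [i [Bc Be ce HP]]]].
have [c' Ac' ec] := iso_surj ne Bc; rewrite -ec in ce.
have [e' [Ae' ae' ee]] := iso_nb Ac' Be ce.
exists c', e', i; split=> // a Aa.
by rewrite HP; [rewrite -ec -ee iso_side|exact: fin].
Qed.

Lemma iso_star F a : star A F a -> star B (f @` F) (f \o a).
Proof.
move=> [Aa Fa]; split; first exact: fin.
by move=> _ [v Fv <-]; have [j _ <-] := Fa _ Fv; exists j.
Qed.

Lemma iso_star_inv F a b : star A F b -> A a -> star B (f @` F) (f \o a) -> star A F a.
Proof.
move=> [Ab Fb] Aa [_ Fa]; split=> // v Fv; have [j _ e] := Fb _ Fv.
have [|k _ ek] := Fa (f v); first by exists v.
by exists k => //; rewrite -e; case: fi => _ h; apply: h => //; rewrite e.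
Qed.

Lemma iso_cuts F H : star A F !=set0 ->
  cuts B H (f @` F) <-> cuts A (fun a => H (f \o a)) F.
Proof.
move=> [c sc]; split=> -[a [b [sa sb ne]]].
  have [a' Aa' ea] := iso_surj (ex_intro _ _ (proj1 sc)) (proj1 sa).
  have [b' Ab' eb] := iso_surj (ex_intro _ _ (proj1 sc)) (proj1 sb).
  exists a', b'; rewrite ea eb; split=> //.
    by apply: (iso_star_inv sc) => //; rewrite ea.
  by apply: (iso_star_inv sc) => //; rewrite eb.
by exists (f \o a), (f \o b); split=> //; apply: iso_star.
Qed.

(** Rigidity: along a gallery from [c], thinness forces the image of each next chamber. *)
Lemma iso_uniq f' c a : iso A B f' -> A c -> f \o c = f' \o c -> A a ->
  f \o a = f' \o a.
Proof.
move=> fi' Ac + Aa; have := distP cA Ac Aa; move: (dist A c a) => n.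
elim: n c Ac => [|n IH] c Ac /=; first by move=> [_ ->].
move=> [e [i [_ ce h]]] ec; have [Ae _] := gal_in h; apply: IH h _ => //.
apply: (cx_thin cxB (fin Ac) (fin Ae)); first by case: fi' => + _; apply.
  exact: (iso_adj fi Ac Ae ce).
by rewrite ec; apply: (iso_adj fi' Ac Ae ce).
Qed.

End TwoApartments.
End Isomorphisms.

(* An adjacency-preserving bijection between sets of chambers carries the
   chambers containing a vertex to the chambers containing some vertex, as soon
   as the type of the image of a panel is locally constant (hypothesis sq). *)
Section Transfer.
Variables (V : Type) (I : finType) (P : set (I -> V)) (T : (I -> V) -> (I -> V)).
Hypotheses
  (pres : forall x y i, P x -> P y -> adj i x y -> exists k, adj k (T x) (T y))
  (refl : forall x y k, P x -> P y -> adj k (T x) (T y) -> exists i, adj i x y)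
  (inj : forall x y, P x -> P y -> T x = T y -> x = y)
  (sq : forall x y x' i j, P x -> P y -> P x' -> adj j x y -> j <> i -> adj i x x' ->
    exists x1 y1 k, [/\ P x1 /\ P y1, adj i x x1, adj i y y1,
      adj k (T x) (T x1) & adj k (T y) (T y1)]).

(** The chambers of a panel are pairwise adjacent, and so are their images; with two different image
    types, [T x'] and [T x''] would differ at two types. *)
Lemma transfer_type x x' x'' i k : P x -> P x' -> P x'' -> adj i x x' -> adj i x x'' ->
  adj k (T x) (T x') -> adj k (T x) (T x'').
Proof.
move=> Px Px' Px'' xx' xx'' h; have [k' h'] := pres Px Px'' xx''.
have [e|xx] := adj_trans xx' xx''; first by rewrite -e.
have [l hl] := pres Px' Px'' xx.
have [->//|ne] := eqVneq k k'; case: (adj_neq h').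
have lk : l = k'.
  apply/esym/(adj_type hl); rewrite -(proj2 h) ?(rwP eqP) 1?eq_sym //.
    exact: adj_neq h'.
  by apply/eqP; rewrite eq_sym.
have : k = l; last by rewrite lk => /eqP; rewrite (negbTE ne).
apply: (adj_type hl); rewrite -(proj2 h' k); last exact/eqP.
exact/nesym/(adj_neq h).
Qed.

Lemma transfer v x y x' i k n : x i = v -> P x -> P x' -> adj i x x' -> adj k (T x) (T x') ->
  gal [set z | P z /\ z i = v] n x y -> T y k = T x k.
Proof.
elim: n x x' => [|n IH] x x' xv Px Px' xx' h /=; first by move=> [_ ->].
move=> [z [j [_ xz hz]]]; have [[Pz zi] _] := gal_in hz.
have ji : j <> i by move=> e; apply: (adj_neq xz); rewrite e xv zi.
have [x1 [z1 [l [[Px1 Pz1] xx1 zz1 hx1 hz1]]]] := sq Px Pz Px' xz ji xx'.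
have lk : l = k.
  exact: adj_uniq hx1 (transfer_type Px Px' Px1 xx' xx1 h).
rewrite lk in hz1; rewrite (IH z z1) //.
(* If the step to [z] also had image type [k], then [T x'] and [T z] would be equal or adjacent,
   hence so would [x'] and [z], which differ at the two types [i] and [j]. *)
have [l' hl'] := pres Px Pz xz; apply/esym; rewrite (proj2 hl') // => e.
rewrite -e in hl'.
have [eq|/(refl Px' Pz)[t ht]] := adj_trans h hl'.
  move/(inj Px' Pz): eq => eq; rewrite eq in xx'; exact: ji (adj_uniq xz xx').
have ti : i = t by apply: (adj_type ht); rewrite zi -xv; apply/nesym/(adj_neq xx').
have tj : j = t.
  by apply: (adj_type ht); rewrite -(proj2 xx') //; apply: (adj_neq xz).
by apply: ji; rewrite tj.
Qed.

End Transfer.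

(** * Opposition, the flag property and the diagram in a Coxeter complex *)

Section Opposition.
Variables (V : Type) (I : finType) (typ : V -> I).
Local Notation ch := (I -> V).
Local Notation coxeter := (coxeter typ).
Implicit Types (A B : set ch) (a b c e x y : ch) (i j k : I) (f r : V -> V)
  (F G : set V) (H : ch -> bool) (v w : V).

Definition bounded A := exists N, forall a b, A a -> A b -> dist A a b <= N.

(** [b] is opposite [a] in the star of [F]; the case [F = set0] is opposition of chambers. *)
Definition far A F a b := [/\ star A F a, star A F b &
  forall H, rt A H -> cuts A H F -> H a != H b].

Definition opp A a b := far A set0 a b.

(** Opposition of chambers exchanges the two stars; [opp_simplexP] relates this to the definition
    vertex by vertex. *)
Definition opp_simplex A F G := [/\ star A F !=set0, star A G !=set0 &
  forall a b, opp A a b -> (star A F a <-> star A G b)].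

Section Apartment.
Variable A : set ch.
Hypothesis cxA : coxeter A.
Let cA := cx_conn cxA.
Local Notation d := (dist A).

Lemma chamber_vertex a b i j : A a -> A b -> a i = b j -> i = j.
Proof. by move=> Aa Ab e; rewrite -(cx_typ cxA i Aa) e (cx_typ cxA). Qed.

Lemma star_vertex a b F v i : star A F a -> A b -> F v -> v = b i -> a i = b i.
Proof.
move=> [Aa Fa] Ab Fv e; have [j _ ej] := Fa _ Fv.
rewrite e in ej; by rewrite -{1}(chamber_vertex Aa Ab ej).
Qed.

Lemma star1 a i b : A b -> star A [set a i] b -> A a -> b i = a i.
Proof. by move=> Ab s Aa; apply: (star_vertex s Aa). Qed.

Lemma star_set1 a i : A a -> star A [set a i] a.
Proof. by move=> Aa; split=> // _ ->; exists i. Qed.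

Lemma star_adj a b i F : star A F a -> A b -> adj i a b -> ~ F (a i) -> star A F b.
Proof.
move=> [Aa Fa] Ab ab nF; split=> // v Fv.
by apply: (adj_range ab (Fa _ Fv)) => e; apply: nF; rewrite -e.
Qed.

(** The walls crossed by a minimal gallery separate [x] from [y], so they contain [F], and their
    reflections preserve the star. *)
Lemma star_gal F x y : star A F x -> star A F y -> gal (star A F) (d x y) x y.
Proof.
move=> + sy; have Ay := proj1 sy.
move: {-1}(d x y) (erefl (d x y)) => n; elim: n x => [|n IH] x dn sx.
  by have := dist0 cA (proj1 sx) Ay dn.
have Ax := proj1 sx.
have [|e [i [Ae xe dxy hy]]] := step_sep cxA Ax Ay.
  by move=> eq; move: dn; rewrite eq distxx.
have [_ [r rr re]] := side_refl cxA Ax Ae xe.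
have hx : side A x e x by rewrite /side distxx // (dist1 cA Ax Ae xe).
have cu : cuts A (side A x e) F by exists x, y; split=> //; rewrite hx hy.
exists e, i; split=> //; apply: IH; first lia.
by rewrite -re; apply: (refl_star rr) => // v; apply: (cuts_fix rr cu).
Qed.

Lemma star_inj F G : star A F !=set0 -> star A F = star A G -> F `<=` G.
Proof.
move=> [b sb] e v Fv; have [j _ ej] := (proj2 sb) _ Fv; have Ab := proj1 sb.
have [//|nG] := pselect (G v); have [b' Ab' bb'] := cx_nb cxA j Ab.
have : star A F b'.
  by rewrite e; apply: (star_adj _ Ab' bb'); rewrite -?e // ej.
move=> s; case: (adj_neq bb'); apply/esym.
exact: star_vertex s Ab Fv (esym ej).
Qed.

Lemma rt_sub_cuts H F G : F `<=` G -> cuts A H G -> cuts A H F.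
Proof.
move=> FG [a [b [[Aa Ga] [Ab Gb] ne]]]; exists a, b; split=> //; split=> //;
 exact: subset_trans FG _.
Qed.

Lemma side_ncuts a b i F : A a -> A b -> adj i a b -> star A F a -> F (a i) ->
  ~ cuts A (side A a b) F.
Proof.
move=> Aa Ab ab sa Fa cu; have [_ [r rr ra]] := side_refl cxA Aa Ab ab.
by case: (adj_neq ab); rewrite -(cuts_fix rr cu Fa) -[in RHS]ra.
Qed.

Section Far.
Hypothesis bdA : bounded A.

Lemma far_sym F a b : far A F a b -> far A F b a.
Proof. by move=> [sa sb h]; split=> // H rH cH; rewrite eq_sym h. Qed.

(** A chamber of the star at maximal distance from [a] works: on the side of [a] of a wall through
    [F], it could be reflected further away. Minimising [N - d a x], with [N] a bound, gives the
    maximum. *)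
Lemma far_ex F a : star A F a -> exists b, far A F a b.
Proof.
move=> sa; have [Aa Fa] := sa; have [N dN] := bdA.
have [|b sb bm] := argmin (fun x => N - d a x) (P := star A F); first by exists a.
exists b; split=> // H rH cH; apply/negP => /eqP e.
have [r rr] := rt_refl cxA rH.
have sr := refl_star rr (fun v => cuts_fix rr cH) sb.
have := bm _ sr; have [Ab _] := sb; have [Ar _] := sr.
have := @refl_lt _ _ _ _ cxA _ _ rr a (r \o b) Aa Ar.
rewrite (reflN rr Ab) (reflK rr Ab) e => /(_ _).
have -> : H b != ~~ H b by case: (H b).
by move=> /(_ isT); have := dN _ _ Aa Ar; have := dN _ _ Aa Ab; lia.
Qed.

Lemma far_uniq F a b b' : far A F a b -> far A F a b' -> b = b'.
Proof.
move=> [sa [Ab Fb] h] [_ [Ab' Fb'] h']; have [//|ne] := pselect (b = b').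
have [H rH ne'] := sep_ex cxA Ab Ab' ne.
have cH : cuts A H F by exists b, b'.
by move: ne' (h H rH cH) (h' H rH cH); case: (H b); case: (H b'); case: (H a).
Qed.

Lemma far_btw F a x b : far A F a b -> star A F x -> btw A a x b.
Proof.
move=> [[Aa Fa] [Ab Fb] h] [Ax Fx]; apply: (rt_btw cxA) => // H rH ab.
apply/eqP/negPn/negP => ne; have cH : cuts A H F by exists x, a.
by have := h H rH cH; rewrite ab eqxx.
Qed.

(** As for gates: the reflection exchanging [a] and [a'] carries [b] to [b'], and the first wall
    between these two separates [a] from [a'], so it is the same wall. *)
Lemma far_adj F a a' b i : star A F a' -> adj i a a' -> far A F a b ->
  exists b' k, far A F a' b' /\ adj k b b'.
Proof.
move=> sa' aa' fab; have [sa sb h] := fab; have [[Aa Fa] [Ab Fb]] := (sa, sb).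
have [Aa' Fa'] := sa'.
have [_ [r rr ra]] := side_refl cxA Aa Aa' aa'.
have rt0 := rt_side Aa Aa' aa'.
have cu : cuts A (side A a a') F by exists a, a'; split=> //; apply: (side_sep cxA _ _ aa').
have fx v := @cuts_fix _ _ _ _ _ rr F v cu.
have sr := refl_star rr fx sb; have [Ar _] := sr.
have fa' : far A F a' (r \o b).
  split=> // H rH [x [y [sx sy ne]]]; rewrite -ra.
  apply: (h (fun z => H (r \o z))).
    exact: (iso_rt cxA cxA (refl_iso rr) (ex_intro _ _ Aa) rH).
  have [Ax _] := sx; have [Ay _] := sy.
  exists (r \o x), (r \o y); split; [exact: (refl_star rr)|exact: (refl_star rr)|].
  by rewrite !(reflK rr).
have nab := h _ rt0 cu.
have ne : b <> r \o b by move=> e; have := reflN rr Ab; rewrite -e; case: side.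
have [e [k [Ae be _ he]]] := step_sep cxA Ab Ar ne.
have hb : side A b e b by rewrite /side distxx // (dist1 cA Ab Ae be).
have rH := rt_side Ab Ae be.
have cH : cuts A (side A b e) F by exists b, (r \o b); split=> //; rewrite hb he.
have s1 := h _ rH cH; have [_ _ /(_ _ rH cH) s2] := fa'.
have s3 : side A b e a != side A b e a'.
  by move: s1 s2; rewrite hb he; case: side => //; case: side.
have := rt_sep cxA rH Aa Aa' aa' s3 Ab Ae; rewrite (side_sep cxA Ab Ae be) => /esym s4.
by exists (r \o b), k; split=> //; rewrite (refl_adj cxA rr Ab Ae be s4).
Qed.

Lemma star0 a : A a -> star A set0 a. Proof. by move=> Aa; split. Qed.

Lemma cuts0 H : rt A H -> cuts A H set0.
Proof.
move=> [c [e [i [Ac Ae ce HP]]]]; exists c, e; split; [exact: star0|exact: star0|].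
by rewrite !HP // (side_sep cxA Ac Ae ce).
Qed.

Lemma opp_sep a b H : opp A a b -> rt A H -> H a != H b.
Proof. by move=> [_ _ h] rH; apply: h => //; apply: cuts0. Qed.

Lemma opp_in a b : opp A a b -> A a /\ A b.
Proof. by move=> [[? _] [? _] _]. Qed.

Lemma opp_le a b x : opp A a b -> A x -> d a x <= d a b.
Proof. by move=> ab Ax; have := far_btw ab (star0 Ax); rewrite /btw; lia. Qed.

Lemma opp_max a b : A a -> A b -> (forall x, A x -> d a x <= d a b) -> opp A a b.
Proof.
move=> Aa Ab mx; have [c fc] := far_ex (star0 Aa).
have [_ Ac] := opp_in fc; have := mx _ Ac; have := far_btw fc (star0 Ab).
rewrite /btw => h1 h2; suff -> : b = c by [].
by apply: (dist0 cA) => //; lia.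
Qed.

Lemma opp_simplex_sym F G : opp_simplex A F G -> opp_simplex A G F.
Proof. by move=> [h1 h2 h]; split=> // a b /far_sym/h ->. Qed.

Lemma opp_simplex_par F G : opp_simplex A F G -> par A F G.
Proof.
suff h F' G' H : rt A H -> opp_simplex A F' G' -> cuts A H F' -> cuts A H G'.
  by move=> FG H rH; split; apply: h => //; apply: opp_simplex_sym.
move=> rH [_ _ h] [a [b [sa sb ne]]].
have [a' aa'] := far_ex (star0 (proj1 sa)).
have [b' bb'] := far_ex (star0 (proj1 sb)).
exists a', b'; split; [exact/(h _ _ aa')|exact/(h _ _ bb')|].
by have := opp_sep aa' rH; have := opp_sep bb' rH; move: ne; do 4!case: (H _).
Qed.

Lemma opp_simplex_uniq F G G' : opp_simplex A F G -> opp_simplex A F G' -> G = G'.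
Proof.
move=> [_ neG h] [_ neG' h'].
have e : star A G = star A G'.
  apply/seteqP; split=> b sb; have [a /far_sym ab] := far_ex (star0 (proj1 sb)).
    by apply/(h' _ _ ab)/(h _ _ ab).
  by apply/(h _ _ ab)/(h' _ _ ab).
by apply/seteqP; split; apply: star_inj.
Qed.

Definition oppc a : ch :=
  if pselect (exists b, opp A a b) is left h then projT1 (cid h) else a.

Lemma oppcP a : A a -> opp A a (oppc a).
Proof.
move=> Aa; rewrite /oppc; case: pselect => [h|[]]; first by case: (cid h).
exact: far_ex (star0 Aa).
Qed.

Lemma oppcK a : A a -> oppc (oppc a) = a.
Proof.
move=> Aa; have h := oppcP Aa; have [_ Ab] := opp_in h.
exact: far_uniq (oppcP Ab) (far_sym h).
Qed.

Lemma oppc_refl a H r : A a -> refl A H r -> oppc (r \o a) = r \o (oppc a).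
Proof.
move=> Aa rr; have Ar := refl_in rr Aa; have h := oppcP Aa.
have [_ Ab] := opp_in h; apply: far_uniq (oppcP Ar) _.
apply: opp_max => //; first exact: (refl_in rr).
move=> x Ax; rewrite -{1}(reflK rr Ax) !(refl_dist cxA rr) //; last exact: (refl_in rr).
by apply: opp_le => //; apply: (refl_in rr).
Qed.

Lemma oppc_adj a b i : A a -> A b -> adj i a b -> exists k, adj k (oppc a) (oppc b).
Proof.
move=> Aa Ab ab; have [b' [k [h1 h2]]] := far_adj (star0 Ab) ab (oppcP Aa).
by exists k; rewrite (far_uniq (oppcP Ab) h1).
Qed.

(** Opposition preserves adjacency of chambers but is not yet a map on vertices. [transfer] supplies
    the vertex: [k] is the type of the image of the [i]-panel of [a], and the squares come from
    reflections, with which opposition commutes. *)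
Lemma opp_vertex_sub a i : A a -> exists w, (exists2 b, A b & range b w) /\
  forall x, star A [set a i] x -> star A [set w] (oppc x).
Proof.
move=> Aa; have [a' Aa' aa'] := cx_nb cxA i Aa.
have [k hk] := oppc_adj Aa Aa' aa'; have [_ Ab] := opp_in (oppcP Aa).
exists (oppc a k); split; first by exists (oppc a) => //; exists k.
move=> x sx; have [_ Ax] := opp_in (oppcP (proj1 sx)).
split=> // _ ->; exists k => //.
apply: (@transfer V I A oppc _ _ _ _ (a i) a x a' i k _ erefl Aa Aa' aa' hk).
- by move=> ? ? ?; apply: oppc_adj.
- move=> y z l Ay Az h; have [_ A1] := opp_in (oppcP Ay).
  have [_ A2] := opp_in (oppcP Az).
  by have := oppc_adj A1 A2 h; rewrite !oppcK.
- by move=> y z Ay Az e; rewrite -(oppcK Ay) e oppcK.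
- move=> y z y' l j Ay Az Ay' yz lj yy'; have [m hm] := oppc_adj Ay Ay' yy'.
  have [_ [r rr ry]] := side_refl cxA Ay Az yz.
  have [_ Ao] := opp_in (oppcP Ay); have [_ Ao'] := opp_in (oppcP Ay').
  exists y', (r \o y'), m; rewrite -ry !(oppc_refl _ rr) //; split=> //.
  + by split=> //; apply: (refl_in rr).
  + exact: (iso_adj (refl_iso rr)).
  + exact: (iso_adj (refl_iso rr)).
have := star_gal (star_set1 i Aa) sx; apply: gal_sub => y sy; split; first by case: sy.
exact: star1 (proj1 sy) sy Aa.
Qed.

Lemma opp_vertex_ex a i : A a ->
  exists w, opp_simplex A [set a i] [set w].
Proof.
move=> Aa; have [w [[b Ab [k _ ew]] h]] := opp_vertex_sub i Aa.
exists w; split; [by exists a; apply: star_set1| |].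
  by exists (oppc a); apply/h/star_set1.
have [v [[c Ac [l _ ev]] h']] := opp_vertex_sub k Ab; rewrite ew in h'.
(* Applying the construction twice, every chamber containing [a i] contains [v]; this forces
   [v = a i], and the inclusion of stars becomes an equivalence. *)
have va : v = a i.
  have hh x : star A [set a i] x -> star A [set v] x.
    by move=> sx; rewrite -(oppcK (proj1 sx)); apply/h'/h.
  have [_ /(_ v erefl) [j _ ej]] := hh _ (star_set1 i Aa).
  have [//|ne] := pselect (v = a i).
  have [a' Aa' aa'] := cx_nb cxA j Aa.
  have sa' : star A [set a i] a'.
    apply: (star_adj (star_set1 i Aa) Aa' aa') => e; apply: ne.
    by rewrite -ej -e.
  have := hh _ sa'; rewrite -ej => /(star1 Aa') /(_ Aa) e.
  by case: (adj_neq aa').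
move=> x y xy; have [Ax Ay] := opp_in xy.
have ey : y = oppc x by apply: far_uniq xy (oppcP Ax).
split=> s; first by rewrite ey; apply: h.
by rewrite -(oppcK Ax) -ey -va; apply: h'.
Qed.

Lemma opp_vertex_neq a i w : A a -> opp_simplex A [set a i] [set w] -> a i <> w.
Proof.
move=> Aa [_ _ h] e; have [a' Aa' aa'] := cx_nb cxA i Aa.
have rH := rt_side Aa Aa' aa'.
apply: (side_ncuts Aa Aa' aa' (star_set1 i Aa) erefl).
exists a, (oppc a); split; [exact: star_set1| |exact: opp_sep (oppcP Aa) rH].
by rewrite e; apply/(h _ _ (oppcP Aa)); apply: star_set1.
Qed.

(** Let [g] be the gate of [a] on the star of [w]. The first wall crossed from [a] to [g] does not
    contain [w], hence not [a i]; among the walls of the panels of [a] only that of type [i] avoids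
    [a i]. So this wall separates [a] from [g], and from all chambers containing [w]. *)
Lemma par_vertex_side a i a' w b : A a -> A a' -> adj i a a' -> A b -> star A [set w] b ->
  a i <> w -> par A [set a i] [set w] -> side A a a' b = false.
Proof.
move=> Aa Aa' aa' Ab sb ne pr; have rH := rt_side Aa Aa' aa'.
have nc : ~ cuts A (side A a a') [set w].
  by move/(pr _ rH); apply: side_ncuts aa' (star_set1 i Aa) erefl.
have [g gg] := gate_ex cxA Aa (ex_intro _ _ sb).
have [sg _] := gg; have [Ag _] := sg.
have -> : side A a a' b = side A a a' g.
  by apply: contrapT => /eqP h; apply: nc; exists b, g.
have ag : a <> g.
  move=> e; rewrite -e in sg; apply: nc; exists a, a'; split=> //.
    apply: (star_adj sg Aa' aa') => /esym //.
  exact: (side_sep cxA _ _ aa').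
have [c [k [Ac ac _ hg]]] := step_sep cxA Aa Ag ag.
have rH' := rt_side Aa Ac ac.
have : ~ cuts A (side A a c) [set w].
  move/(gate_rt cxA Aa gg rH'); rewrite hg /side distxx //.
  by rewrite (dist1 cA Aa Ac ac).
have [ki|ki] := eqVneq k i.
  by rewrite ki in ac; rewrite (cx_thin cxA Aa Aa' Ac aa' ac).
case; apply/(pr _ rH'); exists a, c; split; [exact: star_set1| |exact: (side_sep cxA _ _ ac)].
apply: (star_adj (star_set1 i Aa) Ac ac) => /(chamber_vertex Aa Aa) e.
by rewrite e eqxx in ki.
Qed.

(* If w were neither v nor the opposite w' of v, the wall of a panel opposite v
   would separate w both from v and from w', though it separates v from w'. *)
Lemma par_vertex_opp a i b j : A a -> A b -> a i <> b j ->
  par A [set a i] [set b j] -> opp_simplex A [set a i] [set b j].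
Proof.
move=> Aa Ab ne pr; have [w' ow] := opp_vertex_ex i Aa.
have [//|nw] := pselect (w' = b j); first by move=> <-.
have [a' Aa' aa'] := cx_nb cxA i Aa; have rH := rt_side Aa Aa' aa'.
have [_ Ae] := opp_in (oppcP Aa); have [_ Ae'] := opp_in (oppcP Aa').
have [k ee'] := oppc_adj Aa Aa' aa'; have [_ _ hw] := ow.
have [_ /(_ w' erefl) [l _ el]] : star A [set w'] (oppc a).
  by apply/(hw _ _ (oppcP Aa)); apply: star_set1.
have kl : l = k.
  apply: (adj_type ee') => e; case: (adj_neq aa'); apply/esym.
  apply: (star1 Aa' _ Aa); apply/(hw _ _ (oppcP Aa')); split=> // _ ->.
  by rewrite -el e; exists l.
rewrite kl in el; have sb := star_set1 j Ab.
have h1 := par_vertex_side Aa Aa' aa' Ab sb ne pr.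
have h2 : side A (oppc a) (oppc a') b = false.
  apply: (par_vertex_side Ae Ae' ee' Ab sb); rewrite el // => H rH'.
  by rewrite -(pr H rH'); have := opp_simplex_par ow rH' => ->.
have ha : side A a a' a by rewrite /side distxx // (dist1 cA Aa Aa' aa').
have hs := opp_sep (oppcP Aa) rH; have hs' := opp_sep (oppcP Aa') rH.
have h0 := side_sep cxA Aa Aa' aa'.
have hsep : side A a a' (oppc a) != side A a a' (oppc a').
  by move: hs hs' h0; do 4!case: (side A a a' _).
have := rt_sep cxA rH Ae Ae' ee' hsep Ae Ab.
rewrite h1 h2 /side distxx // (dist1 cA Ae Ae' ee') -/(side A a a' (oppc a)).
by move: hs; rewrite ha; case: (side A a a' (oppc a)).
Qed.

Lemma opp_simplexP F G : star A F !=set0 -> star A G !=set0 ->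
  opp_simplex A F G <->
  (forall v, F v -> exists2 w, G w & opp_simplex A [set v] [set w]) /\
  (forall w, G w -> exists2 v, F v & opp_simplex A [set v] [set w]).
Proof.
move=> neF neG; have sub1 K v x : star A K x -> K v -> star A [set v] x.
  by move=> [Ax Kx] Kv; split=> // _ ->; apply: Kx.
have half1 F' G' : opp_simplex A F' G' -> forall v, F' v ->
    exists2 w, G' w & opp_simplex A [set v] [set w].
  move=> [[a sa] [b sb] h] v Fv; have [Aa Fa] := sa.
  have [j _ ej] := Fa _ Fv; have [w ow] := opp_vertex_ex j Aa.
  rewrite ej in ow; exists w => //; have [_ _ hw] := ow.
  have [Ab Gb] := sb.
  have hG y : star A G' y -> star A [set w] y.
    move=> sy; have [x /far_sym xy] := far_ex (star0 (proj1 sy)).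
    by apply/(hw _ _ xy); apply: sub1 Fv; apply/(h _ _ xy).
  have [_ /(_ w erefl) [k _ ek]] := hG _ sb.
  have [//|nG] := pselect (G' w); have [b' Ab' bb'] := cx_nb cxA k Ab.
  have sb' : star A G' b' by apply: (star_adj sb Ab' bb'); rewrite ek.
  have := hG _ sb'; rewrite -ek => /(star1 Ab') /(_ Ab) e.
  by case: (adj_neq bb').
split.
  move=> FG; split; first exact: half1.
  move=> w /(half1 _ _ (opp_simplex_sym FG)) [v Fv /opp_simplex_sym h].
  by exists v.
move=> [h1 h2]; split=> // a b ab; have [Aa Ab] := opp_in ab; split=> s; split=> //.
  move=> w Gw; have [v Fv [_ _ h]] := h2 _ Gw.
  by have [_] := proj1 (h _ _ ab) (sub1 _ _ _ s Fv); apply.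
move=> v Fv; have [w Gw [_ _ h]] := h1 _ Fv.
by have [_] := proj2 (h _ _ ab) (sub1 _ _ _ s Gw); apply.
Qed.

Lemma opp_simplex_ex F a : star A F a -> exists G, opp_simplex A F G.
Proof.
move=> [Aa Fa].
pose G := [set w | exists2 v, F v & opp_simplex A [set v] [set w]].
have hF v : F v -> exists w, opp_simplex A [set v] [set w].
  by move=> /Fa [j _ <-]; apply: opp_vertex_ex.
have sG : star A G !=set0.
  have [_ Ab] := opp_in (oppcP Aa); exists (oppc a); split=> // w [v Fv [_ _ h]].
  have [_] : star A [set w] (oppc a); last exact.
  by apply/(h _ _ (oppcP Aa)); split=> // _ ->; apply: Fa.
exists G; apply/opp_simplexP => //; first by exists a.
split=> // v Fv; have [w h] := hF _ Fv; exists w => //; exists v => //.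
Qed.

End Far.

(** Take [c] containing [F] and [e] containing [G] as near as possible. The first wall from [c] to
    [e] avoids [F], so a chamber containing [F] and a vertex [v] of [G] is on the side of [c], and
    the wall contains [v]. Reflecting [e] would keep [G] and come nearer to [c]. *)
Lemma flag F G : star A F !=set0 -> star A G !=set0 ->
  (forall v, G v -> star A (F `|` [set v]) !=set0) -> star A (F `|` G) !=set0.
Proof.
move=> [c0 sc0] [e0 se0] h.
have [|[c e] [/= sc se] ce_min] := argmin (fun p => d p.1 p.2)
  (P := [set p | star A F p.1 /\ star A G p.2]); first by exists (c0, e0).
have [Ac Fc] := sc; have [Ae Ge] := se.
have [eq|ne] := pselect (c = e).
  by exists c; split=> // v [/Fc //|/Ge]; rewrite eq.
have [c2 [i [Ac2 cc2 dce he]]] := step_sep cxA Ac Ae ne.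
have [_ [r rr rc]] := side_refl cxA Ac Ac2 cc2.
have rH := rt_side Ac Ac2 cc2.
have hc : side A c c2 c by rewrite /side distxx // (dist1 cA Ac Ac2 cc2).
have ncF : ~ cuts A (side A c c2) F.
  move=> cu; have := refl_star rr (fun v => cuts_fix rr cu) sc; rewrite rc => s.
  by have := ce_min (c2, e) (conj s se); rewrite /= dce ltnn.
have fx v : G v -> r v = v.
  move=> Gv; have [x [Ax Fx]] := h v Gv.
  have sx : star A F x by split=> // w Fw; apply: Fx; left.
  have hx : side A c c2 x.
    by apply/negPn/negP => hx; apply: ncF; exists c, x; split=> //; rewrite hc.
  apply: (@cuts_fix _ _ _ _ _ rr [set v]) => //; exists x, e.
  split; last by rewrite hx he.
    by split=> // _ ->; apply: Fx; right.
  by split=> // _ ->; apply: Ge.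
have sr := refl_star rr fx se.
have := ce_min (c, r \o e) (conj sc sr) => /=.
have := @refl_lt _ _ _ _ cxA _ _ rr c e Ac Ae; rewrite hc he => /(_ isT); lia.
Qed.

(** * Irreducibility *)

(** A closed gallery of type [j], [k], [j], [k]: for distinct types it witnesses the Coxeter entry
    2, that is, a missing edge of the diagram. *)
Definition square j k := exists a b c e, [/\ A a /\ A b, A c /\ A e,
  adj j a b /\ adj k b c & adj j c e /\ adj k e a].

Lemma homogeneous a b : A a -> A b -> exists2 f, iso A A f & f \o a = b.
Proof.
move=> Aa Ab; have [n] := cA Aa Ab; elim: n a Aa => [|n IH] a Aa /=.
  by move=> [_ <-]; exists id.
move=> [e [i [_ ae h]]]; have [Ae _] := gal_in h; have [f fi fe] := IH _ Ae h.
have [_ [r rr ra]] := side_refl cxA Aa Ae ae.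
exists (f \o r); first exact: iso_comp (refl_iso rr) fi.
by rewrite -[LHS]/(f \o (r \o a)) ra.
Qed.

(** The set of such [j] is shown to be closed under diagram edges; as it never contains [i],
    irreducibility forces it to be empty. *)
Let fixed_by i j := forall a a' b, A a -> A a' -> A b -> adj j a a' ->
  cuts A (side A a a') [set b i].

(** Let [C] be the gate of [b] on the face [G] of [a] of cotype [j], [k], and [D] its [k]-neighbour.
    The [j]-wall at [D] contains [v = b i] by assumption; reflecting [b] in it gives a chamber on
    [v] whose gate [D''] lies beyond the wall of [C] and [D], as there is no square. So that wall
    contains [v] too. Reflections in walls containing [v] spread this from [C] to [a]. *)
Lemma fixed_by_step i j k : fixed_by i j -> j <> k -> ~ square j k -> fixed_by i k.
Proof.
move=> Zj jk nsq a a' b Aa Aa' Ab aa'.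
pose v := b i; pose G := [set a l | l in [set l | l <> j /\ l <> k]].
have sa : star A G a by split=> // _ [l _ <-]; exists l.
have Gadj t x y : star A G x -> A y -> adj t x y -> t = j \/ t = k -> star A G y.
  move=> [Ax Gx] Ay xy tjk; split=> // _ [l [lj lk] <-].
  have [|m _ e] := Gx (a l); first by exists l.
  have ml := chamber_vertex Ax Aa e; exists m => //.
  by rewrite -(proj2 xy) // ml; case: tjk => ->.
have Gadj' t x y : star A G x -> star A G y -> adj t x y -> t = j \/ t = k.
  move=> sx sy xy.
  have [->|/eqP tj] := eqVneq t j; first by left.
  have [->|/eqP tk] := eqVneq t k; first by right.
  have Gt : G (a t) by exists t.
  by case: (adj_neq xy); rewrite (star_vertex sx Aa Gt erefl) (star_vertex sy Aa Gt erefl).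
pose Q x := forall t x', t = j \/ t = k -> A x' -> adj t x x' ->
  cuts A (side A x x') [set v].
suff Qa : Q a by apply: (Qa k) => //; right.
have [C gC] := gate_ex cxA Ab (ex_intro _ _ sa).
have [sC _] := gC; have [AC _] := sC.
have QC : Q C.
  move=> t D [->|->] AD CD; first exact: (Zj C D b).
  have [D' AD' DD'] := cx_nb cxA j AD.
  have sD : star A G D by apply: (Gadj k C D) => //; right.
  have sD' : star A G D' by apply: (Gadj j D D') => //; left.
  have [_ [r rr rD]] := side_refl cxA AD AD' DD'.
  have cu : cuts A (side A D D') G by exists D, D'; split=> //; apply: (side_sep cxA _ _ DD').
  have fx w := @cuts_fix _ _ _ _ _ rr G w cu.
  have sv : star A [set v] b by apply: star_set1.
  have rv w : [set v] w -> r w = w.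
    by move=> wv; apply: (cuts_fix rr (Zj _ _ _ AD AD' Ab DD')).
  have gr := gate_refl cxA rr fx Ab gC.
  have rH := rt_side AC AD CD.
  have cu' : cuts A (side A C D) G by exists C, D; split=> //; apply: (side_sep cxA _ _ CD).
  have srv := refl_star rr rv sv; have [Arb _] := srv.
  exists b, (r \o b); split=> //.
  rewrite -(gate_rt cxA Ab gC rH cu') -(gate_rt cxA Arb gr rH cu').
  have hC : side A C D C by rewrite /side distxx // (dist1 cA AC AD CD).
  rewrite hC; have [h''|//] := boolP (side A C D (r \o C)); exfalso.
  set D'' := r \o C in h'' gr *.
  have D'D'' : adj k D' D''.
    by rewrite -rD; apply: (iso_adj (refl_iso rr)) => //; apply: adj_sym.
  have [sD'' _] := gr; have AD'' := proj1 sD''.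
  (* [C], [D], [D'], [D''] is a gallery of type [k], [j], [k]. If [D''] were on the side of [C], it
     would be [C] or adjacent to [C]; this closes a square or conflicts with thinness or
     [j <> k]. *)
  have dD : dist A D'' D <= 2.
    have := dist_tri cA AD'' AD' AD.
    by rewrite (dist1 cA AD'' AD' (adj_sym D'D'')) (dist1 cA AD' AD (adj_sym DD')); lia.
  have [eC|neC] := pselect (D'' = C).
    rewrite eC in D'D''; have := adj_trans (adj_sym D'D'') CD.
    case=> [e|/adj_sym/(adj_uniq DD') //].
    by case: DD' => + _; apply; rewrite e.
  have [y [t' [Ay D''y dD''C]]] := dist_step cA AD'' AC neC.
  have yC : y = C by apply: (dist0 cA) => //; move: h''; rewrite /side; lia.
  rewrite yC in D''y; case: (Gadj' _ _ _ sD'' sC D''y) => tt; rewrite tt in D''y.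
    apply: nsq; exists D, D', D'', C; split=> //.
  have e : C = D' := cx_thin cxA AD'' AC AD' D''y (adj_sym D'D'').
  by rewrite e in CD; apply: jk; apply: adj_uniq DD' (adj_sym CD).
have := star_gal sC sa; move: (dist A C a) => n; elim: n (C) QC => [|n IH] x Qx /=.
  by move=> [_ <-].
move=> [y [t [sx xy hy]]]; have [sy _] := gal_in hy; apply: (IH y) => // t' y' tt' Ay' yy'.
have [Ax _] := sx; have [Ay _] := sy.
have [_ [r rr rx]] := side_refl cxA Ax Ay xy.
have tjk := Gadj' _ _ _ sx sy xy.
have rv w : [set v] w -> r w = w by apply: (cuts_fix rr (Qx _ _ tjk Ay xy)).
have ry : r \o y = x by rewrite -rx (reflK rr).
have rA z := @refl_in _ _ _ _ _ rr z.
have xr : adj t' x (r \o y') by rewrite -ry; apply: (iso_adj (refl_iso rr)).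
have [p [q [sp sq ne]]] := Qx _ _ tt' (rA _ Ay') xr.
exists (r \o p), (r \o q); split; [exact: (refl_star rr)|exact: (refl_star rr)|].
have [[Ap _] [Aq _]] := (sp, sq).
have e z : A z -> side A y y' (r \o z) = side A x (r \o y') z.
  move=> Az; rewrite -(iso_side cxA cxA (refl_iso rr) Ay Ay' (rA _ Az)).
  by rewrite ry (reflK rr).
by rewrite !e.
Qed.

(** Otherwise every vertex of type [i] lies on the wall of [H], one beyond the wall having its
    mirror image inside. By homogeneity this holds for all walls of panels of the same cotype [j0],
    and it spreads along the connected diagram to [i] itself, although the wall of an [i]-panel of a
    chamber avoids its vertex of type [i]. *)
Lemma interior_vertex H i : rt A H ->
  (forall J : set I, J !=set0 -> ~` J !=set0 ->
     exists j k, [/\ J j, ~ J k, j <> k & ~ square j k]) ->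
  exists a, [/\ A a, H a & ~ cuts A H [set a i]].
Proof.
move=> rH irr; apply: contrapT => no.
have all_cut a : A a -> cuts A H [set a i].
  move=> Aa; apply: contrapT => nc; have [Ha|Ha] := boolP (H a).
    by apply: no; exists a.
  have [r rr] := rt_refl cxA rH; have Ar := refl_in rr Aa.
  apply: no; exists (r \o a); split=> //; first by rewrite (reflN rr).
  move=> [x [y [sx sy ne]]]; apply: nc.
  have sr z : star A [set (r \o a) i] z -> star A [set a i] (r \o z).
    move=> sz; have Az := proj1 sz; split; first exact: (refl_in rr).
    move=> _ ->; exists i => //=; rewrite (star1 Az sz Ar) /=.
    exact: (congr1 (@^~ i) (reflK rr Aa)).
  exists (r \o x), (r \o y); split; [exact: sr|exact: sr|].
  by rewrite !(reflN rr) ?(inj_eq negb_inj); [|case: sy|case: sx].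
have [c [e [j0 [Ac Ae ce HP]]]] := rH.
have Z0 : fixed_by i j0.
  move=> a a' b Aa Aa' Ab aa'; have [f fi fa] := homogeneous Aa Ac.
  have fe : f \o a' = e.
    apply: (cx_thin cxA Ac) ce; [by apply: (proj1 fi)|by []|].
    by rewrite -fa; apply: (iso_adj fi).
  have Afb : A (f \o b) by apply: (proj1 fi).
  have := all_cut _ Afb.
  have -> : [set (f \o b) i] = f @` [set b i].
    by apply/seteqP; split=> [_ ->|_ [_ -> <-]] //=; exists (b i).
  move/(iso_cuts cxA cxA fi) => /(_ (ex_intro _ _ (star_set1 i Ab))).
  move=> [x [y [sx sy ne]]]; exists x, y; split=> //.
  have [[Ax _] [Ay _]] := (sx, sy).
  rewrite -(iso_side cxA cxA fi) // -[side A a a' y](iso_side cxA cxA fi) //.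
  by rewrite fa fe -!HP //; apply: (proj1 fi).
have [||j [k [Jj nJk jk nsq]]] := irr [set j | fixed_by i j]; first by exists j0.
  exists i => /= Zi; have [a' Aa' aa'] := cx_nb cxA i Ac.
  exact: (side_ncuts Ac Aa' aa' (star_set1 i Ac) erefl (Zi _ _ _ Ac Aa' Ac aa')).
by apply: nJk; apply: fixed_by_step nsq.
Qed.

End Apartment.

Section Transport.
Variables A B : set ch.
Hypotheses (cxA : coxeter A) (cxB : coxeter B) (bdA : bounded A) (bdB : bounded B).
Variable f : V -> V.
Hypothesis fi : iso A B f.

Lemma iso_far F a b : far A F a b -> far B (f @` F) (f \o a) (f \o b).
Proof.
move=> [sa sb h]; split; [exact: (iso_star fi)|exact: (iso_star fi)|].
move=> H rH cH; apply: (h (fun z => H (f \o z))).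
  exact: (iso_rt cxA cxB fi (ex_intro _ _ (proj1 sa))).
by apply/(iso_cuts cxA cxB fi) => //; exists a.
Qed.

Lemma iso_opp a b : opp A a b -> opp B (f \o a) (f \o b).
Proof. by move=> /iso_far; rewrite image_set0. Qed.

Lemma iso_opp_simplex F G : opp_simplex A F G -> opp_simplex B (f @` F) (f @` G).
Proof.
move=> [[a sa] [b sb] h]; split; [by exists (f \o a); apply: (iso_star fi)|
  by exists (f \o b); apply: (iso_star fi)|].
move=> y z yz; have [By Bz] := opp_in yz; have nA := ex_intro A a (proj1 sa).
have [x Ax ex] := iso_surj cxA cxB fi nA By.
have [x' xx'] := far_ex cxA bdA (star0 Ax); have [_ Ax'] := opp_in xx'.
have ez : z = f \o x' by apply: (far_uniq cxB yz); rewrite -ex; apply: iso_opp.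
rewrite -ex ez; split=> s.
  by apply: (iso_star fi) => //; apply/(h _ _ xx'); apply: (iso_star_inv fi sa).
by apply: (iso_star fi) => //; apply/(h _ _ xx'); apply: (iso_star_inv fi sb).
Qed.

Lemma iso_par F G : star A F !=set0 -> star A G !=set0 -> par A F G ->
  par B (f @` F) (f @` G).
Proof.
move=> nF nG FG H rH; have nA : A !=set0 by case: nF => a [Aa _]; exists a.
rewrite (iso_cuts cxA cxB fi H nF) (iso_cuts cxA cxB fi H nG); apply: FG.
exact: (iso_rt cxA cxB fi).
Qed.

End Transport.
End Opposition.

Lemma card2P T (P : set T) x : P #= `I_2 -> P x ->
  exists y, [/\ P y, x <> y & forall z, P z -> z = x \/ z = y].
Proof.
move=> /card_set_bijP[f [f1 f2 f3]] Px.
have fx := f1 _ Px; have [|y Py fy] := f3 (1 - f x); first by move: fx => /=; lia.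
exists y; split=> //; first by move=> e; move: fx fy => /=; rewrite e; lia.
move=> z Pz; have fz := f1 _ Pz.
have inj u w : P u -> P w -> f u = f w -> u = w by move=> *; apply: f2; rewrite ?inE.
have [e|e] := eqVneq (f z) (f x); first by left; apply: inj.
by right; apply: inj => //; rewrite fy; move: fx fz e => /=; lia.
Qed.

Lemma finite_bound T (P : set T) (f : T -> nat) : finite_set P ->
  exists N, forall x, P x -> f x <= N.
Proof.
move=> /(finite_image f)/finite_seqP[s es]; exists (\max_(i <- s) i) => x Px.
have : [set` s] (f x) by rewrite -es; exists x.
by move=> /= xs; apply: leq_bigmax_seq.
Qed.

(** * From simplicial complexes to typed chambers *)

Section Translation.
Variables (V : Type) (I : finType) (Delta : building V I).
Local Notation ch := (I -> V).
Local Notation simplices := (simplices Delta).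
Local Notation apartments := (apartments Delta).
Local Notation typ := (typ Delta).
Implicit Types (a b c e x y : ch) (i j k : I) (f r : V -> V)
  (F G C D : set V) (S K : set (set V)).

(* A chamber is represented by the function sending each type to its vertex of
   that type. *)
Definition chs K : set ch :=
  [set c | chamber K (range c) /\ forall i, typ (c i) = i].

Local Notation X := (chs simplices).

Lemma chs_vertex K c v : chs K c -> range c v -> v = c (typ v).
Proof. by move=> [_ ct] [j _ <-]; rewrite ct. Qed.

Lemma chs_inj K L c e : chs K c -> chs L e -> range c = range e -> c = e.
Proof.
move=> Kc Le ce; apply/funext => i.
have /(chs_vertex Le) -> : range e (c i) by rewrite -ce; exists i.
by rewrite (proj2 Kc).
Qed.

Lemma chs_sub K L c e : chs K c -> chs L e -> range c `<=` range e -> c = e.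
Proof.
move=> Kc Le ce; apply/funext => i.
have /ce/(chs_vertex Le) -> : range c (c i) by exists i.
by rewrite (proj2 Kc).
Qed.

Lemma chamber_fun C : chamber simplices C -> exists2 c, X c & range c = C.
Proof.
move=> hC; have [_ inj surj] := typP hC.
have /boolp.choice[c hc] i : exists v, C v /\ typ v = i.
  by have [v Cv e] := surj i Logic.I; exists v.
have e : range c = C.
  apply/seteqP; split=> [_ [i _ <-]|v Cv]; first by case: (hc i).
  by exists (typ v) => //; apply: inj; rewrite ?inE; case: (hc (typ v)).
by exists c => //; split; [rewrite e|move=> i; case: (hc i)].
Qed.

Section GoodComplex.
Variable K : set (set V).
Hypothesis goodK : forall C, chamber K C -> chamber simplices C.

Lemma chs_ex C : chamber K C -> exists2 c, chs K c & range c = C.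
Proof.
by move=> kC; have [c [_ ct] e] := chamber_fun (goodK kC); exists c => //; split; rewrite ?e.
Qed.

Lemma chs_X c : chs K c -> X c. Proof. by move=> [/goodK ? ?]. Qed.

Lemma adjacentP c e : chs K c -> chs K e ->
  adjacent K (range c) (range e) <-> exists i, adj i c e.
Proof.
move=> Kc Ke; split.
  move=> [_ _ ne [P [[v [i _ <-] eP] [w [j _ <-] eP']]]]; exists i; split.
    by move=> eq; apply: ne; rewrite eq.
  move=> k ki; have : P (c k).
    rewrite eP; split; first by exists k.
    by move=> /= ek; apply: ki; rewrite -(proj2 Kc k) ek (proj2 Kc).
  by rewrite eP' => -[/(chs_vertex Ke) -> _]; rewrite (proj2 Kc).
move=> [i ce]; split; [by case: Kc|by case: Ke| |].
  by move=> /(chs_inj Kc Ke); case: ce.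
exists (range c `\ c i); split; first by exists (c i) => //; exists i.
exists (e i); first by exists i.
apply/seteqP; split=> v [h] ne; split.
- exact: (adj_range ce h).
- by move=> /= ev; have := chs_vertex Kc h; rewrite ev (proj2 Ke) => e'; apply: ne; rewrite ev.
- apply: (adj_range (adj_sym ce) h) => ev; exact: ne.
- by move=> /= ev; have := chs_vertex Ke h; rewrite ev (proj2 Kc) => e'; apply: ne; rewrite ev.
Qed.

Lemma galleryP n c e : chs K c -> chs K e ->
  gallery K n (range c) (range e) <-> gal (chs K) n c e.
Proof.
elim: n c => [|n IH] c Kc Ke /=; split.
- by move=> [_ /(chs_inj Kc Ke)].
- by move=> [[kc _] <-].
- move=> [C aC h]; have [_ kC _ _] := aC; have [x Kx ex] := chs_ex kC.
  rewrite -ex in aC h; have [i xi] := proj1 (adjacentP Kc Kx) aC.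
  by exists x, i; split=> //; apply/IH.
move=> [x [i [_ xi h]]]; have [Kx _] := gal_in h.
by exists (range x); [apply/adjacentP => //; exists i|apply/IH].
Qed.

(** Along a gallery all types but one are known at the next chamber; as its image is a chamber, the
    remaining vertex gets the remaining type. *)
Lemma chs_typed (f : V -> V) c a : conn (chs K) -> chs K c -> chs K a ->
  (forall x, chs K x -> chamber simplices (f @` range x)) ->
  (forall i, typ (f (c i)) = i) -> forall i, typ (f (a i)) = i.
Proof.
move=> cK Kc Ka fK; have := distP cK Kc Ka; move: (dist _ c a) => n.
elim: n c Kc => [|n IH] c Kc /=; first by move=> [_ ->].
move=> [e [i [_ ce h]]] ct; have [Ke _] := gal_in h; apply: (IH e) => // j.
have te l : l <> i -> typ (f (e l)) = l by move=> li; rewrite -(proj2 ce).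
have [->|/eqP/te //] := eqVneq j i.
have [z Xz ez] := chamber_fun (fK _ Ke).
have : range z (z i) by exists i.
rewrite ez => -[_ [l _ <-] el].
have [li|/eqP/te] := eqVneq l i; first by rewrite -li el (proj2 Xz).
by rewrite el (proj2 Xz) => li; rewrite {1}li el (proj2 Xz).
Qed.

End GoodComplex.

Lemma chs_comp K f c : chamber K (f @` range c) -> (forall i, typ (f (c i)) = i) ->
  chs K (f \o c).
Proof. by move=> h t; split; [rewrite image_comp in h|exact: t]. Qed.

Lemma isomorphism_chamber K L f C : is_complex K -> is_complex L ->
  isomorphism K L f -> chamber K C -> chamber L (f @` C).
Proof.
move=> [_ cK] [_ cL] [[f1 f2 f3] fi] [KC Cmax].
have vK v : C v -> vertices K v by move=> Cv; apply: cK KC _ => _ ->.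
split; first by apply/(fi _ vK).
move=> D LD CD.
have vD v : D v -> vertices L v by move=> Dv; apply: cL LD _ => _ ->.
pose E := [set v | vertices K v /\ D (f v)].
have eE : f @` E = D.
  apply/seteqP; split=> [_ [v [_ Dv] <-] //|w Dw].
  by have [v Kv e] := f3 _ (vD _ Dw); exists v => //; split=> //; rewrite e.
have KE : K E by apply/fi; [move=> v []|rewrite eE].
rewrite -eE (Cmax _ KE) // => v Cv; split; first exact: vK.
by apply: CD; exists v.
Qed.

Section Apartments.

Lemma complexD : is_complex simplices.
Proof. by case: (chamber_complexP Delta). Qed.

(** Enlarge [C] to a chamber [C'] of the building and map an apartment through [C'] to [S], fixing
    [C]. The image of [C'] is [C] by maximality in [S], and injectivity gives [C = C']. *)
Lemma apartment_good S C : apartments S -> chamber S C -> chamber simplices C.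
Proof.
move=> aS [SC Cmax]; have [_ pure _] := chamber_complexP Delta.
have [C' hC' CC'] := pure _ (apartment_sub aS SC); have [KC' C'max] := hC'.
have [S' [aS' S'C' _]] := apartment_join KC' KC'.
have [[[_ cS'] _ _] _ _] := apartment_coxeter aS'.
have S'C : S' C := cS' _ _ S'C' CC'.
have [f [[f1 f2 f3] fi] ff] := apartment_iso aS' aS S'C S'C SC SC.
have vC' v : C' v -> vertices S' v by move=> Cv; apply: cS' S'C' _ => _ ->.
have e : f @` C' = C.
  apply: Cmax; first by apply/(fi _ vC').
  by move=> v Cv; exists v; [apply: CC'|apply: ff; left].
suff -> : C = C' by [].
apply/seteqP; split=> // v C'v.
have : C (f v) by rewrite -e; exists v.
move=> Cfv; suff -> : v = f v by [].
by apply: f2; rewrite ?inE; [exact: vC'|exact: vC' (CC' _ Cfv)|apply/esym/ff; left].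
Qed.

Lemma apartment_complex S : apartments S -> is_complex S.
Proof. by move=> /apartment_coxeter[[]]. Qed.

Lemma apartment_chs S c : apartments S -> X c -> S (range c) -> chs S c.
Proof.
move=> aS [[_ cm] ct] Sc; split=> //; split=> // D SD; apply: cm.
exact: apartment_sub SD.
Qed.

Lemma apartment_face S F : apartments S -> S F <-> star (chs S) F !=set0.
Proof.
move=> aS; split.
  have [[_ pure _] _ _] := apartment_coxeter aS => /pure [C kC FC].
  have [c Kc e] := chs_ex (fun C => @apartment_good S C aS) kC.
  by exists c; split=> //; rewrite e.
by move=> [c [[[Sc _] _] Fc]]; case: (apartment_complex aS) => _; apply; last exact: Fc.
Qed.

Lemma simplex_face F : simplices F <-> star X F !=set0.
Proof.
have [[_ cD] pure _] := chamber_complexP Delta; split.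
  move=> /pure [C kC FC]; have [c Kc e] := chamber_fun kC.
  by exists c; split=> //; rewrite e.
by move=> [c [[[Sc _] _] Fc]]; apply: cD Fc.
Qed.

Lemma apartment_chs_join c e : X c -> X e ->
  exists S, [/\ apartments S, chs S c & chs S e].
Proof.
move=> Xc Xe; have [S [aS Sc Se]] := apartment_join (proj1 (proj1 Xc)) (proj1 (proj1 Xe)).
by exists S; split=> //; apply: apartment_chs.
Qed.

Lemma apartment_chs_iso S S' c F : apartments S -> apartments S' ->
  chs S c -> chs S' c -> S F -> S' F -> conn (chs S) ->
  exists f, [/\ iso (chs S) (chs S') f, f \o c = c & forall v, F v -> f v = v].
Proof.
move=> aS aS' Sc S'c SF S'F cS.
have [f fi ff] := apartment_iso aS aS' (proj1 (proj1 Sc)) SF (proj1 (proj1 S'c)) S'F.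
have fc : f \o c = c by apply/funext => i; apply: ff; left; exists i.
exists f; split=> //; last by move=> v Fv; apply: ff; right.
have fch x : chs S x -> chamber S' (f @` range x).
  move=> [Sx _]; apply: isomorphism_chamber fi Sx; exact: apartment_complex.
have ft x : chs S x -> forall i, typ (f (x i)) = i.
  move=> Sx; apply: (chs_typed (K := S) (c := c)) => //.
  - by move=> y /fch; apply: (apartment_good aS').
  - by move=> j; rewrite -[f (c j)]/((f \o c) j) fc (proj2 Sc).
split; first by move=> x Sx; apply: chs_comp; [apply: fch|apply: ft].
move=> x y i j Sx Sy e; have [[_ inj _] _] := fi.
have vS z l : chs S z -> vertices S (z l).
  move=> [[Sz _] _]; case: (apartment_complex aS) => _; apply; first exact: Sz.
  by move=> _ ->; exists l.
by apply: inj; rewrite ?inE //; apply: vS.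
Qed.

End Apartments.
End Translation.

(** * Roots and walls of apartments in terms of chambers; convexity and gates in the building *)

Section Metric.
Variables (V : Type) (I : finType) (Delta : building V I).
Local Notation ch := (I -> V).
Local Notation simplices := (simplices Delta).
Local Notation apartments := (apartments Delta).
Local Notation typ := (typ Delta).
Local Notation chs := (chs Delta).
Implicit Types (a b c e x y : ch) (i j k : I) (f r : V -> V)
  (F G C D : set V) (S K : set (set V)) (H : ch -> bool) (v w : V).

Local Notation X := (chs simplices).

Lemma fold_sideE A f x y i : coxeter typ A -> fold A f -> A x -> A y -> adj i x y ->
  f \o x = x -> f \o y <> y -> forall a, A a -> `[< f \o a = a >] = side A x y a.
Proof.
move=> cxA ff Ax Ay xy fx fy a Aa.
have [g fg gx] := cx_fold cxA Ay Ax (adj_sym xy).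
have gy : g \o y = y by rewrite -gx; case: fg => _ ->.
have gx' : g \o x <> x by rewrite gx; case: xy => /nesym.
have fyx := fold_cross cxA ff Ax Ay xy fx fy.
case: asboolP => fa.
  by rewrite (fold_side cxA ff Ax Ay xy).
have ga := opp_compl cxA ff fg Ax Ay xy fyx gx Aa fa.
have := fold_side cxA fg Ay Ax (adj_sym xy) gy gx' Aa ga; rewrite /side; lia.
Qed.

Lemma fold_rt A f b : coxeter typ A -> fold A f -> A b -> f \o b <> b ->
  rt A (fun x => `[< f \o x = x >]).
Proof.
move=> cxA ff Ab fb; have [f1 f2 _] := ff.
have [||x [y [i [Ax Ay xy [/asboolP fx /asboolPn fy] _]]]] :=
  @dist_exit _ _ _ (cx_conn cxA) (fun x => `[< f \o x = x >]) _ _ (f1 _ Ab) Ab.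
- by apply/asboolP/f2.
- exact/asboolPn.
by exists x, y, i; split=> //; exact: (fold_sideE cxA ff Ax Ay xy fx fy).
Qed.

Section OneApartment.
Variable S : set (set V).
Hypothesis aS : apartments S.
Local Notation A := (chs S).

Lemma ap_good C : chamber S C -> chamber simplices C.
Proof. exact: apartment_good. Qed.

Lemma ap_X c : A c -> X c. Proof. exact: (chs_X ap_good). Qed.

Lemma panel_adj K c e i : chs K c -> X e -> c <> e -> range c `\ c i `<=` range e -> adj i c e.
Proof.
move=> Kc Xe ne sub; split=> // k ki.
have : range e (c k).
  apply: sub; split; first by exists k.
  by move=> /= eq; apply: ki; rewrite -(proj2 Kc k) eq (proj2 Kc).
by move=> /(chs_vertex Xe) ->; rewrite (proj2 Kc).
Qed.

(** The image of a chamber is fixed, which makes [f] type-preserving. That fibres have exactly two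
    chambers gives both the injectivity clause and a moved chamber. *)
Lemma folding_fold f : conn A -> folding S f -> fold A f /\ exists2 b, A b & f \o b <> b.
Proof.
move=> cA [[fS fC] ff f2].
have [[[S0 cS] pure _] _ _] := apartment_coxeter aS.
have [C kC _] := pure _ S0; have [c0 Kc0 ec0] := chs_ex ap_good kC.
have [c Kc ec] := chs_ex ap_good (fC _ kC).
have vS x i : A x -> vertices S (x i).
  by move=> [[Sx _] _]; apply: cS Sx _ => _ ->; exists i.
have fc : f \o c = c.
  apply/funext => i /=; have : range c (c i) by exists i.
  by rewrite ec -ec0 => -[_ [j _ <-] <-]; rewrite ff //; apply: vS.
have ft x : A x -> forall i, typ (f (x i)) = i.
  move=> Sx i; apply: (chs_typed cA Kc Sx) => //.
    by move=> y [/fC/ap_good].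
  by move=> j; rewrite -[f (c j)]/((f \o c) j) fc (proj2 Kc).
have f1 x : A x -> A (f \o x).
  by move=> Ax; apply: (chs_comp _ (ft _ Ax)); apply: fC; case: Ax.
have fid x : A x -> f \o (f \o x) = f \o x.
  by move=> Ax; apply/funext => i /=; rewrite ff //; apply: vS.
have fib x y : A x -> A y -> f \o x = f \o y ->
    chamber S (range y) /\ f @` range y = f @` range x.
  by move=> [? _] [? _] e; split=> //; rewrite !image_comp e.
split; first split=> //.
  move=> a b Aa Ab eab na nb; have Aff := f1 _ Aa.
  have [y [_ _ yP]] := card2P (f2 _ (proj1 Aa)) (fib _ _ Aa Aff (esym (fid _ Aa))).
  have [ea|ea] := yP _ (fib _ _ Aa Aa erefl).
    by case: na; apply/esym/(chs_inj Aa Aff).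
  have [eb|eb] := yP _ (fib _ _ Aa Ab eab).
    by case: nb; rewrite -eab; apply/esym/(chs_inj Ab Aff).
  by apply: (chs_inj Aa Ab); rewrite ea eb.
have [D [[kD eD] ne _]] := card2P (f2 _ (proj1 Kc)) (fib _ _ Kc Kc erefl).
have [b Ab eb] := chs_ex ap_good kD; exists b => // fb.
apply: ne; have e1 : f @` range b = range b by rewrite image_comp fb.
have e2 : f @` range c = range c by rewrite image_comp fc.
by rewrite -e2 -eD -eb e1.
Qed.

Lemma ap_coxeter : coxeter typ A.
Proof.
have [[[S0 cS] pure galS] thinS foldS] := apartment_coxeter aS.
have cA : conn A.
  move=> a b Aa Ab; have [n] := galS _ _ (proj1 Aa) (proj1 Ab).
  by move=> /(galleryP ap_good n Aa Ab) ?; exists n.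
have pan c i : A c -> chambers_on S (range c `\ c i) #= `I_2.
  by move=> Ac; apply: thinS; exists (range c); [case: Ac|exists (c i) => //; exists i].
have sub x y i : A x -> A y -> adj i x y -> chambers_on S (range x `\ x i) (range y).
  move=> Ax Ay xy; split; first by case: Ay.
  by move=> v [h ne]; apply: (adj_range xy h).
have self x i : A x -> chambers_on S (range x `\ x i) (range x).
  by move=> Ax; split; [case: Ax|move=> v []].
split=> //.
- by move=> a i [].
- move=> a i Aa; have [D [[kD PD] ne _]] := card2P (pan _ i Aa) (self _ i Aa).
  have [e Ae ee] := chs_ex ap_good kD; rewrite -ee in ne PD; exists e => //.
  by apply: (panel_adj Aa (ap_X Ae)) => // eq; apply: ne; rewrite eq.
- move=> a b c i Aa Ab Ac ab ac.
  have [D [_ _ DP]] := card2P (pan _ i Aa) (self _ i Aa).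
  have [eb|eb] := DP _ (sub _ _ _ Aa Ab ab).
    by case: ab => -[]; apply/esym/(chs_inj Ab Aa).
  have [ec|ec] := DP _ (sub _ _ _ Aa Ac ac).
    by case: ac => -[]; apply/esym/(chs_inj Ac Aa).
  by apply: (chs_inj Ab Ac); rewrite eb ec.
move=> a b i Aa Ab ab.
have [|f ff fb] := foldS (range a) (range b).
  by apply/(adjacentP Aa Ab); exists i.
have [[f1 _ _] _] := folding_fold cA ff.
by exists f; [case: (folding_fold cA ff)|apply: (chs_inj (f1 _ Ab) Aa); rewrite -fb image_comp].
Qed.

Lemma folding_image f F : conn A -> folding S f ->
  [set f @` B | B in S] F <-> exists2 x, star A F x & f \o x = x.
Proof.
move=> cA ff; have [[f1 f2 _] _] := folding_fold cA ff; split.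
  move=> [G /(apartment_face _ aS)[x [Ax Gx]] <-]; exists (f \o x); last exact: f2.
  by split; [exact: f1|move=> _ [v /Gx[i _ <-] <-]; exists i].
move=> [x [Ax Fx] fx]; exists F.
  by apply/(apartment_face _ aS); exists x.
have fF v : F v -> f v = v.
  by move=> /Fx[i _ <-]; rewrite -[in RHS]fx.
by apply/seteqP; split=> [_ [v Fv <-]|v Fv]; [rewrite fF|exists v => //; rewrite fF].
Qed.

Lemma root_rt al : Defs.root S al -> exists2 H, rt A H &
  forall F, al F <-> exists2 x, star A F x & H x.
Proof.
move=> [f ff ->]; have cA := cx_conn ap_coxeter.
have [fo [b Ab fb]] := folding_fold cA ff.
exists (fun x => `[< f \o x = x >]); first exact: (fold_rt ap_coxeter fo Ab fb).
by move=> F; rewrite folding_image //; split=> -[x sx /asboolP]; exists x.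
Qed.

Lemma rt_root H : rt A H -> exists2 al, Defs.root S al &
  forall F, al F <-> exists2 x, star A F x & H x.
Proof.
move=> [c [e [i [Ac Ae ce HP]]]]; have cxA := ap_coxeter; have cA := cx_conn cxA.
have [_ _ foldS] := apartment_coxeter aS.
have [|f ff fe] := foldS (range c) (range e).
  by apply/(adjacentP Ac Ae); exists i.
have [fo _] := folding_fold cA ff; have [f1 f2 _] := fo.
have fec : f \o e = c by apply: (chs_inj (f1 _ Ae) Ac); rewrite -fe image_comp.
have fc : f \o c = c by rewrite -fec f2.
have fe' : f \o e <> e by rewrite fec; case: ce.
exists [set f @` B | B in S]; first by exists f.
have eH x : A x -> H x <-> f \o x = x.
  by move=> Ax; rewrite HP // -(fold_sideE cxA fo Ac Ae ce) //; split=> /asboolP.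
by move=> F; rewrite folding_image //; split=> -[x sx h]; exists x => //;
  apply/(eH _ (proj1 sx)).
Qed.

Section Root.
Variables (al : set (set V)) (H : ch -> bool).
Hypotheses (rH : rt A H) (alH : forall F, al F <-> exists2 x, star A F x & H x).

Lemma root_chs x : A x -> al (range x) <-> H x.
Proof.
move=> Ax; rewrite alH; split=> [[y [Ay xy] Hy]|Hx]; last by exists x => //; split.
by rewrite (chs_sub Ax Ay xy).
Qed.

Lemma boundaryP F : boundary S al F <-> cuts A H F.
Proof.
split.
  move=> [/alH [x sx Hx] [C [kC nC FC]]]; have [c Ac ec] := chs_ex ap_good kC.
  exists x, c; split=> //; first by split=> //; rewrite ec.
  rewrite Hx; have [Hc|//] := boolP (H c); case: nC; rewrite -ec.
  exact/root_chs.
move=> [x [y [sx sy ne]]]; wlog Hx : x y sx sy ne / H x.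
  move=> h; have [Hx|Hx] := boolP (H x); first exact: (h x y).
  apply: (h y x) => //; first by rewrite eq_sym.
  by move: ne; rewrite (negbTE Hx); case: (H y).
split; first by apply/alH; exists x.
exists (range y); split; [by case: sy => -[]| |by case: sy].
by move/(root_chs (proj1 sy)) => Hy; rewrite Hx Hy in ne.
Qed.

End Root.

Lemma wall_cuts v w : (forall W, wall S W -> (W [set v] <-> W [set w])) <->
  par A [set v] [set w].
Proof.
split=> h.
  move=> H rH; have [al ral alH] := rt_root rH.
  by rewrite -!(boundaryP alH); apply: h; exists al.
move=> W [al ral ->]; have [H rH alH] := root_rt ral.
by rewrite !(boundaryP alH); apply: h.
Qed.

Lemma vertexS v : vertices S v <-> exists2 a, A a & range a v.
Proof.
rewrite /vertices /= (apartment_face _ aS); split=> -[a].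
  by move=> [Aa av]; exists a => //; apply: av.
by move=> Aa av; exists a; split=> // _ ->.
Qed.

Hypothesis sph : spherical Delta.

Lemma ap_bounded : bounded A.
Proof.
have cA := cx_conn ap_coxeter.
have [[c Ac]|no] := pselect (exists c, A c); last by exists 0 => a b Aa; case: no; exists a.
pose P C x := A x /\ range x = C.
pose h C := if pselect (exists x, P C x) is left p then dist A c (projT1 (cid p)) else 0.
have [N hN] := finite_bound h (sph aS).
have dN x : A x -> dist A c x <= N.
  move=> Ax; have := hN (range x) (proj1 (proj1 Ax)); rewrite /h.
  case: pselect => [p|[]]; last by exists x.
  by case: (cid p) => /= y [Ay e]; rewrite (chs_inj Ay Ax e).
exists (N + N) => a b Aa Ab; have := dist_tri cA Aa Ac Ab.
by have := dN _ Aa; have := dN _ Ab; rewrite (distC cA Aa Ac); lia.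
Qed.

Lemma opposite_vertexP v w : opposite_vertices S v w <->
  opp_simplex A [set v] [set w].
Proof.
have cxA := ap_coxeter; have bdA := ap_bounded; split.
  move=> [/vertexS[a Aa [i _ <-]] /vertexS[b Ab [j _ <-]] ne /wall_cuts h].
  exact: (par_vertex_opp cxA bdA Aa Ab ne h).
move=> o; have [[a sa] [b sb] _] := o.
have [_ /(_ v erefl) [i _ ei]] := sa; have [_ /(_ w erefl) [j _ ej]] := sb.
have [Aa _] := sa; have [Ab _] := sb; split.
- by apply/vertexS; exists a => //; exists i.
- by apply/vertexS; exists b => //; exists j.
- by rewrite -ei; rewrite -ei in o; apply: (opp_vertex_neq cxA bdA Aa o).
by apply/wall_cuts; apply: (opp_simplex_par cxA bdA o).
Qed.

Lemma opposite_inP F G : opposite_in S F G <-> opp_simplex A F G.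
Proof.
have cxA := ap_coxeter; have bdA := ap_bounded; split.
  move=> [/(apartment_face _ aS) sF /(apartment_face _ aS) sG h1 h2].
  apply/(opp_simplexP cxA bdA sF sG); split=> [v /h1|w /h2] [u Fu /opposite_vertexP];
  by exists u.
move=> o; have [sF sG _] := o.
have [h1 h2] := proj1 (opp_simplexP cxA bdA sF sG) o.
split; [exact/(apartment_face _ aS)|exact/(apartment_face _ aS)| |].
  by move=> v /h1[w Gw /opposite_vertexP]; exists w.
by move=> v /h2[w Gw /opposite_vertexP]; exists w.
Qed.

End OneApartment.

(** * Retractions and the metric of the building *)

Lemma X_conn : conn X.
Proof.
move=> a b Xa Xb; have [_ _ galD] := chamber_complexP Delta.
have [n h] := galD _ _ (proj1 Xa) (proj1 Xb); exists n.
by apply/(galleryP _ n Xa Xb).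
Qed.

Let ap_iso S S' c F (aS : apartments S) (aS' : apartments S') :=
  @apartment_chs_iso V I Delta S S' c F aS aS'.

(** Each vertex is sent by an isomorphism to [S] fixing [e], from some apartment through [e] and the
    vertex; rigidity makes the value independent of these choices. *)
Lemma retraction S e : apartments S -> chs S e -> exists r, r \o e = e /\
  forall S', apartments S' -> chs S' e -> iso (chs S') (chs S) r.
Proof.
move=> aS Se.
pose P v w := exists S' f, [/\ apartments S', chs S' e, S' [set v],
  iso (chs S') (chs S) f & f \o e = e /\ w = f v].
have /boolp.choice[r rP] v : exists w, P v w.
  have [S' [aS' S'e S'v]] := apartment_join (proj1 (proj1 (ap_X aS Se))) (vertexP Delta v).
  have S'e' := apartment_chs aS' (ap_X aS Se) S'e.
  have [f [fi fe _]] := ap_iso aS' aS S'e' Se (proj1 (apartment_complex aS'))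
    (proj1 (apartment_complex aS)) (cx_conn (ap_coxeter aS')).
  by exists (f v), S', f.
have main S' f x i : apartments S' -> chs S' e -> iso (chs S') (chs S) f ->
    f \o e = e -> chs S' x -> r (x i) = f (x i).
  move=> aS' S'e fi fe S'x.
  have [S1 [f1 [aS1 S1e S1v fi1 [fe1 ->]]]] := rP (x i).
  have S'v : S' [set x i].
    by apply/(apartment_face _ aS'); exists x; split=> // _ ->; exists i.
  have [g [gi ge gv]] := ap_iso aS' aS1 S'e S1e S'v S1v (cx_conn (ap_coxeter aS')).
  have gi' : iso (chs S') (chs S) (f1 \o g) by apply: iso_comp gi fi1.
  have := iso_uniq (ap_coxeter aS') (ap_coxeter aS) fi gi' S'e _ S'x.
  rewrite fe -[RHS]/(f1 \o (g \o e)) ge fe1 => /(_ erefl) /(congr1 (@^~ i)) /= ->.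
  by rewrite gv.
have idi : iso (chs S) (chs S) id by split.
have re : r \o e = e by apply/funext => i /=; rewrite (main S id).
exists r; split=> // S' aS' S'e.
have [f [fi fe _]] := ap_iso aS' aS S'e Se (proj1 (apartment_complex aS'))
  (proj1 (apartment_complex aS)) (cx_conn (ap_coxeter aS')).
split.
  move=> x S'x; have -> : r \o x = f \o x by apply/funext => i; apply: main S'x.
  by case: fi => + _; apply.
move=> x y i j S'x S'y; rewrite (main S' f) // (main S' f) //.
by case: fi => _; apply.
Qed.

Section Retraction.
Variables (S : set (set V)) (e : ch) (r : V -> V).
Hypotheses (aS : apartments S) (Se : chs S e) (re : r \o e = e)
  (ri : forall S', apartments S' -> chs S' e -> iso (chs S') (chs S) r).
Let cxS := ap_coxeter aS.

Lemma retr_id x : chs S x -> r \o x = x.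
Proof.
have idi : iso (chs S) (chs S) id by split.
by move=> Sx; apply: (iso_uniq cxS cxS (ri aS Se) idi Se _ Sx).
Qed.

Lemma retr_in x : X x -> chs S (r \o x).
Proof.
move=> Xx; have [S' [aS' S'e S'x]] := apartment_chs_join (ap_X aS Se) Xx.
by case: (ri aS' S'e) => + _; apply.
Qed.

Lemma retr_le x y : X x -> X y -> dist (chs S) (r \o x) (r \o y) <= dist X x y.
Proof. by apply: dist_map retr_in; [exact: X_conn|exact: cx_conn cxS]. Qed.

Lemma retr_center x : X x -> r \o x = e -> x = e.
Proof.
move=> Xx rx; have [S' [aS' S'e S'x]] := apartment_chs_join (ap_X aS Se) Xx.
by apply: (iso_inj (ri aS' S'e)) => //; rewrite rx re.
Qed.

End Retraction.

Lemma ap_dist S a b : apartments S -> chs S a -> chs S b ->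
  dist (chs S) a b = dist X a b.
Proof.
move=> aS Sa Sb; have [r [re ri]] := retraction aS Sa.
apply/eqP; rewrite eqn_leq; apply/andP; split.
  have := retr_le aS Sa ri (ap_X aS Sa) (ap_X aS Sb).
  by rewrite !(retr_id aS Sa re ri).
have := distP (cx_conn (ap_coxeter aS)) Sa Sb.
by move/(gal_sub (fun x => @ap_X S aS x))/dist_le.
Qed.

Lemma retr_dist S e r x : apartments S -> chs S e -> r \o e = e ->
  (forall S', apartments S' -> chs S' e -> iso (chs S') (chs S) r) -> X x ->
  dist X e (r \o x) = dist X e x.
Proof.
move=> aS Se re ri Xx; have [S' [aS' S'e S'x]] := apartment_chs_join (ap_X aS Se) Xx.
have := iso_dist (ap_coxeter aS') (ap_coxeter aS) (ri _ aS' S'e) S'e S'x.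
by rewrite re !ap_dist //; apply: retr_in ri _ Xx.
Qed.

(** Let [e] be the first chamber from [a] towards [x] and [a'] the neighbour of [a] in [S] across
    the same panel. If they differ, the retraction centred at [a'] sends [e] to [a], since only [a']
    goes to [a']; then [a] would be as near to [b] as [e] is. *)
Lemma ap_convex S a x b : apartments S -> chs S a -> chs S b -> X x ->
  btw X a x b -> chs S x.
Proof.
move=> aS Sa Sb Xx; have Xb := ap_X aS Sb; have cX := X_conn.
move: {2}(dist X a x) (erefl (dist X a x)) => n; elim: n a Sa => [|n IH] a Sa dn bt.
  by rewrite -(dist0 cX (ap_X aS Sa) Xx dn).
have Xa := ap_X aS Sa.
have [|e [i [Xe ae dax]]] := dist_step cX Xa Xx.
  by move=> eq; move: dn; rewrite eq distxx.
have deb : (dist X e b).+1 <= dist X a b.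
  by have := dist_tri cX Xe Xx Xb; move: bt; rewrite /btw; lia.
suff Se : chs S e.
  apply: (IH e) => //; first lia.
  have := dist_tri cX Xa Xe Xb; have := dist_tri cX Xe Xx Xb.
  by move: bt; rewrite /btw (dist1 cX Xa Xe ae); lia.
have [a' Sa' aa'] := cx_nb (ap_coxeter aS) i Sa.
have [<-//|ne] := pselect (a' = e).
have [r [ra' ri]] := retraction aS Sa'.
have Sre := retr_in aS Sa' ri Xe.
have rid x' := retr_id aS Sa' ra' ri (x := x').
have re : r \o e = a.
  have [//|nra] := pselect (r \o e = a).
  have are : adj i a (r \o e).
    split; first exact: nesym.
    by move=> j ji; rewrite -[in LHS](rid _ Sa) /= (proj2 ae).
  have := cx_thin (ap_coxeter aS) Sa Sa' Sre aa' are => /esym.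
  by move/(retr_center aS Sa' ra' ri Xe) => /esym.
have := retr_le aS Sa' ri Xe Xb; rewrite re rid // ap_dist //.
lia.
Qed.

Lemma ap_btw S a x b : apartments S -> chs S a -> chs S x -> chs S b ->
  btw X a x b <-> btw (chs S) a x b.
Proof. by move=> aS Sa Sx Sb; rewrite /btw !ap_dist. Qed.

(** Retract to an apartment through [c] and the nearest chamber [D], with centre [D]: this keeps [F]
    and the distance to [D] and increases no distance, and inside the apartment the gate must be
    [D]. *)
Lemma X_gate_ex F c : X c -> star X F !=set0 -> exists g, gate X c F g.
Proof.
move=> Xc neF; have cX := X_conn.
have [D [XD FD] Dm] := argmin (dist X c) neF; exists D; split=> // x [Xx Fx].
have [S [aS Sc SD]] := apartment_chs_join Xc XD.
have [r [rD ri]] := retraction aS SD.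
have Srx := retr_in aS SD ri Xx.
have sD : star (chs S) F D by split.
have srx : star (chs S) F (r \o x).
  split=> // v Fv; have [j _ ej] := Fx _ Fv; have [k _ ek] := FD _ Fv.
  by exists j => //=; rewrite ej -ek -[in RHS]rD.
have [g [sg gm]] := gate_ex (ap_coxeter aS) Sc (ex_intro _ _ sD).
have [Sg Fg] := sg.
have gD : g = D.
  have := gm _ sD; rewrite -(ap_btw aS) // /btw => h.
  have := Dm g (conj (ap_X aS Sg) Fg).
  by move=> h'; apply: (dist0 cX (ap_X aS Sg) XD); lia.
have := gm _ srx; rewrite gD -(ap_btw aS) // /btw (retr_dist aS SD rD ri Xx).
have := retr_le aS SD ri Xc Xx; rewrite (retr_id aS SD rD ri Sc) ap_dist //.
by have := dist_tri cX Xc XD Xx; lia.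
Qed.

Lemma X_gate_uniq F c g g' : X c -> gate X c F g -> gate X c F g' -> g = g'.
Proof.
move=> Xc [[Xg Fg] gm] [[Xg' Fg'] gm']; apply: (btw_anti X_conn Xc) => //.
  by apply: gm; split.
by apply: gm'; split.
Qed.

Lemma ap_gate S F c g : apartments S -> chs S c -> star (chs S) F !=set0 ->
  gate X c F g <-> gate (chs S) c F g.
Proof.
move=> aS Sc neF.
have sX x : star (chs S) F x -> star X F x by move=> [/(ap_X aS)].
have XS y : gate X c F y -> gate (chs S) c F y.
  move=> [[Xy Fy] ym]; have [x sx] := neF; have [Sx _] := sx.
  have Sy : chs S y := ap_convex aS Sc Sx Xy (ym _ (sX _ sx)).
  split=> // z sz; have [Sz _] := sz; rewrite -(ap_btw aS) //.
  exact: (ym _ (sX _ sz)).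
split; first exact: XS.
move=> gg; have [y gy] : exists y, gate X c F y.
  by apply: X_gate_ex; [exact: ap_X Sc|case: neF => x /sX; exists x].
suff -> : g = y by [].
have [[Sg Fg] gm] := gg; have [[Sy Fy] gm'] := XS _ gy.
by apply: (btw_anti (cx_conn (ap_coxeter aS)) Sc) => //; [apply: gm|apply: gm']; split.
Qed.

End Metric.

Lemma image_fix T (f : T -> T) (F : set T) : (forall v, F v -> f v = v) -> f @` F = F.
Proof.
by move=> h; apply/seteqP; split=> [_ [v Fv <-]|v Fv]; [rewrite h|exists v => //; rewrite h].
Qed.

(** * Projections, perspectivities and type-preserving automorphisms *)

Section Projections.
Variables (V : Type) (I : finType) (Delta : building V I).
Local Notation ch := (I -> V).
Local Notation simplices := (simplices Delta).
Local Notation apartments := (apartments Delta).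
Local Notation typ := (typ Delta).
Local Notation chs := (chs Delta).
Implicit Types (a b c e x y : ch) (i j k : I) (f r : V -> V)
  (F G C D : set V) (S K : set (set V)) (H : ch -> bool) (v w : V).
Local Notation X := (chs simplices).
Local Notation res := (res_vertices Delta).
Hypothesis sph : spherical Delta.

Lemma fix_sub a f F : f \o a = a -> F `<=` range a -> forall v, F v -> f v = v.
Proof. by move=> fa Fa v /Fa[j _ <-]; rewrite -[in RHS]fa. Qed.

Definition pair_in (Q : set ch -> set V -> set V -> Prop) F G := exists S,
  [/\ apartments S, star (chs S) F !=set0, star (chs S) G !=set0 & Q (chs S) F G].

Definition iso_inv_rel (Q : set ch -> set V -> set V -> Prop) :=
  forall S S' f F G, apartments S -> apartments S' -> iso (chs S) (chs S') f ->
  star (chs S) F !=set0 -> star (chs S) G !=set0 -> Q (chs S) F G ->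
  Q (chs S') (f @` F) (f @` G).

(** Two moves: the first isomorphism fixes [F] and a chamber on [G] and reaches an apartment through
    [c]; the second fixes [c] and [G] and reaches one through [c] and [e]. *)
Lemma pair_join Q F G c e : iso_inv_rel Q -> pair_in Q F G -> star X F c -> star X G e ->
  exists S, [/\ apartments S, chs S c, chs S e & Q (chs S) F G].
Proof.
move=> Qi [S0 [aS0 nF [e0 [Se0 Ge0]] Q0]] [Xc Fc] [Xe Ge].
have [S1 [aS1 S1c S1e0]] := apartment_chs_join Xc (ap_X aS0 Se0).
have S1F : S1 F by apply/(apartment_face _ aS1); exists c.
have S0F : S0 F by apply/(apartment_face _ aS0).
have [f [fi fe fF]] := apartment_chs_iso aS0 aS1 Se0 S1e0 S0F S1F (cx_conn (ap_coxeter aS0)).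
have nG : star (chs S0) G !=set0 by exists e0.
have Q1 : Q (chs S1) F G.
  rewrite -(image_fix fF) -(image_fix (fix_sub fe Ge0)).
  exact: (Qi S0 S1).
have [S2 [aS2 S2c S2e]] := apartment_chs_join Xc Xe.
have nF1 : star (chs S1) F !=set0 by exists c.
have nG1 : star (chs S1) G !=set0 by exists e0.
have S1G : S1 G by apply/(apartment_face _ aS1).
have S2G : S2 G by apply/(apartment_face _ aS2); exists e.
have [h [hi hc hG]] := apartment_chs_iso aS1 aS2 S1c S2c S1G S2G (cx_conn (ap_coxeter aS1)).
exists S2; split=> //; rewrite -(image_fix hG) -(image_fix (fix_sub hc Fc)).
exact: (Qi S1 S2).
Qed.

Lemma par_inv : iso_inv_rel (@par V I).
Proof.
move=> S S' f F G aS aS' fi nF nG.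
exact: (iso_par (ap_coxeter aS) (ap_coxeter aS') fi nF nG).
Qed.

Lemma opp_simplex_inv : iso_inv_rel (@opp_simplex V I).
Proof.
move=> S S' f F G aS aS' fi nF nG.
exact: (iso_opp_simplex (ap_coxeter aS) (ap_coxeter aS') (ap_bounded aS sph) fi).
Qed.

Lemma oppositeP F G : opposite Delta F G <-> pair_in (@opp_simplex V I) F G.
Proof.
split=> -[S].
  by move=> aS /(opposite_inP aS sph) o; exists S; split=> //; case: o.
by move=> [aS _ _ o]; exists S => //; apply/(opposite_inP aS sph).
Qed.

Lemma pair_sub (Q Q' : set ch -> set V -> set V -> Prop) F G :
  (forall S, apartments S -> Q (chs S) F G -> Q' (chs S) F G) ->
  pair_in Q F G -> pair_in Q' F G.
Proof. by move=> h [S [aS nF nG /(h S aS)]]; exists S. Qed.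

Lemma opposite_par F G : opposite Delta F G -> pair_in (@par V I) F G.
Proof.
move/oppositeP; apply: pair_sub => S aS.
exact: (opp_simplex_par (ap_coxeter aS) (ap_bounded aS sph)).
Qed.

Lemma opposite_sym F G : opposite Delta F G -> opposite Delta G F.
Proof.
move/oppositeP => [S [aS nF nG o]]; apply/oppositeP; exists S; split=> //.
exact: opp_simplex_sym.
Qed.

Lemma par_pair_sym F G : pair_in (@par V I) F G -> pair_in (@par V I) G F.
Proof. by move=> [S [aS nF nG h]]; exists S; split=> //; apply: par_sym. Qed.

Definition prj G c : ch :=
  if pselect (exists g, gate X c G g) is left h then projT1 (cid h) else c.

Lemma prjP G c : X c -> star X G !=set0 -> gate X c G (prj G c).
Proof.
move=> Xc nG; rewrite /prj; case: pselect => [h|[]]; first by case: (cid h).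
exact: X_gate_ex.
Qed.

Lemma gate_prj G c b : X c -> gate X c G b -> prj G c = b.
Proof.
move=> Xc gb; apply: (X_gate_uniq Xc (prjP Xc _) gb).
by case: gb => sb _; exists b.
Qed.

Lemma star_X S F : apartments S -> star (chs S) F !=set0 -> star X F !=set0.
Proof. by move=> aS [x [/(ap_X aS) Xx Fx]]; exists x. Qed.

Lemma pair_X Q F G : pair_in Q F G -> star X F !=set0 /\ star X G !=set0.
Proof. by move=> [S [aS nF nG _]]; split; apply: star_X aS _. Qed.

Lemma gate_invX F G c b : pair_in (@par V I) F G -> star X F c -> gate X c G b ->
  gate X b F c.
Proof.
move=> pr sc gb; have [nF [e se]] := pair_X pr; have [Xc Fc] := sc.
have [S [aS Sc Se pS]] := pair_join par_inv pr sc se.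
have sF : star (chs S) F c by [].
have nGS : star (chs S) G !=set0 by exists e; split=> //; case: se.
have gb' := proj1 (ap_gate b aS Sc nGS) gb.
have [[Sb _] _] := gb'.
by apply/(ap_gate _ aS Sb); [exists c|apply: (gate_inv (ap_coxeter aS)) pS _ gb'].
Qed.

Lemma prjK F G c : pair_in (@par V I) F G -> star X F c -> prj F (prj G c) = c.
Proof.
move=> pr sc; have [_ nG] := pair_X pr; have gb := prjP (proj1 sc) nG.
by apply: gate_prj; [case: gb => -[]|apply: gate_invX gb].
Qed.

Lemma prj_star G c : X c -> star X G !=set0 -> star X G (prj G c).
Proof. by move=> Xc /(prjP Xc)[]. Qed.

Lemma X_star_gal G x y : star X G x -> star X G y -> exists n, gal (star X G) n x y.
Proof.
move=> [Xx Gx] [Xy Gy]; have [S [aS Sx Sy]] := apartment_chs_join Xx Xy.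
exists (dist (chs S) x y); apply: (@gal_sub _ _ (star (chs S) G)).
  by move=> z [/(ap_X aS)].
by apply: (star_gal (ap_coxeter aS)).
Qed.

Lemma X_nb c i : X c -> exists2 e, X e & adj i c e.
Proof.
move=> Xc; have [S [aS Sc _]] := apartment_chs_join Xc Xc.
by have [e Se ce] := cx_nb (ap_coxeter aS) i Sc; exists e => //; apply: ap_X aS _ Se.
Qed.

Lemma X_star_adj a b i F : star X F a -> X b -> adj i a b -> ~ F (a i) -> star X F b.
Proof.
move=> [Xa Fa] Xb ab nF; split=> // v Fv.
by apply: (adj_range ab (Fa _ Fv)) => e; apply: nF; rewrite -e.
Qed.

Lemma X_star_type F x y i : star X F x -> star X F y -> adj i x y -> ~ F (x i).
Proof.
move=> [Xx Fx] [Xy Fy] xy /Fy /(chs_vertex Xy); rewrite (proj2 Xx).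
exact: adj_neq xy.
Qed.

Lemma resP F v : res F v <-> ~ F v /\ exists c, [/\ X c, F `<=` range c & range c v].
Proof.
rewrite /res_vertices /= simplex_face; split=> -[nF [c]].
  move=> [Xc Fc]; split=> //; exists c; split=> //; first by move=> u Fu; apply: Fc; left.
  by apply: Fc; right.
by move=> [Xc Fc cv]; split=> //; exists c; split=> // u [/Fc//|->].
Qed.

(* In an apartment through c, c' and the projection of c the reflection taking
   c to c' also takes one projection to the other. *)
Lemma prj_adj F G c c' i : pair_in (@par V I) F G -> star X F c -> star X F c' ->
  adj i c c' -> exists S r, [/\ apartments S, chs S c /\ chs S c', chs S (prj G c),
    refl (chs S) (side (chs S) c c') r &
    [/\ r \o c = c', r \o prj G c = prj G c', forall v, F v \/ G v -> r v = v &
      exists k, adj k (prj G c) (prj G c')]].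
Proof.
move=> pr sc sc' cc'; have [_ nG] := pair_X pr.
have gb := prjP (proj1 sc) nG; have gb' := gate_invX pr sc gb.
set b := prj G c in gb gb' *; have [sb _] := gb; have [Xb _] := sb.
have [S [aS Sc' Sb pS]] := pair_join par_inv pr sc' sb.
(* [c] is the gate on [F] of its projection [b], so it lies between [b] and [c'], and convexity puts
   it in [S]. *)
have Sc : chs S c by apply: (ap_convex aS Sb Sc') (proj1 sc) _; case: gb' => _; apply.
have cxS := ap_coxeter aS.
have sFc : star (chs S) F c by split=> //; case: sc.
have sFc' : star (chs S) F c' by split=> //; case: sc'.
have nGS : star (chs S) G !=set0 by exists b; split=> //; case: sb.
have gbS := proj1 (ap_gate b aS Sc nGS) gb.
have [r [k [rr rc rF gr kr]]] := gate_adj cxS pS sFc sFc' cc' gbS.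
have e : r \o b = prj G c'.
  by apply/esym/gate_prj; [case: sc'|apply/(ap_gate _ aS Sc' nGS)].
exists S, r; split=> //; split=> //; exists k; by rewrite -e.
Qed.

(** Projection is so far only a map on chambers preserving adjacency; [transfer] makes the chambers
    containing [v] project to chambers with a common vertex. *)
Lemma prj_vertex F G v : pair_in (@par V I) F G -> res F v -> exists w, res G w /\
  forall c, star X (F `|` [set v]) c -> range (prj G c) w.
Proof.
move=> pr rv; have [nF [c [Xc Fc [i _ ci]]]] := proj1 (resP _ _) rv.
have [neF nG] := pair_X pr; have pr' := par_pair_sym pr.
have sc : star X F c by [].
have [c' Xc' cc'] := X_nb i Xc.
have sc' : star X F c' by apply: (X_star_adj sc Xc' cc'); rewrite ci.
have [_ [_ [_ _ _ _ [_ _ _ [k hk]]]]] := prj_adj pr sc sc' cc'.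
have sT x : star X F x -> star X G (prj G x) by move=> [Xx _]; apply: prj_star.
exists (prj G c k); split.
  apply/resP; split; first exact: X_star_type (sT _ sc) (sT _ sc') hk.
  by exists (prj G c); split; [case: (sT _ sc)|case: (sT _ sc)|exists k].
have scv : star X (F `|` [set v]) c by split=> // u [/Fc//|->]; exists i.
move=> x sx; have [n] := X_star_gal scv sx.
have sub : star X (F `|` [set v]) `<=` [set z | star X F z /\ z i = v].
  move=> z [Xz Fz]; split; first by split=> // u Fu; apply: Fz; left.
  have /(chs_vertex Xz) : range z v by apply: Fz; right.
  by rewrite -ci (proj2 Xc) => ->.
move=> /(gal_sub sub) gx; exists k => //.
apply: (@transfer V I (star X F) (prj G) _ _ _ _ v c x c' i k n ci sc sc' cc' hk gx).
- move=> y z l sy sz yz.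
  by have [_ [_ [_ _ _ _ [_ _ _ h]]]] := prj_adj pr sy sz yz.
- move=> y z l sy sz yz.
  have [_ [_ [_ _ _ _ [_ _ _ h]]]] := prj_adj pr' (sT _ sy) (sT _ sz) yz.
  by move: h; rewrite !prjK.
- by move=> y z sy sz e; rewrite -(prjK pr sy) e prjK.
move=> y z y' l j sy sz sy' yz jl yy'.
have [S [r [aS [Sy Sz] Sp rr [ry rp rF _]]]] := prj_adj pr sy sz yz.
have cxS := ap_coxeter aS.
(* [y'] may lie outside [S]; the [l]-neighbour [y1] of [y] in [S] represents the same panel, and the
   reflection moves it together with its projection. *)
have [y1 Sy1 yy1] := cx_nb cxS l Sy; have Xy1 := ap_X aS Sy1.
have nFl := X_star_type sy sy' yy'.
have sy1 := X_star_adj sy Xy1 yy1 nFl.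
have [_ [_ [_ _ _ _ [_ _ _ [m hm]]]]] := prj_adj pr sy sy1 yy1.
have nGS : star (chs S) G !=set0 by exists (prj G y); split=> //; case: (sT _ sy).
have gp1 := prjP Xy1 nG.
have gp1S := proj1 (ap_gate _ aS Sy1 nGS) gp1.
have Sp1 : chs S (prj G y1) by case: gp1S => -[].
have Srx := refl_in rr Sy1.
have e1 : prj G (r \o y1) = r \o prj G y1.
  apply: gate_prj; first exact: ap_X aS _ Srx.
  apply/(ap_gate _ aS Srx nGS); apply: (gate_refl cxS rr _ Sy1 gp1S).
  by move=> u Gu; apply: rF; right.
exists y1, (r \o y1), m; split=> //.
- split=> //; split; first exact: ap_X aS _ Srx.
  move=> u Fu; have [q _ eq] := proj2 sy1 _ Fu; exists q => //=.
  by rewrite eq rF //; left.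
- by rewrite -ry; apply: (iso_adj (refl_iso rr)).
- by rewrite e1 -rp; apply: (iso_adj (refl_iso rr)).
Qed.

Lemma prj_map F G : pair_in (@par V I) F G -> exists f, forall v, res F v ->
  res G (f v) /\ forall c, star X (F `|` [set v]) c -> range (prj G c) (f v).
Proof.
move=> pr; have /boolp.choice[f fP] v : exists w, res F v -> res G w /\
    forall c, star X (F `|` [set v]) c -> range (prj G c) w.
  by have [/(prj_vertex pr)[w]|nr] := pselect (res F v); [exists w|exists v].
by exists f.
Qed.

(** [residue] only asks that each vertex of [A] be joinable to [F]; the flag property of an
    apartment through [F] and [A] joins them all at once. *)
Lemma link_simplex F A : simplices F -> simplices A -> A `<=` res F ->
  simplices (F `|` A).
Proof.
move=> hF hA sub; have [S [aS SF SA]] := apartment_join hF hA.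
apply/simplex_face; apply: (star_X aS).
apply: (flag (ap_coxeter aS)); [exact/(apartment_face _ aS)|exact/(apartment_face _ aS)|].
move=> v Av; apply/(apartment_face _ aS).
have Sv : S [set v].
  by case: (apartment_complex aS) => _; apply; [exact: SA|move=> _ ->].
have [_ hFv] := sub _ Av.
have [S' [aS' S'Fv _]] := apartment_join hFv hFv.
have [_ cS'] := apartment_complex aS'.
have S'F : S' F by apply: cS' S'Fv _ => u; left.
have S'v : S' [set v] by apply: cS' S'Fv _ => u; right.
have [f [_ fi] ff] := apartment_iso aS' aS S'F S'v SF Sv.
rewrite -(@image_fix _ f (F `|` [set v])) //; apply/fi => //.
by move=> u hu; apply: cS' S'Fv _ => _ ->.
Qed.

Lemma residue_vertices F v : vertices (residue Delta F) v <-> res F v.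
Proof.
split; first by move=> [_]; apply.
by move=> rv; split; [exact: vertexP|move=> _ ->].
Qed.

Lemma star_res F c i : star X F c -> ~ F (c i) -> res F (c i).
Proof. by move=> [Xc Fc] nF; apply/resP; split=> //; exists c; split=> //; exists i. Qed.

Lemma star_add F v c : star X F c -> range c v -> star X (F `|` [set v]) c.
Proof. by move=> [Xc Fc] cv; split=> // u [/Fc//|->]. Qed.

Lemma star_meet F u v : res F u -> res F v ->
  (forall c, star X (F `|` [set v]) c -> range c u) -> u = v.
Proof.
move=> [nFu _] rv h; have [nFv [c [Xc Fc cv]]] := proj1 (resP _ _) rv.
have sc : star X (F `|` [set v]) c by apply: star_add.
have [//|ne] := pselect (u = v); have [j _ ej] := h _ sc.
have [c' Xc' cc'] := X_nb j Xc.
have : star X (F `|` [set v]) c'.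
  apply: (X_star_adj sc Xc' cc'); rewrite ej => -[//|].
  exact: ne.
move/h => /(chs_vertex Xc'); rewrite -ej (proj2 Xc) => e.
by case: (adj_neq cc').
Qed.

Lemma chambers_onE F C : chambers_on simplices F C <->
  exists2 c, star X F c & range c = C.
Proof.
split; last by move=> [c [[kc ct] Fc] <-].
move=> [kC FC]; have [c Xc e] := chamber_fun kC.
by exists c => //; split=> //; rewrite e.
Qed.

Lemma is_projP G c D : X c -> star X G !=set0 ->
  is_proj Delta G (range c) D <-> D = range (prj G c).
Proof.
move=> Xc nG; have gp := prjP Xc nG; have [sp pm] := gp; have [Xp Gp] := sp.
have cX := @X_conn V I Delta.
have near : nearest Delta G (range c) (range (prj G c)).
  split; first by apply/chambers_onE; exists (prj G c).
  exists (dist X c (prj G c)).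
    exact: (proj2 (galleryP (fun _ h => h) _ Xc Xp) (distP cX Xc Xp)).
  move=> E m /chambers_onE[e se <-] /(galleryP (fun _ h => h) m Xc (proj1 se)).
  by move/dist_le; have := pm _ se; rewrite /btw; lia.
have un D' : nearest Delta G (range c) D' -> range (prj G c) = D'.
  move=> [/chambers_onE[e se <-] [n hn nm]].
  have [Xe _] := se.
  have hn' := proj1 (galleryP (fun _ h => h) n Xc Xe) hn.
  have := nm _ (dist X c (prj G c)) (proj2 (chambers_onE G _) (ex_intro2 _ _ _ sp erefl)).
  move=> /(_ (proj2 (galleryP (fun _ h => h) _ Xc Xp) (distP cX Xc Xp))) h1.
  have h2 := dist_le hn'; have := pm _ se; rewrite /btw => h3.
  by rewrite (dist0 cX Xp Xe) //; lia.
split; first by move=> [h h']; apply/esym/un.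
by move=> ->; split=> // D' /un.
Qed.

Definition typed_aut g := automorphism Delta g /\ forall v, typ (g v) = typ v.

Section Perspectivity.
Variables F G : set V.
Hypothesis opFG : opposite Delta F G.
Let pr := opposite_par opFG.
Let pr' := par_pair_sym pr.

Lemma prj_map_inv f f' : (forall v, res F v ->
  res G (f v) /\ forall c, star X (F `|` [set v]) c -> range (prj G c) (f v)) ->
  (forall v, res G v ->
  res F (f' v) /\ forall c, star X (G `|` [set v]) c -> range (prj F c) (f' v)) ->
  forall v, res F v -> f' (f v) = v.
Proof.
move=> hf hf' v rv; have [rw hw] := hf v rv; have [rv' hv'] := hf' _ rw.
apply: (star_meet rv' rv) => c sc.
have sFc : star X F c by case: sc => Xc Fc; split=> // u Fu; apply: Fc; left.
rewrite -(prjK pr sFc); apply: hv'; apply: star_add (hw _ sc).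
by apply: prj_star; [case: sc|case: (pair_X pr)].
Qed.

(** The vertex maps of the two projections are inverse to each other because the projections are,
    and they preserve simplices because a simplex of the residue lies with [F] in a chamber. *)
Lemma perspectivity_ex : F !=set0 -> G !=set0 -> ~ chamber simplices F ->
  ~ chamber simplices G -> exists f, perspectivity Delta F G f.
Proof.
move=> nF nG ncF ncG; have [f hf] := prj_map pr; have [f' hf'] := prj_map pr'.
have [sF sG] := pair_X pr.
have fK := prj_map_inv hf hf'.
have f'K v : res G v -> f (f' v) = v.
  move=> rv; have [rw hw] := hf' v rv; have [rv' hv'] := hf _ rw.
  apply: (star_meet rv' rv) => c sc.
  have sGc : star X G c by case: sc => Xc Gc; split=> // u Gu; apply: Gc; left.
  rewrite -(prjK pr' sGc); apply: hv'; apply: star_add (hw _ sc).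
  by apply: prj_star => //; case: sc.
exists f; split=> //.
- split; first split.
  + by move=> v /residue_vertices/hf[rw _]; apply/residue_vertices.
  + move=> u v; rewrite !inE => /residue_vertices ru /residue_vertices rv e.
    by rewrite -(fK _ ru) e fK.
  + move=> w /residue_vertices rw; have [rv _] := hf' _ rw.
    by exists (f' w); [apply/residue_vertices|apply: f'K].
  have half1 F' G' h A : pair_in (@par V I) F' G' -> (forall v, res F' v -> res G' (h v) /\
      forall c, star X (F' `|` [set v]) c -> range (prj G' c) (h v)) ->
      residue Delta F' A -> residue Delta G' (h @` A).
    move=> pr0 hh [hA Ar]; have [sF' sG'] := pair_X pr0.
    have := link_simplex (proj2 (simplex_face _ _) sF') hA Ar.
    move=> /simplex_face[c [Xc FAc]].
    have sc v : A v -> star X (F' `|` [set v]) c.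
      by move=> Av; split=> // u [Fu|->]; apply: FAc; [left|right].
    split; last by move=> _ [v /Ar/hh[rv _] <-].
    apply/simplex_face; exists (prj G' c); split; first by case: (prj_star Xc sG').
    by move=> _ [v Av <-]; case: (hh v (Ar _ Av)) => _; apply; apply: sc.
  move=> A vA; split; first exact: (half1 _ _ _ _ pr hf).
  move/(half1 _ _ _ _ pr' hf'); rewrite image_comp image_fix //.
  by move=> v /vA/residue_vertices; apply: fK.
move=> _ /chambers_onE[c sc <-]; have [Xc Fc] := sc; apply/is_projP => //.
have [Xp Gp] := prj_star Xc sG.
apply/seteqP; split=> [w [/Gp //|[v [cv nFv] <-]]|w pw].
  have rv : res F v by case: cv nFv => i _ <-; apply: star_res.
  by case: (hf v rv) => _; apply; apply: star_add.
have [Gw|nGw] := pselect (G w); [by left|right].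
have rw : res G w by apply/resP; split=> //; exists (prj G c).
have [rv hv] := hf' _ rw; exists (f' w); last exact: f'K.
split; last by case: rv.
by rewrite -(prjK pr sc); apply: hv; split=> // u [/Gp//|->].
Qed.

End Perspectivity.

Lemma perspectivityE F G f c : perspectivity Delta F G f -> star X F c ->
  range (prj G c) = G `|` f @` (range c `\` F).
Proof.
move=> [o _ _ _ h] sc; have [_ sG] := pair_X (opposite_par o).
have /h : chambers_on simplices F (range c) by apply/chambers_onE; exists c.
by move=> /(is_projP _ (proj1 sc) sG) ->.
Qed.

Lemma perspectivity_res F G f v : perspectivity Delta F G f -> res F v -> res G (f v).
Proof.
by move=> [_ _ _ [[h _ _] _] _] /residue_vertices/h/residue_vertices.
Qed.

Lemma perspectivity_inj F G f u v : perspectivity Delta F G f -> res F u -> res F v ->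
  f u = f v -> u = v.
Proof.
by move=> [_ _ _ [[_ h _] _] _] ru rv; apply: h; rewrite inE; apply/residue_vertices.
Qed.

(** If [f' v = f u] with [u] another vertex of [c], the neighbour of [c] missing only [v] still
    contains [u], so its image contains [f' v], against the injectivity of [f']. *)
Lemma res_map_uniq F G (T : ch -> set V) f f' :
  (forall v, res F v -> res G (f v)) -> (forall v, res F v -> res G (f' v)) ->
  (forall u v, res F u -> res F v -> f' u = f' v -> u = v) ->
  (forall c, star X F c -> T c = G `|` f @` (range c `\` F)) ->
  (forall c, star X F c -> T c = G `|` f' @` (range c `\` F)) ->
  forall v, res F v -> f v = f' v.
Proof.
move=> fr fr' inj' hf hf' v rv.
have [nFv [c [Xc Fc [i _ ei]]]] := proj1 (resP _ _) rv.
have sc : star X F c by [].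
have ind x : star X F x -> range x v -> exists2 u, (range x `\` F) u & f' u = f v.
  move=> sx xv; have : T x (f v) by rewrite hf //; right; exists v.
  rewrite hf' // => -[Gv|//]; by case: (fr _ rv).
have ind' x : star X F x -> range x v -> exists2 u, (range x `\` F) u & f u = f' v.
  move=> sx xv; have : T x (f' v) by rewrite hf' //; right; exists v.
  rewrite hf // => -[Gv|//]; by case: (fr' _ rv).
have [u [[j _ ej] nFu] eu] := ind' c sc (ex_intro2 _ _ i Logic.I ei).
have [uv|ne] := pselect (u = v); first by rewrite -eu uv.
have [c' Xc' cc'] := X_nb i Xc.
have sc' : star X F c' by apply: (X_star_adj sc Xc' cc'); rewrite ei.
have ru : res F u by rewrite -ej; apply: star_res => //; rewrite ej.
have : T c' (f' v).
  rewrite hf // -eu; right; exists u => //; split=> //; exists j => //.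
  by rewrite -(proj2 cc') // => ji; apply: ne; rewrite -ej -ei ji.
rewrite hf' // => -[Gv|[u' [c'u nFu'] e]]; first by case: (fr' _ rv).
have ru' : res F u' by case: c'u nFu' => l _ <-; apply: star_res.
move: c'u; rewrite (inj' _ _ ru' rv e) => /(chs_vertex Xc').
by rewrite -ei (proj2 Xc) => e'; case: (adj_neq cc').
Qed.

(** * Type-preserving automorphisms *)

Section Automorphism.
Variable g : V -> V.
Hypothesis ag : typed_aut g.

Lemma vertexD v : vertices simplices v. Proof. exact: vertexP. Qed.

Lemma aut_inj u v : g u = g v -> u = v.
Proof.
by case: ag => -[[_ h _] _] _; apply: h; rewrite inE; apply: vertexD.
Qed.

Lemma aut_simplex F : simplices F <-> simplices (g @` F).
Proof. by case: ag => -[_ h] _; apply: h => v _; apply: vertexD. Qed.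

Lemma aut_X c : X c -> X (g \o c).
Proof.
move=> [kc ct]; apply: chs_comp; last by move=> i; rewrite (proj2 ag).
apply: isomorphism_chamber (proj1 ag) kc; exact: complexD.
Qed.

Lemma aut_inv : exists g', [/\ typed_aut g', cancel g g' & cancel g' g].
Proof.
have [[[_ inj surj] gi] gt] := ag.
have /boolp.choice[g' g'K] w : exists v, g v = w.
  by have [v _ e] := surj _ (vertexD w); exists v.
have gK : cancel g g' by move=> v; apply: aut_inj.
exists g'; split=> //; split; last by move=> v; rewrite -gt g'K.
split; first split.
- by move=> v _; apply: vertexD.
- by move=> u v _ _ e; rewrite -(g'K u) e.
- by move=> v _; exists (g v); [exact: vertexD|].
move=> F _; rewrite [in X in _ <-> X]aut_simplex image_comp image_fix // => v _.
exact: g'K.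
Qed.

Lemma aut_adj i a b : adj i a b -> adj i (g \o a) (g \o b).
Proof.
move=> [ne h]; split; last by move=> j ji; rewrite /= h.
by move=> e; apply: ne; apply/funext => j; apply: aut_inj; exact: (congr1 (@^~ j) e).
Qed.

Lemma aut_star F c : star X F c -> star X (g @` F) (g \o c).
Proof.
move=> [Xc Fc]; split; first exact: aut_X.
by move=> _ [v /Fc[j _ <-] <-]; exists j.
Qed.

End Automorphism.

End Projections.

(** * Root groups and the stars they fix *)

Section RootGroups.
Variables (V : Type) (I : finType) (Delta : building V I).
Local Notation ch := (I -> V).
Local Notation simplices := (simplices Delta).
Local Notation apartments := (apartments Delta).
Local Notation typ := (typ Delta).
Local Notation chs := (chs Delta).
Implicit Types (a b c e x y z : ch) (i j k : I) (f r : V -> V)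
  (F G C D : set V) (S K : set (set V)) (H : ch -> bool) (v w : V).
Local Notation X := (chs simplices).
Local Notation typed_aut := (typed_aut Delta).
Hypothesis sph : spherical Delta.
Let cX := @X_conn V I Delta.

Section Automorphism.
Variable g : V -> V.
Hypothesis ag : typed_aut g.

Lemma aut_dist a b : X a -> X b -> dist X (g \o a) (g \o b) = dist X a b.
Proof.
move=> Xa Xb; have [g' [ag' gK _]] := aut_inv ag.
have := dist_map cX cX (aut_X ag) Xa Xb.
have := dist_map cX cX (aut_X ag') (aut_X ag Xa) (aut_X ag Xb).
have e c : g' \o (g \o c) = c by apply/funext => i; rewrite /= gK.
by rewrite !e; lia.
Qed.

Lemma aut_gate F c b : X c -> gate X c F b -> gate X (g \o c) (g @` F) (g \o b).
Proof.
move=> Xc [sb bm]; split; first exact: aut_star.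
have [g' [ag' gK g'K]] := aut_inv ag.
move=> x sx; have [Xx _] := sx; have [Xb _] := sb.
have ex : x = g \o (g' \o x) by apply/funext => i; rewrite /= g'K.
have sx' : star X F (g' \o x).
  have := aut_star ag' sx; rewrite image_comp image_fix // => v _; exact: gK.
have [Xgx _] := sx'; suff : btw X (g \o c) (g \o b) (g \o (g' \o x)) by rewrite -ex.
by rewrite /btw !aut_dist //; apply: bm.
Qed.

(** The set of apartments is not assumed stable under automorphisms. But an apartment through the
    images of two opposite chambers of [S] contains, by convexity, the images of all chambers
    between them, that is, of all of [S]. *)
Lemma aut_apartment S : apartments S ->
  exists2 S', apartments S' & iso (chs S) (chs S') g.
Proof.
move=> aS; have cxS := ap_coxeter aS.
have [c [Sc _]] := proj1 (apartment_face _ aS) (proj1 (apartment_complex aS)).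
have bdS := ap_bounded aS sph.
have [b cb] := far_ex cxS bdS (star0 Sc); have [_ Sb] := opp_in cb.
have Xc := ap_X aS Sc; have Xb := ap_X aS Sb.
have [S' [aS' S'c S'b]] := apartment_chs_join (aut_X ag Xc) (aut_X ag Xb).
exists S' => //; split; last by move=> x y i j _ _ /(aut_inj ag).
move=> x Sx; have Xx := ap_X aS Sx.
apply: (ap_convex aS' S'c S'b (aut_X ag Xx)).
rewrite /btw !aut_dist //; apply/(ap_btw aS) => //.
exact: (far_btw cxS cb (star0 Sx)).
Qed.

Lemma aut_opposite F G : opposite Delta F G -> opposite Delta (g @` F) (g @` G).
Proof.
move=> /(oppositeP sph)[S [aS nF nG o]]; have [S' aS' gi] := aut_apartment aS.
have o' := opp_simplex_inv sph aS aS' gi nF nG o.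
by apply/(oppositeP sph); exists S'; split=> //; case: o'.
Qed.

Lemma aut_fix_adj a b i : g \o a = a -> X b -> adj i a b ->
  g @` range b = range b -> g \o b = b.
Proof.
move=> ga Xb ab gb; apply/funext => j /=; have [->|/eqP ji] := eqVneq j i.
  have : range b (g (b i)) by rewrite -gb; exists (b i) => //; exists i.
  by move/(chs_vertex Xb); rewrite (proj2 ag) (proj2 Xb).
by rewrite -(proj2 ab) // -[in RHS]ga.
Qed.

(* Fixing two chambers of an apartment, g fixes the galleries between them. *)
Lemma aut_fix_btw S a b y : apartments S -> chs S a -> chs S b -> chs S y ->
  g \o a = a -> g \o b = b -> btw X a y b -> g \o y = y.
Proof.
move=> aS Sa Sb Sy ga gb; have cxS := ap_coxeter aS.
have [Xa Xb] := (ap_X aS Sa, ap_X aS Sb).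
move: {2}(dist X y a) (erefl (dist X y a)) => n; elim: n y Sy => [|n IH] y Sy dn bt.
  by rewrite (dist0 cX (ap_X aS Sy) Xa dn).
have Xy := ap_X aS Sy.
have [|e [i [Xe ye dye]]] := dist_step cX Xy Xa.
  by move=> eq; move: dn; rewrite eq distxx.
have bte : btw X a e b.
  have := dist_tri cX Xa Xe Xb; have := dist_tri cX Xe Xy Xb.
  have := distC cX Xa Xe; have := distC cX Xa Xy; have := dist1 cX Xy Xe ye.
  by have := distC cX Xe Xy; move: bt; rewrite /btw; lia.
have Se := ap_convex aS Sa Sb Xe bte.
have ge : g \o e = e by apply: IH => //; lia.
have Xgy := aut_X ag Xy.
have btg : btw X a (g \o y) b.
  by rewrite /btw -{1}ga -[in X in _ + X]gb !aut_dist.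
have Sgy := ap_convex aS Sa Sb Xgy btg.
apply: (cx_thin cxS Se Sgy Sy _ (adj_sym ye)).
by rewrite -[in X in adj _ X]ge; apply: (aut_adj ag); apply: adj_sym.
Qed.

End Automorphism.

(* The apartment through x obtained from S by keeping the side of c of the wall
   between c and e, locally at the face G; z is opposite e in the star of G. *)
Lemma swap_apartment S G c e x i : apartments S -> star (chs S) G c ->
  star (chs S) G e -> adj i c e -> X x -> adj i c x ->
  exists S' f z, [/\ apartments S' /\ iso (chs S) (chs S') f, far (chs S) G e z,
    [/\ chs S' x, chs S' z & chs S' c],
    [/\ f \o e = x, f \o z = z & f \o c = c] &
    forall y, star (chs S) G y -> side (chs S) c e y -> f \o y = y].
Proof.
move=> aS [Sc Gc] [Se Ge] ce Xx cx; have cxS := ap_coxeter aS.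
have bdS := ap_bounded aS sph; have cS := cx_conn cxS.
have [z ez] := far_ex cxS bdS (conj Se Ge : star (chs S) G e).
have [_ [Sz Gz] zsep] := ez.
have [Xc Xz] := (ap_X aS Sc, ap_X aS Sz).
have rH := rt_side Sc Se ce.
have Hc : side (chs S) c e c by rewrite /side distxx // (dist1 cS Sc Se ce).
have He : side (chs S) c e e = false.
  by have := side_sep cxS Sc Se ce; rewrite Hc; case: side.
have cu : cuts (chs S) (side (chs S) c e) G by exists c, e; rewrite Hc He.
(* The retraction centred at [c] sends [x] to [e], so [x] is at least as far from [z] as [e], which
   is one step further than [c]. *)
have bzx : btw X z c x.
  have d1 := far_btw cxS ez (conj Sc Gc : star (chs S) G c).
  have [r [rc ri]] := retraction aS Sc.
  have Srx := retr_in aS Sc ri Xx.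
  have rxe : r \o x = e.
    apply/esym; apply: (cx_thin cxS Sc Se Srx ce); split.
      by move=> /esym /(retr_center aS Sc rc ri Xx) e'; case: cx => /(_ (esym e')).
    by move=> j ji; rewrite -[in LHS]rc /= (proj2 cx).
  have := retr_le aS Sc ri Xz Xx; rewrite rxe (retr_id aS Sc rc ri Sz).
  have := dist_tri cX Xz Xc Xx; rewrite (dist1 cX Xc Xx cx).
  have := dist1 cS Se Sc (adj_sym ce); have := distC cS Sz Se; have := distC cS Sz Sc.
  by move: d1; rewrite /btw -(ap_dist aS Sz Sc) (dist1 cX Xc Xx cx); lia.
have [S' [aS' S'z S'x]] := apartment_chs_join Xz Xx.
have cxS' := ap_coxeter aS'.
have S'c := ap_convex aS' S'z S'x Xc bzx.
have S1 : S (range c) by case: Sc => -[].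
have S1' : S' (range c) by case: S'c => -[].
have [f [fi fz fc]] := apartment_chs_iso aS aS' Sz S'z S1 S1' cS.
have {}fc : f \o c = c by apply/funext => j; apply: fc; exists j.
have fe : f \o e = x.
  apply: (cx_thin cxS' S'c _ S'x _ cx); first by case: fi => + _; apply.
  by rewrite -[in X in adj _ X]fc; apply: (iso_adj fi).
exists S', f, z; split=> // y [Sy Gy] Hy.
(* A wall through [G] with [c] and [z] on the same side separates [c] from [e], hence is the wall
   between them, and [y] is on the side of [c]. *)
have btS : btw (chs S) c y z.
  apply: (rt_btw cxS) => // H rH' cz.
  have [cH|nH] := pselect (cuts (chs S) H G).
    have ne : H c != H e.
      by rewrite cz eq_sym; apply: zsep.
    have := rt_sep cxS rH' Sc Se ce ne Sy Sc; rewrite Hy Hc eqxx.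
    by move/negbT; rewrite negbK => /eqP.
  by apply: contrapT => /eqP ne; apply: nH; exists y, c.
have Xy := ap_X aS Sy.
have S'y : chs S' y by apply: (ap_convex aS' S'c S'z Xy); apply/(ap_btw aS).
have [r [rc ri]] := retraction aS' S'c.
have := iso_uniq cxS cxS' fi (ri S aS Sc) Sc _ Sy.
by rewrite fc rc => ->//; apply: (retr_id aS' S'c rc ri).
Qed.

Section RootElement.
Variables (S al : set (set V)) (H : ch -> bool) (u : V -> V).
Hypotheses (aS : apartments S) (rH : rt (chs S) H)
  (alH : forall F, al F <-> exists2 x, star (chs S) F x & H x)
  (ru : root_group Delta S al u) (rank2 : 2 <= #|I|).
Let cxS := ap_coxeter aS.
Let cS := cx_conn cxS.

Lemma panel_cuts a b i (K : ch -> bool) : rt (chs S) K -> chs S a -> chs S b -> adj i a b ->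
  cuts (chs S) K (range a `\ a i) <-> K a != K b.
Proof.
move=> rK Sa Sb ab; split; last first.
  move=> ne; exists a, b; split=> //.
  by split=> // v [av]; apply: (adj_range ab av).
have nbr x : star (chs S) (range a `\ a i) x -> x = a \/ x = b.
  move=> [Sx sx]; have [->|ne] := pselect (a = x); first by left.
  right; apply: (cx_thin cxS Sa Sx Sb _ ab).
  exact: (panel_adj Sa (ap_X aS Sx) ne sx).
move=> [x [y [/nbr xP /nbr yP]]]; case: xP => ->; case: yP => ->; rewrite ?eqxx //.
by rewrite eq_sym.
Qed.

Lemma root_interior a b i x : chs S a -> H a -> chs S b -> adj i a b -> H b -> X x ->
  range a `\ a i `<=` range x -> u @` range x = range x.
Proof.
move=> Sa Ha Sb ab Hb Xx sx; have [_ h] := ru.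
apply: (h _ (range a `\ a i)).
- by case: Xx.
- have aix : a = x \/ adj i a x.
    have [->|ne] := pselect (a = x); [by left|right].
    exact: (panel_adj Sa Xx ne sx).
  exists (x i); first by exists i.
  case: aix => [<- //|ax]; apply/seteqP; split=> v [hv ne].
    split; first exact: (adj_range ax hv).
    by move=> /= ev; apply: ne; have := chs_vertex Sa hv; rewrite ev (proj2 Xx).
  split; first by apply: (adj_range (adj_sym ax) hv) => ev; apply: ne.
  by move=> /= ev; apply: ne; have := chs_vertex Xx hv; rewrite ev (proj2 Sa).
- by apply/alH; exists a => //; split=> // v [].
rewrite (boundaryP aS alH) (panel_cuts rH Sa Sb ab) Ha Hb; exact.
Qed.

Lemma root_one_bad a b c i j : chs S a -> H a -> chs S b -> adj i a b -> ~~ H b ->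
  chs S c -> adj j a c -> ~~ H c -> i = j.
Proof.
move=> Sa Ha Sb ab Hb Sc ac Hc.
have := rt_uniq cxS rH Sa Sb ab Ha Hb Sc; rewrite (negbTE Hc) => /esym.
rewrite (proj1 (side_refl cxS Sa Sb ab) _ Sc) => /negbFE; rewrite /side.
rewrite (dist1 cS Sc Sa (adj_sym ac)) ltnS leqn0 => /eqP /(dist0 cS Sc Sb) e.
by rewrite e in ac; apply: adj_uniq ac.
Qed.

(** If [a] and its [i]-neighbour [b] both lie in [H], their common panel is interior, so [u]
    stabilises both chambers as sets and fixes the vertex [a i], the only one of [a] not in [b]. By
    [root_one_bad] at most one type is left out; rank at least 2 provides another, so [a] is
    stabilised and its last vertex is fixed too. *)
Lemma root_fix a : chs S a -> H a -> u \o a = a.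
Proof.
move=> Sa Ha; have [[[_ inj _] _] _] := ru.
have uinj v w : u v = u w -> v = w by apply: inj; rewrite inE; apply: vertexP.
pose good i := exists b, [/\ chs S b, adj i a b & H b].
have goodfix i : good i -> u @` range a = range a /\ u (a i) = a i.
  move=> [b [Sb ab Hb]].
  have ga := root_interior Sa Ha Sb ab Hb (ap_X aS Sa) (@subDsetl _ _ _).
  have sub : range a `\ a i `<=` range b by move=> v [av]; apply: (adj_range ab).
  have gb := root_interior Sa Ha Sb ab Hb (ap_X aS Sb) sub.
  split=> //; have : range a (u (a i)) by rewrite -ga; exists (a i) => //; exists i.
  move=> av; have [//|ne] := pselect (u (a i) = a i).
  have : range b (u (a i)) by apply: sub.
  rewrite -gb => -[w bw /uinj ew]; rewrite ew in bw.
  have := chs_vertex Sb bw; rewrite (proj2 Sa) => e.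
  by case: (adj_neq ab).
have bad_uniq i j : ~ good i -> ~ good j -> i = j.
  move=> gi gj; have [b Sb ab] := cx_nb cxS i Sa; have [c Sc ac] := cx_nb cxS j Sa.
  apply: (root_one_bad Sa Ha Sb ab _ Sc ac); apply/negP => h.
    by apply: gi; exists b.
  by apply: gj; exists c.
apply/funext => i /=; have [/goodfix[] //|bi] := pselect (good i).
have gj j : j <> i -> good j by move=> ji; apply: contrapT => /(bad_uniq _ _)/(_ bi).
have [j ji] : exists j, j <> i.
  have : 0 < #|predC1 i| by rewrite cardC1; lia.
  by move=> /card_gt0P[j]; rewrite inE => /eqP; exists j.
have [ga _] := goodfix _ (gj _ ji).
have : range a (u (a i)) by rewrite -ga; exists (a i) => //; exists i.
move=> [k _ ek]; have [ki|/eqP ki] := eqVneq k i; first by rewrite -ek ki.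
have [_ uk] := goodfix _ (gj _ ki).
by have := uinj (a k) (a i); rewrite uk ek => /(_ erefl).
Qed.

Lemma root_chamber : exists2 a, chs S a & H a.
Proof.
case: rH => c [e [i [Sc Se ce HP]]]; exists c => //.
by rewrite HP // /side distxx // (dist1 cS Sc Se ce).
Qed.

Lemma root_typed_aut : typed_aut u.
Proof.
have [ua _] := ru; split=> // v; have [a Sa Ha] := root_chamber.
have [c [Xc cv]] := proj1 (simplex_face Delta _) (vertexP Delta v).
have {cv}[i _ <-] : range c v by apply: cv.
rewrite (proj2 Xc); apply: (chs_typed cX (ap_X aS Sa) Xc).
  by move=> x [kx _]; apply: isomorphism_chamber ua kx; exact: complexD.
by move=> j; rewrite -[u (a j)]/((u \o a) j) root_fix // (proj2 Sa).
Qed.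

Lemma root_fix_adj a b x i : chs S a -> H a -> chs S b -> adj i a b -> H b -> X x ->
  adj i a x -> u \o x = x.
Proof.
move=> Sa Ha Sb ab Hb Xx ax.
apply: (aut_fix_adj root_typed_aut (root_fix Sa Ha) Xx ax).
apply: (root_interior Sa Ha Sb ab Hb Xx) => v [av]; exact: (adj_range ax).
Qed.

End RootElement.

(* If all chambers of one apartment of the residue of G are good, then so are
   those of every apartment sharing half of it: a fixed chamber opposite to a good
   one in the residue is good, by projecting panels. *)
Section StarFix.
Variables (g : V -> V) (G : set V).
Hypothesis ag : typed_aut g.

Let good x := g \o x = x /\
  forall i y, star X G y -> adj i x y -> g \o y = y.

Let good_ap S := [/\ apartments S, star (chs S) G !=set0 &
  forall x, star (chs S) G x -> good x].

Lemma good_opp S y y' : apartments S -> far (chs S) G y y' -> g \o y = y ->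
  good y' -> good y.
Proof.
move=> aS yy' gy [gy' gd]; split=> // i w sw yw; have cxS := ap_coxeter aS.
have [[Sy Gy] [Sy' Gy'] sep] := yy'; have [Xy Xy'] := (ap_X aS Sy, ap_X aS Sy').
have nGi : ~ G (y i) by apply: X_star_type (conj Xy Gy) sw yw.
have [y2 Sy2 yy2] := cx_nb cxS i Sy.
have sy2 : star (chs S) G y2 := star_adj (conj Sy Gy) Sy2 yy2 nGi.
have [b [k [far2 yb]]] := far_adj cxS sy2 yy2 yy'.
have [_ [Sb Gb] sep2] := far2.
pose Q := range y `\ y i; pose Q' := range y' `\ y' k.
(* A wall contains [Q] when it separates [y] from [y2], and [Q'] when it separates [y'] from [b];
   both [y], [y'] and [y2], [b] are opposite in the star, so these are the same walls. *)
have pQ : pair_in Delta (@par V I) Q Q'.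
  exists S; split=> //; [by exists y; split=> // v []|by exists y'; split=> // v []|].
  move=> H rH; rewrite (panel_cuts aS rH Sy Sy2 yy2) (panel_cuts aS rH Sy' Sb yb).
  split=> ne.
    have cu : cuts (chs S) H G by exists y, y2.
    by move: ne (sep _ rH cu) (sep2 _ rH cu); do 4!case: (H _).
  have cu : cuts (chs S) H G by exists y', b.
  by move: ne (sep _ rH cu) (sep2 _ rH cu); do 4!case: (H _).
have sQw : star X Q w by case: sw => Xw _; split=> // v [yv]; apply: (adj_range yw).
have [Xw _] := sw.
have sQ' : star X Q' !=set0 by exists y'; split=> // v [].
have gp := prjP Xw sQ'; have [[Xp Qp] _] := gp.
have gpp : g \o prj Delta Q' w = prj Delta Q' w.
  have [<-//|ne] := pselect (y' = prj Delta Q' w).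
  have yp := panel_adj Sy' Xp ne Qp.
  apply: (gd k) => //; apply: (X_star_adj (conj Xy' Gy') Xp yp).
  exact: X_star_type (conj Xy' Gy') (conj (ap_X aS Sb) Gb) yb.
have gQ' : g @` Q' = Q' by apply: image_fix; apply: (fix_sub gy') => v [].
have gQ : g @` Q = Q by apply: image_fix; apply: (fix_sub gy) => v [].
(* [g] fixes both panels and the projection of [w], so [w] and [g \o w] have the same projection,
   and projecting back identifies them. *)
have gate2 := aut_gate ag Xw gp; rewrite gQ' gpp in gate2.
have sgw := aut_star ag sQw; rewrite gQ in sgw.
apply: (X_gate_uniq Xp); first exact: gate_invX pQ sgw gate2.
exact: gate_invX pQ sQw gp.
Qed.

Lemma good_step S a d k : good_ap S -> star (chs S) G a -> star X G d -> adj k a d ->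
  exists2 S', good_ap S' & chs S' d.
Proof.
move=> [aS nG gS] sa sd ad; have cxS := ap_coxeter aS.
have [[Sa Ga] [Xd Gd]] := (sa, sd); have bdS := ap_bounded aS sph.
have nGk : ~ G (a k) by apply: X_star_type (conj (ap_X aS Sa) Ga) sd ad.
have [a1 Sa1 aa1] := cx_nb cxS k Sa.
have sa1 : star (chs S) G a1 := star_adj sa Sa1 aa1 nGk.
have [S' [f [z [[aS' fi] fz [S'd S'z S'a] [fa1 fzz fa] fH]]]] :=
  swap_apartment aS sa sa1 aa1 Xd ad.
have cxS' := ap_coxeter aS'.
have fG : f @` G = G by apply: image_fix; apply: (fix_sub fa).
have cu : cuts (chs S) (side (chs S) a a1) G.
  by exists a, a1; split=> //; apply: (side_sep cxS Sa Sa1 aa1).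
have rH := rt_side Sa Sa1 aa1.
exists S' => //; split=> //; first by exists d.
move=> y sy; have [Sy Gy] := sy.
have [x Sx ex] := iso_surj cxS cxS' fi (ex_intro _ _ Sa) Sy.
have sx : star (chs S) G x.
  by apply: (iso_star_inv fi sa Sx); rewrite fG ex.
(* Chambers on the side of [a] are unchanged by [f]. Any other [y] is opposite such a chamber in the
   star, and lies between the fixed chambers [d] and [z]. *)
have [Hx|Hx] := boolP (side (chs S) a a1 x); first by rewrite -ex fH //; apply: gS.
have [x' xx'] := far_ex cxS bdS sx; have [_ sx' sep] := xx'.
have Hx' : side (chs S) a a1 x'.
  by have := sep _ rH cu; move: Hx; do 2!case: side.
have fx' := fH _ sx' Hx'.
have fary : far (chs S') G y x'.
  by have := iso_far cxS cxS' fi xx'; rewrite fG ex fx'.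
have gy : g \o y = y.
  have [_ sz _] := fz; have [gz _] := gS _ sz; have [_ ga] := gS _ sa.
  have gd := ga _ _ sd ad.
  have farz : far (chs S') G d z.
    by have := iso_far cxS cxS' fi fz; rewrite fG fa1 fzz.
  apply: (aut_fix_btw ag aS' S'd S'z Sy gd gz); apply/(ap_btw aS') => //.
  exact: (far_btw cxS' farz sy).
exact: (good_opp aS' fary gy (gS _ sx')).
Qed.

Lemma star_fix S x : good_ap S -> star X G x -> g \o x = x.
Proof.
move=> gS sx; have [aS [a sa] _] := gS.
have saX : star X G a by case: sa => Sa Ga; split=> //; apply: ap_X aS _ Sa.
have [n] := X_star_gal saX sx; elim: n S a {saX} gS {aS} sa => [|n IH] S a gS sa /=.
  by move=> [_ <-]; have [_ _ /(_ _ sa) []] := gS.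
move=> [e [i [_ ae h]]]; have [se _] := gal_in h.
have [S' gS' S'e] := good_step gS sa se ae.
by apply: (IH S' e gS' _ h); split=> //; case: se.
Qed.

End StarFix.

Lemma root_star_fix S al H u G x : 2 <= #|I| -> apartments S -> rt (chs S) H ->
  (forall F, al F <-> exists2 x, star (chs S) F x & H x) ->
  root_group Delta S al u -> (exists2 a, star (chs S) G a & H a) ->
  ~ cuts (chs S) H G -> star X G x -> u \o x = x.
Proof.
move=> rank2 aS rH alH ru [a0 sa0 Ha0] nc.
have allH a : star (chs S) G a -> H a.
  by move=> sa; apply/negPn/negP => Ha; apply: nc; exists a0, a; rewrite Ha0 (negbTE Ha).
have cxS := ap_coxeter aS.
apply: (star_fix (root_typed_aut aS rH alH ru rank2) (S := S)).
split=> //; first by exists a0.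
move=> a sa; have [Sa Ga] := sa; split.
  exact: (root_fix aS rH alH ru rank2 Sa (allH _ sa)).
move=> i y sy ay; have [b Sb ab] := cx_nb cxS i Sa.
have nGi : ~ G (a i) by apply: X_star_type (conj (ap_X aS Sa) Ga) sy ay.
have sb := star_adj sa Sb ab nGi.
apply: (root_fix_adj aS rH alH ru rank2 Sa (allH _ sa) Sb ab (allH _ sb) _ ay).
by case: sy.
Qed.

End RootGroups.

(** * Even projectivities and the group generated by the root groups *)

Section Main.
Variables (V : Type) (I : finType) (Delta : building V I).
Local Notation ch := (I -> V).
Local Notation simplices := (simplices Delta).
Local Notation apartments := (apartments Delta).
Local Notation typ := (typ Delta).
Local Notation chs := (chs Delta).
Implicit Types (a b c d e x y z : ch) (i j k : I) (f r : V -> V)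
  (F G K C D : set V) (S : set (set V)) (H : ch -> bool) (v w : V).
Local Notation X := (chs simplices).
Local Notation res := (res_vertices Delta).
Local Notation typed_aut := (typed_aut Delta).
Local Notation prj := (prj Delta).
Local Notation perspectivity := (perspectivity Delta).
Local Notation projectivity := (projectivity Delta).
Hypothesis sph : spherical Delta.

(** * Chamber maps *)

(** Carrying [T] along with [f] reduces equalities of vertex maps on residues to equalities of
    chamber maps, through [chamber_map_uniq]. *)
Definition chamber_map F G (T : ch -> ch) f :=
  [/\ forall v, res F v -> res G (f v),
      forall u v, res F u -> res F v -> f u = f v -> u = v &
      forall c, star X F c -> star X G (T c) /\
        range (T c) = G `|` f @` (range c `\` F)].

Lemma chamber_map_comp F G K T T' f f' : chamber_map F G T f ->
  chamber_map G K T' f' -> chamber_map F K (T' \o T) (f' \o f).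
Proof.
move=> [f1 f2 f3] [g1 g2 g3]; split.
- by move=> v /f1/g1.
- by move=> u v ru rv /(g2 _ _ (f1 _ ru) (f1 _ rv)); apply: f2.
move=> c sc; have [sT eT] := f3 _ sc; have [sT' eT'] := g3 _ sT.
split=> //; rewrite /= eT' eT -image_comp; congr (_ `|` _ @` _).
apply/seteqP; split=> [w [[//|//]]|_ [v [cv nv] <-]].
have rv : res F v by case: cv nv => i _ <-; apply: star_res.
by split; [right; exists v|case: (f1 _ rv)].
Qed.

Lemma chamber_map_uniq F G T T' f f' : chamber_map F G T f -> chamber_map F G T' f' ->
  (forall c, star X F c -> T c = T' c) -> forall v, res F v -> f v = f' v.
Proof.
move=> [f1 _ f3] [g1 g2 g3] e.
apply: (res_map_uniq (T := fun c => range (T c)) f1 g1 g2).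
  by move=> c /f3[].
by move=> c sc; rewrite e //; case: (g3 _ sc).
Qed.

Lemma perspectivity_map F G f : perspectivity F G f -> chamber_map F G (prj G) f.
Proof.
move=> pf; have [o _ _ _ _] := pf; have [_ sG] := pair_X (opposite_par sph o).
split.
- by move=> v; apply: perspectivity_res pf.
- by move=> u v; apply: perspectivity_inj pf.
move=> c sc; split; last exact: (perspectivityE sph pf sc).
by apply: prj_star => //; case: sc.
Qed.

Lemma aut_res g F v : typed_aut g -> res F v -> res (g @` F) (g v).
Proof.
move=> ag /resP[nF [c [Xc Fc [i _ ci]]]]; apply/resP; split.
  by move=> [u Fu /(aut_inj ag) e]; apply: nF; rewrite -e.
have [Xg Fg] := aut_star ag (conj Xc Fc : star X F c).
by exists (g \o c); split=> //; exists i => //=; rewrite ci.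
Qed.

Lemma aut_map g F : typed_aut g -> chamber_map F (g @` F) (fun c => g \o c) g.
Proof.
move=> ag; split.
- by move=> v; apply: aut_res.
- by move=> u v _ _; apply: (aut_inj ag).
move=> c sc; split; first exact: aut_star.
by rewrite -image_setU setDUK ?image_comp //; case: sc.
Qed.

Lemma projectivityW n F F' f : projectivity n F F' f ->
  if n is m.+1 then exists F1 f1 g, [/\ projectivity m F F1 f1,
    perspectivity F1 F' g & f = g \o f1]
  else F = F' /\ f = id.
Proof. by case=> // {}n F0 F1 F2 f1 g h1 h2; exists F1, f1, g. Qed.

Lemma projectivity_cat n m F F' F'' f g : projectivity n F F' f ->
  projectivity m F' F'' g -> projectivity (n + m) F F'' (g \o f).
Proof.
move=> h; elim: m F'' g => [|m IH] F'' g /projectivityW.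
  by move=> [<- ->]; rewrite addn0.
by move=> [F1 [f1 [g1 [h1 h2 ->]]]]; rewrite addnS; apply: ProjectivityS (IH _ _ h1) h2.
Qed.

Lemma perspectivity1 F G f : perspectivity F G f -> projectivity 1 F G f.
Proof. by move=> h; apply: (ProjectivityS (Projectivity0 Delta F) h). Qed.

(** * The group generated by the root groups *)

Lemma aut_dagger_id : aut_dagger Delta id.
Proof. by move=> G [h _ _] _. Qed.

Lemma aut_dagger_comp f g : aut_dagger Delta f -> aut_dagger Delta g ->
  aut_dagger Delta (f \o g).
Proof. by move=> hf hg G pG sG; case: (pG) => _ h _; apply: h; [apply: hf|apply: hg]. Qed.

Lemma aut_dagger_root S al u : apartments S -> Defs.root S al ->
  root_group Delta S al u -> aut_dagger Delta u.
Proof. by move=> aS ral ru G _; apply; exists S, al. Qed.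

Lemma typed_aut_id : typed_aut id.
Proof.
split=> //; split; first by split=> // v hv; exists v.
by move=> A _; rewrite image_id.
Qed.

Lemma typed_aut_comp f g : typed_aut f -> typed_aut g -> typed_aut (f \o g).
Proof.
move=> af ag; split; last by move=> v /=; rewrite (proj2 af) (proj2 ag).
split; first split.
- by move=> v _; apply: vertexD.
- by move=> u v _ _ /(aut_inj af)/(aut_inj ag).
- move=> w _; have [[[_ _ s1] _] _] := af; have [[[_ _ s2] _] _] := ag.
  have [v _ ev] := s1 w (vertexD Delta w); have [u _ eu] := s2 v (vertexD Delta v).
  by exists u; [apply: vertexD|rewrite /= eu].
by move=> A _; rewrite -image_comp -(aut_simplex af) -(aut_simplex ag).
Qed.

Hypothesis rank2 : 2 <= #|I|.

Section Moufang.
Hypothesis mouf : moufang Delta.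

(** Swapping with [G = set0] gives an apartment [S'] through [x] that shares the root of [c] with
    [S]; the Moufang condition moves [S] to [S'], and thinness identifies the image of [e] with
    [x]. *)
Lemma moufang_root S c e x i : apartments S -> chs S c -> chs S e -> adj i c e ->
  X x -> adj i c x -> exists u, [/\ typed_aut u, aut_dagger Delta u, u \o e = x,
    u \o c = c &
    forall G y, (exists2 a, star (chs S) G a & side (chs S) c e a) ->
      ~ cuts (chs S) (side (chs S) c e) G -> star X G y -> u \o y = y].
Proof.
move=> aS Sc Se ce Xx cx; have cxS := ap_coxeter aS.
have rH := rt_side Sc Se ce.
have [al ral alH] := rt_root aS rH.
have [S' [f [z [[aS' fi] _ [S'x _ S'c] _ fH]]]] :=
  swap_apartment sph aS (star0 Sc) (star0 Se) ce Xx cx.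
have alS : al `<=` S.
  by move=> F /alH[y sy _]; apply/(apartment_face _ aS); exists y.
have alS' : al `<=` S'.
  move=> F /alH[y [Sy Fy] Hy]; apply/(apartment_face _ aS'); exists y; split=> //.
  by rewrite -(fH y (star0 Sy) Hy); case: fi => + _; apply.
have [u ru uS] := mouf aS ral aS aS' alS alS'.
have au := root_typed_aut aS rH alH ru rank2.
have Hc : side (chs S) c e c.
  by rewrite /side distxx // (dist1 (cx_conn cxS) Sc Se ce).
have uc := root_fix aS rH alH ru rank2 Sc Hc.
have S'u : chs S' (u \o e).
  apply: (apartment_chs aS'); first exact: (aut_X au (ap_X aS Se)).
  by rewrite -uS; exists (range e); [case: Se => -[]|rewrite image_comp].
exists u; split=> //; first exact: aut_dagger_root ral ru.
- apply: (cx_thin (ap_coxeter aS') S'c S'u S'x _ cx).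
  by rewrite -[in X in adj _ X]uc; apply: (aut_adj au).
by move=> G y; apply: (root_star_fix sph rank2 aS rH alH ru).
Qed.

(* Carry, one step at a time, a gallery from c to the projection of c onto F to
   the corresponding gallery towards F'. *)
Lemma opposite_transitive G F F' : opposite Delta G F -> opposite Delta G F' ->
  exists g, [/\ typed_aut g, aut_dagger Delta g, g @` F = F' &
    forall y, star X G y -> g \o y = y].
Proof.
move=> /(oppositeP sph) oF /(oppositeP sph) oF'.
have [[c sc] [e0 se0]] := pair_X oF; have [_ [e1 se1]] := pair_X oF'.
have [S [aS Sc Se0 oS]] := pair_join (opp_simplex_inv sph) oF sc se0.
have [S' [aS' S'c S'e1 oS']] := pair_join (opp_simplex_inv sph) oF' sc se1.
have [Xc Gc] := sc; have cxS := ap_coxeter aS; have cxS' := ap_coxeter aS'.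
have cS := cx_conn cxS.
have SG : S G by apply/(apartment_face _ aS); exists c.
have S'G : S' G by apply/(apartment_face _ aS'); exists c.
have [f [fi fc fG]] := apartment_chs_iso aS aS' Sc S'c SG S'G cS.
have bdS := ap_bounded aS sph; have bdS' := ap_bounded aS' sph.
have fF : f @` F = F'.
  have := iso_opp_simplex cxS cxS' bdS fi oS; rewrite (image_fix fG) => o.
  exact: (opp_simplex_uniq cxS' bdS' o oS').
have sF : star (chs S) F !=set0 by exists e0; split=> //; case: se0.
have [b gb] := gate_ex cxS Sc sF; have [[Sb Fb] _] := gb.
have prS := opp_simplex_par cxS bdS oS.
(* It suffices to send [b] to [f \o b], since [b] contains [F] and [f] maps [F] to [F'], the only
   simplex of [S'] opposite [G]. *)
suff [g [ag dg gfb gG]] : exists g, [/\ typed_aut g, aut_dagger Delta g,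
    g \o b = f \o b & forall y, star X G y -> g \o y = y].
  exists g; split=> //; rewrite -fF; apply/seteqP; split=> _ [v Fv <-];
    exists v => //; case: (Fb _ Fv) => j _ <-.
    exact: (congr1 (@^~ j) (esym gfb)).
  exact: (congr1 (@^~ j) gfb).
suff H n y g : chs S y -> dist (chs S) y b = n -> btw (chs S) c y b ->
    typed_aut g -> aut_dagger Delta g -> g \o y = f \o y ->
    (forall y, star X G y -> g \o y = y) ->
    exists g, [/\ typed_aut g, aut_dagger Delta g,
    g \o b = f \o b & forall y, star X G y -> g \o y = y].
  apply: (H _ c id Sc erefl) => //; [|exact: typed_aut_id|exact: aut_dagger_id].
  by rewrite /btw distxx.
elim: n y g => [|n IH] y g Sy dn bt ag dg gy gG.
  by exists g; split=> //; rewrite -(dist0 cS Sy Sb dn).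
have [|y1 [i [Sy1 yy1 dy1 hb]]] := step_sep cxS Sy Sb.
  by move=> e; move: dn; rewrite e distxx.
have rH := rt_side Sy Sy1 yy1.
have hy : side (chs S) y y1 y by rewrite /side distxx // (dist1 cS Sy Sy1 yy1).
have hc : side (chs S) y y1 c.
  apply/negPn/negP => hc; have := btw_rt cxS Sc Sy Sb bt rH.
  by rewrite hy hb (negbTE hc) => /(_ erefl).
(* No wall through [F] separates [c] from its gate [b], and opposite simplices lie in the same
   walls. *)
have ncG : ~ cuts (chs S) (side (chs S) y y1) G.
  by move/(prS _ rH)/(gate_rt cxS Sc gb rH); rewrite hc hb.
have [S1 aS1 gi] := aut_apartment sph ag aS; have cxS1 := ap_coxeter aS1.
have S1y : chs S1 (g \o y) by case: gi => + _; apply.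
have S1y1 : chs S1 (g \o y1) by case: gi => + _; apply.
have Xfy : X (f \o y1) by apply: (ap_X aS'); case: fi => + _; apply.
have gc : g \o c = c by apply: gG.
have [|u [au du ue uy uG]] := moufang_root aS1 S1y S1y1 (aut_adj ag yy1) Xfy.
  by rewrite gy; apply: (iso_adj fi).
apply: (IH y1 (u \o g)) => //.
- by lia.
- have := dist_tri cS Sc Sy1 Sb; have := dist_tri cS Sc Sy Sy1.
  by move: bt; rewrite /btw (dist1 cS Sy Sy1 yy1); lia.
- exact: typed_aut_comp.
- exact: aut_dagger_comp.
move=> z sz; rewrite -[LHS]/(u \o (g \o z)) (gG _ sz).
apply: (uG G) => //.
  exists c; first by split=> //; rewrite -gc; case: gi => + _; apply.
  by rewrite -[in X in _ X]gc (iso_side cxS cxS1 gi).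
have gGG : g @` G = G by apply: image_fix; apply: (fix_sub gc).
rewrite -gGG (iso_cuts cxS cxS1 gi); last by exists c.
move=> [p [q [sp sq ne]]]; apply: ncG; exists p, q; split=> //.
by move: ne; rewrite !(iso_side cxS cxS1 gi) //; [case: sq|case: sp].
Qed.

Lemma even_projectivity_aut n F F' f : ~~ odd n -> projectivity n F F' f ->
  exists g, [/\ typed_aut g, aut_dagger Delta g, g @` F = F' &
    forall v, res F v -> g v = f v].
Proof.
move: {2}n (leqnn n) => m; elim: m n F' f => [|m IH] n F' f.
  rewrite leqn0 => /eqP -> _ /projectivityW[<- ->].
  by exists id; split=> //; [exact: typed_aut_id|exact: aut_dagger_id|exact: image_id].
case: n => [_ _ /projectivityW[<- ->]|[//|n]].
  by exists id; split=> //; [exact: typed_aut_id|exact: aut_dagger_id|exact: image_id].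
rewrite /= negbK => nm odn /projectivityW[F2 [f2 [q [/projectivityW h pq ->]]]].
have [F1 [f1 [p [h1 pp ef]]]] := h.
have [g [ag dg gF gf]] := IH n F1 f1 (ltnW nm) odn h1.
have [o1 _ _ _ _] := pp; have [o2 _ _ _ _] := pq.
have [u [au du uF uG]] := opposite_transitive (opposite_sym sph o1) o2.
exists (u \o g); split.
- exact: typed_aut_comp.
- exact: aut_dagger_comp.
- by rewrite -(image_comp g u) gF.
move=> v rv; rewrite ef /= (gf _ rv).
have rv1 : res F1 (f1 v) by rewrite -gF -gf //; apply: aut_res.
have mu := aut_map F1 au; rewrite uF in mu.
have mpq := chamber_map_comp (perspectivity_map pp) (perspectivity_map pq).
apply: (chamber_map_uniq mu mpq _ rv1) => c sc /=.
have [Xc _] := sc; have pr := opposite_par sph o1; have [_ s2] := pair_X pr.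
have gp := prjP Xc s2; have [sp _] := gp; have [Xp _] := sp.
apply/esym/gate_prj => //.
by have := aut_gate au Xp (gate_invX pr sc gp); rewrite uF (uG _ sp).
Qed.

End Moufang.

(** * Automorphisms acting as projectivities *)

Definition proper F := [/\ simplices F, F !=set0 & ~ chamber simplices F].

(** A simplex of an apartment that is not a chamber lies in some wall, and a chamber lies in none;
    opposite simplices lie in the same walls. *)
Lemma opposite_proper F G : opposite Delta F G -> proper F -> proper G.
Proof.
move=> [S aS oS] [_ [v Fv] nF]; have [SF SG h _] := oS.
split; [exact: apartment_sub SG|by have [w Gw _] := h _ Fv; exists w|].
move=> kG; have o := proj1 (opposite_inP aS sph F G) oS.
have cxS := ap_coxeter aS; have pr := opp_simplex_par cxS (ap_bounded aS sph) o.
have [a sa] := proj1 (apartment_face _ aS) SF; have [Sa Fa] := sa.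
have [g Xg eg] := chamber_fun kG.
have [i nFi] : exists i, ~ F (a i).
  apply: contrapT => no; apply: nF; have -> : F = range a.
    apply/seteqP; split=> // _ [i _ <-]; apply: contrapT => nFi; apply: no.
    by exists i.
  by case: (ap_X aS Sa).
have [b Sb ab] := cx_nb cxS i Sa; have rH := rt_side Sa Sb ab.
have [x [y [[Sx Gx] [Sy Gy]]]] : cuts (chs S) (side (chs S) a b) G.
  apply/(pr _ rH); exists a, b; split=> //; last exact: (side_sep cxS Sa Sb ab).
  exact: star_adj ab nFi.
rewrite -eg in Gx Gy; rewrite -(chs_sub Xg Sx Gx) -(chs_sub Xg Sy Gy).
by rewrite eqxx.
Qed.

Lemma aut_proper g F : typed_aut g -> proper F -> proper (g @` F).
Proof.
move=> ag [sF [v Fv] nF]; split; first exact: (proj1 (aut_simplex ag F) sF).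
  by exists (g v), v.
move=> kF; apply: nF; have [g' [ag' gK _]] := aut_inv ag.
have := isomorphism_chamber (complexD Delta) (complexD Delta) (proj1 ag') kF.
by rewrite image_comp image_fix // => w _; apply: gK.
Qed.

Definition acts_projectively g F := exists n f,
  [/\ ~~ odd n, projectivity n F (g @` F) f & forall v, res F v -> f v = g v].

Lemma acts_opposite g F G : typed_aut g -> proper F -> opposite Delta F G ->
  acts_projectively g G -> acts_projectively g F.
Proof.
move=> ag pF oFG [n [q [en pq hq]]].
have pG := opposite_proper oFG pF.
have pgF := aut_proper ag pF; have pgG := aut_proper ag pG.
have [[_ nF kF] [_ nG kG]] := (pF, pG).
have [[_ ngF kgF] [_ ngG kgG]] := (pgF, pgG).
have [p pp] := perspectivity_ex sph oFG nF nG kF kG.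
have ogGF := opposite_sym sph (aut_opposite sph ag oFG).
have [r pr] := perspectivity_ex sph ogGF ngG ngF kgG kgF.
exists n.+2, (r \o (q \o p)); split; first by rewrite /= negbK.
  apply: (ProjectivityS _ pr).
  by rewrite -add1n; apply: projectivity_cat (perspectivity1 pp) pq.
have mp := perspectivity_map pp; have [rp _ _] := mp.
move=> v rv; rewrite /= hq; last exact: rp.
(* As [g] commutes with projections, projecting to [G], applying [g] and projecting to the image of
   [F] amounts to applying [g]. *)
have m1 := chamber_map_comp (chamber_map_comp mp (aut_map G ag)) (perspectivity_map pr).
apply: (chamber_map_uniq m1 (aut_map F ag) _ rv) => c sc /=.
have [Xc _] := sc; have par := opposite_par sph oFG; have [_ sG] := pair_X par.
have gp := prjP Xc sG; have [[Xp _] _] := gp.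
apply: gate_prj; first exact: aut_X.
exact: (aut_gate ag Xp (gate_invX par sc gp)).
Qed.

Lemma third_chamber c d i : X c -> X d -> adj i c d ->
  exists x, [/\ X x, adj i x c & adj i x d].
Proof.
move=> Xc Xd cd.
have pan : panel simplices (range c `\ c i).
  by exists (range c); [case: Xc|exists (c i) => //; exists i].
have /pcard_leP[f] := thickP pan.
have fin n : n < 3 -> chambers_on simplices (range c `\ c i) (f n).
  by move=> n3; exact: (@funS _ _ _ _ f n n3).
have finj n m : n < 3 -> m < 3 -> f n = f m -> n = m.
  by move=> n3 m3; apply: (@inj _ _ _ f); rewrite inE.
have [n n3 [nc nd]] : exists2 n, n < 3 & f n <> range c /\ f n <> range d.
  apply: contrapT => no.
  have h n : n < 3 -> f n = range c \/ f n = range d.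
    move=> n3; apply: contrapT => /not_orP[h1 h2]; apply: no; exists n => //.
  have e n m : n < 3 -> m < 3 -> n != m -> f n <> f m.
    by move=> n3 m3 /eqP nm /(finj _ _ n3 m3).
  have e01 := e 0 1 isT isT isT; have e02 := e 0 2 isT isT isT.
  have e12 := e 1 2 isT isT isT.
  by have [] := h 0 isT; have [] := h 1 isT; have [] := h 2 isT; congruence.
have [x sx ex] := proj1 (chambers_onE _ _ _) (fin n n3); have [Xx Px] := sx.
have cx : adj i c x by apply: (panel_adj Xc Xx) => // e; apply: nc; rewrite -ex e.
exists x; split=> //; first exact: adj_sym.
have [e|dx] := adj_trans cd cx; last exact: adj_sym.
by case: nd; rewrite -ex e.
Qed.

Definition face c (J : set I) : set V := c @` J.

Lemma face_sub c J : face c J `<=` range c.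
Proof. by move=> _ [j _ <-]; exists j. Qed.

(* Adjacent chambers have a common opposite, because panels are thick. *)
Lemma opposite_faces c d i J : X c -> X d -> adj i c d ->
  exists G, opposite Delta (face c J) G /\ opposite Delta (face d J) G.
Proof.
move=> Xc Xd cd; have [x [Xx xc xd]] := third_chamber Xc Xd cd.
have [S [aS Sc Sx]] := apartment_chs_join Xc Xx; have cxS := ap_coxeter aS.
have bdS := ap_bounded aS sph.
(* The swap replaces [c] by [d] and keeps [z], opposite [c]; the simplex [G] opposite the face of
   [c] lies in [z], so it is kept too. *)
have [S' [f [z [[aS' fi] cz _ [fc fz _] _]]]] :=
  swap_apartment sph aS (star0 Sx) (star0 Sc) xc Xd xd.
have [_ Sz] := opp_in cz.
have sJ : star (chs S) (face c J) c by split=> //; apply: face_sub.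
have [G oG] := opp_simplex_ex cxS bdS sJ; have [nF nG hG] := oG.
have [_ Gz] := proj1 (hG _ _ cz) sJ.
exists G; split; apply/(oppositeP sph); first by exists S; split.
have := opp_simplex_inv sph aS aS' fi nF nG oG.
rewrite (image_fix (fix_sub fz Gz)) /face image_comp fc => o.
by exists S'; split=> //; case: o.
Qed.

Lemma acts_face g c d J : typed_aut g -> X c -> X d -> proper (face c J) ->
  acts_projectively g (face d J) -> acts_projectively g (face c J).
Proof.
move=> ag Xc Xd; have [n] := @X_conn V I Delta c d Xc Xd.
elim: n c Xc => [|n IH] c Xc /=; first by move=> [_ ->].
move=> [e [i [_ ce h]]] pc hd; have [Xe _] := gal_in h.
have [G [oc oe]] := opposite_faces J Xc Xe ce.
have pG := opposite_proper oc pc.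
have pe := opposite_proper (opposite_sym sph oe) pG.
apply: (acts_opposite ag pc oc); apply: (acts_opposite ag pG (opposite_sym sph oe)).
exact: IH.
Qed.

(** * The Coxeter diagram *)

Lemma iso_square S S' f j k a b c d : apartments S -> apartments S' ->
  iso (chs S) (chs S') f ->
  [/\ chs S a /\ chs S b, chs S c /\ chs S d, adj j a b /\ adj k b c &
    adj j c d /\ adj k d a] ->
  [/\ chs S' (f \o a) /\ chs S' (f \o b), chs S' (f \o c) /\ chs S' (f \o d),
    adj j (f \o a) (f \o b) /\ adj k (f \o b) (f \o c) &
    adj j (f \o c) (f \o d) /\ adj k (f \o d) (f \o a)].
Proof.
move=> aS aS' fi [[Sa Sb] [Sc Sd] [ab bc] [cd da]]; have [f1 _] := fi.
by split; split; first [exact: f1|apply: (iso_adj fi)].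
Qed.

(** Isomorphisms move the square to a chamber [x] containing the given [A]. Its four chambers
    contain [A] and are closed under adjacency in the star of [A], so by connectedness they exhaust
    it; four is [2 * 2]. *)
Lemma square_entry S j k : apartments S -> j <> k -> square (chs S) j k ->
  coxeter_entry Delta j k 2.
Proof.
move=> aS jk [a [b [c [d sq]]]] S' A aS' S'A tA.
have [x [S'x Ax]] := proj1 (apartment_face _ aS') S'A.
have [[Sa _] _ _ _] := sq.
have [S1 [aS1 S1a S1x]] := apartment_chs_join (ap_X aS Sa) (ap_X aS' S'x).
have cxS1 := ap_coxeter aS1; have cxS' := ap_coxeter aS'.
have e0 S0 (aS0 : apartments S0) : S0 set0 := proj1 (apartment_complex aS0).
have [f [fi fa _]] := apartment_chs_iso aS aS1 Sa S1a (e0 _ aS) (e0 _ aS1)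
  (cx_conn (ap_coxeter aS)).
have [h hi ha] := homogeneous cxS1 S1a S1x.
have [g [gi gx _]] := apartment_chs_iso aS1 aS' S1x S'x (e0 _ aS1) (e0 _ aS') (cx_conn cxS1).
have := iso_square aS1 aS' gi (iso_square aS1 aS1 hi (iso_square aS aS1 fi sq)).
rewrite fa ha gx; set b' := g \o _; set c' := g \o _; set d' := g \o _.
move=> [[_ Sb] [Sc Sd] [xb bc] [cd dx]].
have type_in v : A v -> typ v <> j /\ typ v <> k.
  move=> Av; have : (typ @` A) (typ v) by exists v.
  by rewrite tA => /= h1; split=> e; apply: h1; [left|right].
have sadj y z l : l = j \/ l = k -> star (chs S') A y -> chs S' z -> adj l y z ->
    star (chs S') A z.
  move=> hl sy Sz yz; apply: (star_adj sy Sz yz) => /type_in.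
  by rewrite (proj2 (proj1 sy)) => -[h1 h2]; case: hl.
have sx : star (chs S') A x by [].
have sb := sadj _ _ j (or_introl erefl) sx Sb xb.
have sc := sadj _ _ k (or_intror erefl) sb Sc bc.
have sd := sadj _ _ j (or_introl erefl) sc Sd cd.
pose u n := match n with 0 => x | 1 => b' | 2 => c' | _ => d' end.
have su n : star (chs S') A (u n) by case: n => [|[|[|n]]].
have closed y z l : star (chs S') A y -> star (chs S') A z -> adj l y z ->
    (exists2 n, n < 4 & y = u n) -> exists2 n, n < 4 & z = u n.
  move=> sy sz yz [n n4 yu].
  have lP : l = j \/ l = k.
    have : ~ (typ @` A) l.
      move=> [v Av vl]; apply: (adj_neq yz).
      have [[Sy Ay] [Sz Az]] := (sy, sz).
      by rewrite -vl -(chs_vertex Sy (Ay _ Av)) -(chs_vertex Sz (Az _ Av)).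
    by rewrite tA => /contrapT.
  have [Sz _] := sz; rewrite yu in yz.
  have thin p q q' m := @cx_thin _ _ _ _ cxS' p q q' m.
  case: n n4 yu yz => [|[|[|[|//]]]] _ _ /= yz; case: lP => e; rewrite e in yz.
  - by exists 1; [|apply: (thin x z b' j)].
  - by exists 3; [|apply: (thin x z d' k) => //; exact: adj_sym].
  - by exists 0; [|apply: (thin b' z x j) => //; exact: adj_sym].
  - by exists 2; [|apply: (thin b' z c' k)].
  - by exists 3; [|apply: (thin c' z d' j)].
  - by exists 1; [|apply: (thin c' z b' k) => //; exact: adj_sym].
  - by exists 2; [|apply: (thin d' z c' j) => //; exact: adj_sym].
  - by exists 0; [|apply: (thin d' z x k)].
have -> : chambers_on S' A = (fun n => range (u n)) @` `I_4.
  apply/seteqP; split=> [C [kC AC]|_ [n _ <-]]; last first.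
    by have [[kn _] An] := su n; split.
  have [y Sy ey] := chs_ex (@apartment_good _ _ _ _ ^~ aS') kC.
  have sy : star (chs S') A y by split=> //; rewrite ey.
  have := star_gal cxS' sx sy.
  have : exists2 n, n < 4 & x = u n by exists 0.
  move: (dist _ x y) => m; elim: m (x) => [|m IH] z /=.
    by move=> [n n4 zu] [_ zy]; exists n => //; rewrite -zu zy.
  move=> hz [w [l [sz zw hw]]]; have [sw _] := gal_in hw.
  exact: IH (closed _ _ _ sz sw zw hz) hw.
apply: inj_card_eq => n m; rewrite !inE /= => n4 m4 enm.
have {}enm : u n = u m by apply: (chs_inj (proj1 (su n)) (proj1 (su m))).
have xc : x <> c'.
  by move=> e; rewrite -e in bc; apply: jk; apply: adj_uniq xb (adj_sym bc).
have bd : b' <> d'.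
  by move=> e; rewrite -e in dx; apply: jk; apply: adj_uniq xb (adj_sym dx).
have [[nxb _] [nbc _] [ncd _] [ndx _]] := And4 xb bc cd dx.
case: n n4 enm => [|[|[|[|//]]]] _; case: m m4 => [|[|[|[|//]]]] _ //= e; exfalso;
  congruence.
Qed.

Section Irreducible.
Hypothesis irr : irreducible Delta.

Lemma irreducible_square S (J : set I) : apartments S -> J !=set0 -> ~` J !=set0 ->
  exists j k, [/\ J j, ~ J k, j <> k & ~ square (chs S) j k].
Proof.
move=> aS nJ nCJ; have [j [k [Jj Jk [jk ne]]]] := irr nJ nCJ.
by exists j, k; split=> // sq; apply: ne; apply: square_entry aS jk sq.
Qed.

Lemma root_acts S al u F : apartments S -> Defs.root S al -> root_group Delta S al u ->
  proper F -> acts_projectively u F.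
Proof.
move=> aS ral ru pF; have [H rH alH] := root_rt aS ral.
have [/simplex_face[c [Xc Fc]] [v Fv] _] := pF.
pose J := [set j | F (c j)].
have eF : F = face c J.
  apply/seteqP; split=> [w Fw|_ [j Jj <-] //].
  by have [j _ ej] := Fc _ Fw; exists j => //; rewrite /J /= ej.
have [i _ ei] := Fc _ Fv.
(* [i] is the type of a vertex of [F], so the face of [a] of the type of [F] has an interior vertex,
   and [u] acts on its residue as the projectivity of length 0. *)
have [a [Sa Ha nc]] := interior_vertex (ap_coxeter aS) i rH
  (fun J => @irreducible_square S J aS).
have au := root_typed_aut aS rH alH ru rank2; have Xa := ap_X aS Sa.
have uJ x : star X (face a J) x -> u \o x = x.
  apply: (root_star_fix sph rank2 aS rH alH ru).
    by exists a => //; split=> //; apply: face_sub.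
  move=> cu; apply: nc; apply: rt_sub_cuts cu => _ ->.
  by exists i => //; rewrite /J /= ei.
have sa : star X (face a J) a by split=> //; apply: face_sub.
rewrite eF in pF *; apply: (acts_face au Xc Xa pF).
exists 0, id; split=> //.
  have -> : u @` face a J = face a J; last exact: Projectivity0.
  by apply: image_fix; apply: (fix_sub (uJ _ sa)); apply: face_sub.
move=> w /resP[_ [x [Xx Fx [k _ <-]]]].
exact: (congr1 (@^~ k) (esym (uJ x (conj Xx Fx)))).
Qed.

Lemma root_group_inv S al u u' : root_group Delta S al u -> cancel u u' -> cancel u' u ->
  root_group Delta S al u'.
Proof.
move=> [[[f1 f2 f3] fi] h] uK u'K; split; last first.
  move=> C P kC PC aP bP; rewrite -{1}(h C P kC PC aP bP) image_comp image_fix //.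
  by move=> v _; apply: uK.
split; first split.
- by move=> v _; apply: vertexD.
- by move=> v w _ _ e; rewrite -(u'K v) e.
- by move=> v _; exists (u v); [exact: vertexD|].
move=> A _; rewrite [X in _ <-> X]fi; last by move=> v _; apply: vertexD.
by rewrite image_comp image_fix // => v _; apply: u'K.
Qed.

Lemma aut_dagger_acts g F : aut_dagger Delta g -> proper F -> acts_projectively g F.
Proof.
(* [good] ranges over all proper simplices because in a composition the outer factor acts on an
   image of [F]. It is also asked of the inverse, so that the elements form a permutation group. *)
move=> dg pF; pose good h := typed_aut h /\ forall F, proper F -> acts_projectively h F.
suff [g' [_ _ [_ hg] _]] : exists g', [/\ cancel g g', cancel g' g, good g & good g'].
  exact: hg.
have comp f h : good f -> good h -> good (f \o h).
  move=> [af hf] [ah hh]; split; first exact: typed_aut_comp.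
  move=> G pG; have [n [p [en pp ep]]] := hh _ pG.
  have [m [q [em pq eq]]] := hf _ (aut_proper ah pG).
  exists (n + m), (q \o p); split; first by rewrite oddD (negbTE en) (negbTE em).
    by rewrite -(image_comp h f); apply: projectivity_cat pp pq.
  by move=> v rv; rewrite /= (ep _ rv) eq //; apply: aut_res.
apply: (dg [set g | exists g', [/\ cancel g g', cancel g' g, good g & good g']]).
  split.
  - have gid : good id.
      split; first exact: typed_aut_id.
      by move=> G _; exists 0, id; split=> //; rewrite image_id; apply: Projectivity0.
    by exists id.
  - move=> f h [f' [fK f'K gf gf']] [h' [hK h'K gh gh']].
    exists (h' \o f'); split; [exact: can_comp|exact: can_comp|exact: comp|exact: comp].
  by move=> f [f' [fK f'K gf gf']]; exists f'; split=> //; exists f.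
move=> u [S [al [aS ral ru]]]; have [H rH alH] := root_rt aS ral.
have au := root_typed_aut aS rH alH ru rank2.
have [u' [au' uK u'K]] := aut_inv au.
have ru' := root_group_inv ru uK u'K.
by exists u'; split=> //; split=> // G; [apply: root_acts ru|apply: root_acts ru'].
Qed.

End Irreducible.
End Main.

Theorem theorem1 (V : Type) (I : finType) (Delta : building V I) (F : set V)
  (sphericalD : spherical Delta) (irreducibleD : irreducible Delta)
  (rankD : 2 <= #|I|) (moufangD : moufang Delta)
  (simplexF : simplices Delta F) (nonemptyF : F !=set0)
  (not_chamberF : ~ chamber (simplices Delta) F) :
  permutation_equivalent (special_projectivity_group Delta F)
    (induced (res_vertices Delta F) (stabiliser (aut_dagger Delta) F)).
Proof.
have resE (x : res_vertices Delta F) : res_vertices Delta F (\val x).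
  exact: set_mem (valP x).
(* The two groups are equal as sets of permutations of the vertices of the residue, so identity maps
   give the equivalence. *)
have e : special_projectivity_group Delta F =
    induced (res_vertices Delta F) (stabiliser (aut_dagger Delta) F).
  apply/seteqP; split=> h.
    move=> [f [n en pf] hf].
    have [g [ag dg gF gf]] := even_projectivity_aut sphericalD rankD moufangD en pf.
    by exists g => // x; rewrite hf gf.
  move=> [g [dg gF] hg].
  have [n [f [en pf fg]]] := aut_dagger_acts sphericalD rankD irreducibleD dg
    (And3 simplexF nonemptyF not_chamberF : proper Delta F).
  rewrite gF in pf; exists f; first by exists n.
  by move=> x; rewrite hg fg.
rewrite e; exists id, id; split=> //; first by exists id.
by split=> // f hf; exists f.
Qed.
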